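(* Let $\Gamma$ be a countable residually finite amenable group, and let $f,g\in\mathbb{Z}\Gamma$ be elements such that the algebraic $\Gamma$-actions $\alpha_f$ on $X_f$ and $\alpha_g$ on $X_g$ are expansive. Then $\alpha_{f^*}$ (on $X_{f^*}$) and $\alpha_{f\cdot g}$ (on $X_{f\cdot g}$) are expansive, $h(\alpha_{f^*})=h(\alpha_f)$ and $h(\alpha_{f\cdot g})=h(\alpha_f)+h(\alpha_g)$.
   Context: For $f=\sum f_\gamma\gamma\in\mathbb{Z}\Gamma$, $f^*=\sum f_\gamma\gamma^{-1}$, and $f\cdot g$ is the product in the group ring. With $\mathbb{T}=\mathbb{R}/\mathbb{Z}$, $X_f=\{x\in\mathbb{T}^\Gamma:\sum_{\gamma'}f_{\gamma'}x_{\gamma\gamma'}=0\ \forall\gamma\in\Gamma\}$ is a compact abelian group (the Pontryagin dual of $\mathbb{Z}\Gamma/\mathbb{Z}\Gamma f$) with the $\Gamma$-action by automorphisms $(\alpha_f^\gamma x)_{\gamma'}=x_{\gamma^{-1}\gamma'}$. $\alpha_f$ is expansive if there is an open neighbourhood $\mathcal{U}$ of $0$ in $X_f$ with $\bigcap_{\gamma}\alpha_f^\gamma(\mathcal{U})=\{0\}$. $h(\alpha_f)$ is the topological entropy: for a Følner sequence $(F_n)$ of nonempty finite subsets of $\Gamma$ ($|\gamma F_n\triangle F_n|/|F_n|\to0$ for all $\gamma$), $h(\alpha_f)=\sup_{\mathcal V}\lim_n\frac1{|F_n|}\log N(\bigvee_{\gamma\in F_n}(\alpha_f^{\gamma})^{-1}\mathcal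 V)$, the supremum over open covers $\mathcal V$ of $X_f$, $N$ denoting minimal cardinality of a subcover; this does not depend on $(F_n)$. *)

(* Defs.v *)
From HB Require Import structures.
From mathcomp Require Import all_boot all_order all_algebra all_fingroup finmap.
From mathcomp Require Import all_classical all_reals all_analysis.
Set Implicit Arguments.
Unset Strict Implicit.
Unset Printing Implicit Defensive.
Import Order.TTheory GRing.Theory Num.Theory numFieldNormedType.Exports.
Local Open Scope fset_scope.
Local Open Scope classical_set_scope.
Local Open Scope ring_scope.

Definition residually_finite (G : groupType) : Prop :=
  forall x : G, x != 1%g ->
    exists (gT : finGroupType) (phi : {multiplicative G -> gT}), phi x != 1%g.

Definition ltranslate (G : groupType) (c : G) (A : {fset G}) : {fset G} :=
  [fset (c * x)%g | x in A].

Definition fsymdiff (G : groupType) (A B : {fset G}) : {fset G} :=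
  ((A `\` B) `|` (B `\` A))%fset.

Definition folner (R : realType) (G : groupType) (F : nat -> {fset G}) : Prop :=
  (forall n, F n != fset0) /\
  forall c : G,
    (fun n => #|` fsymdiff (ltranslate c (F n)) (F n)|%:R / #|` F n|%:R : R)
      @ \oo --> (0 : R).

(* For countable groups, amenability is the existence of a Folner sequence.   *)
Definition amenable (R : realType) (G : groupType) : Prop :=
  exists F : nat -> {fset G}, folner R F.

Definition group_ring (G : groupType) := {fsfun G -> int with 0}.

Section GroupRing.
Variable G : groupType.
Implicit Types f g : group_ring G.

Definition gr_star f : group_ring G :=
  [fsfun c in [fset (d^-1)%g | d in finsupp f] => f (c^-1)%g].

Definition gr_mul f g : group_ring G :=
  [fsfun c in [fset (d * e)%g | d in finsupp f, e in finsupp g] =>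
     \sum_(d <- finsupp f) f d * g (d^-1 * c)%g].

Lemma gr_starE f c : gr_star f c = f (c^-1)%g.
Proof.
rewrite fsfunE; case: ifPn => // /imfsetP nc.
by apply/esym/fsfun_dflt; apply/negP => cf; case: nc; exists c^-1%g; rewrite ?invgK.
Qed.

Lemma gr_mulE f g c :
  gr_mul f g c = \sum_(d <- finsupp f) f d * g (d^-1 * c)%g.
Proof.
rewrite fsfunE; case: ifPn => // /imfset2P nc.
rewrite big_seq big1// => d df; rewrite [g _]fsfun_dflt ?mulr0//.
apply/negP => eg; case: nc; exists d => //; exists (d^-1 * c)%g => //.
by rewrite mulgA mulgV mul1g.
Qed.

End GroupRing.

Definition integers (R : realType) : zmodClosed R :=
  GRing.ZmodClosed.clone R (@Num.int_num_subdef R) _.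

Definition circle (R : realType) : Type :=
  quotient_topology (Quotient.quot (integers R)).

HB.instance Definition _ (R : realType) := Topological.on (circle R).
HB.instance Definition _ (R : realType) := Quotient.on (circle R).
HB.instance Definition _ (R : realType) := GRing.isZmodule.Build (circle R)
  (@Quotient.addqA _ (integers R)) (@Quotient.addqC _ (integers R))
  (@Quotient.add0q _ (integers R)) (@Quotient.addNq _ (integers R)).

Section AlgebraicAction.
Variables (R : realType) (G : groupType).
Implicit Types f : group_ring G.

Definition Xspace f : set {ptws G -> circle R} :=
  [set x | forall c : G, \sum_(d <- finsupp f) x (c * d)%g *~ f d = 0].

Lemma Xspace_zero_subproof f : ((fun=> 0) : {ptws G -> circle R}) \in Xspace f.
Proof. by apply/mem_set => c; rewrite big1// => d _; rewrite mul0rz. Qed.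

Definition Xspace_zero f : Xspace f :=
  exist (fun y => y \in Xspace f) _ (Xspace_zero_subproof f).

Lemma alpha_subproof f (c : G) (x : Xspace f) :
  ((fun d => \val x (c^-1 * d)%g) : {ptws G -> circle R}) \in Xspace f.
Proof.
apply/mem_set => d; have := set_mem (valP x) (c^-1 * d)%g.
by under eq_bigr do rewrite -mulgA.
Qed.

Definition alpha f (c : G) (x : Xspace f) : Xspace f :=
  exist (fun y => y \in Xspace f) _ (alpha_subproof c x).

End AlgebraicAction.
Arguments Xspace R {G} f.
Arguments Xspace_zero R {G} f.
Arguments alpha R {G} f c x.

Definition expansive (G : groupType) (T : topologicalType) (z : T)
    (act : G -> T -> T) : Prop :=
  exists U : set T,
    [/\ open U, U z & \bigcap_(c in [set: G]) (act c @` U) = [set z]].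

Definition covers (T : Type) (V : set (set T)) : Prop :=
  \bigcup_(U in V) U = [set: T].

Definition open_cover (T : topologicalType) (V : set (set T)) : Prop :=
  (forall U, V U -> open U) /\ covers V.

(* Minimal cardinality of a subcover, +oo if V has no finite subcover.        *)
Definition min_subcover (R : realType) (T : Type) (V : set (set T)) : \bar R :=
  ereal_inf [set (#|` W|%:R)%:E | W in
    [set W : {fset set T} | [set` W] `<=` V /\ covers [set` W]]].

(* The join over c in F of the inverse images of the cover V under act c: one
   member s c of V is picked independently for each c.                        *)
Definition cover_join (G : groupType) (T : Type) (act : G -> T -> T)
    (F : {fset G}) (V : set (set T)) : set (set T) :=
  [set U | exists2 s : G -> set T, (forall c, c \in F -> V (s c)) &
     U = \bigcap_(c in [set` F]) (act c @^-1` s c)].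

(* Topological entropy along F. For a Folner sequence and a continuous action
   on a compact space the limit exists and the value does not depend on F.    *)
Definition entropy (R : realType) (G : groupType) (F : nat -> {fset G})
    (T : topologicalType) (act : G -> T -> T) : \bar R :=
  ereal_sup
    [set limn (fun n =>
       ((#|` F n|%:R^-1)%:E * lne (min_subcover R (cover_join act (F n) V)))%E)
    | V in @open_cover T].

(* Main.v *)
(* Expansiveness of alpha_f means that f is injective on bounded functions; by
   compactness and Hahn-Banach duality f then has a left inverse in l^1(G).  Over
   an amenable group a left inverse in l^1 is two-sided: the images under f of the
   point masses of a Folner set almost fill the functions on it, so some point mass
   is close in l^2 to the image of f.  Hence f^* and f g are again invertible in
   l^1, which gives their expansiveness.
   The entropy of alpha_f is the exponential growth rate, along almost invariant
   finite sets Q, of the number N_f(Q) of solutions of f x = 0 mod Z that are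
   separated on Q.  Solving f y = x gives N_{fg} = N_f N_g up to subexponential
   factors.  Let D(Q) be the determinant of the compression of f f^* to Q.  Shearer's
   inequality shows that log D(Q) / |Q| converges, a volume argument gives
   N_{f f^*} <= D, and choosing a large square minor of the compression of f^* gives
   N_f, N_{f^*} >= D^(1/2), all up to subexponential factors.  Since
   N_f N_{f^*} = N_{f f^*}, both N_f and N_{f^*} grow like D^(1/2). *)
Require Import Defs.
From HB Require Import structures.
From mathcomp Require Import all_boot all_order all_algebra all_fingroup finmap.
From mathcomp Require Import all_classical all_reals all_analysis.
From mathcomp Require Import ring lra zify.
Set Implicit Arguments.
Unset Strict Implicit.
Unset Printing Implicit Defensive.
Import Order.TTheory GRing.Theory Num.Theory numFieldNormedType.Exports.
Local Open Scope classical_set_scope.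
Local Open Scope ring_scope.

(** * Elements of the real group ring as lists *)

(** The completion l^1(G) is never built: an inverse is a finite list together with a defect of norm
    at most 1/2, and a Neumann series is summed to the limit only where a bounded function has to be
    produced. The compressions of f alone are of little use, since they may be singular even for
    invertible f. Those of f f^* are Gram matrices, positive definite with integer determinant at
    least 1. Positivity makes Schur complements decrease when the window grows, which is the input
    of Shearer's inequality. All comparisons of counts have one shape. Nothing is controlled near
    the boundary of a window or at a small proportion of bad points, so the maps between separated
    sets are not injective. Members of one fibre, however, agree closely off a sparse set of
    coordinates, and a generating function estimate shows that only subexponentially many such
    members are separated. Windows are quantified by a filter on finite sets, which yields one
    growth rate for all Folner sequences at once. *)

Section ListOperators.
Variables (R : realType) (G : groupType).
Implicit Types (a b u r : seq (R * G)) (x y : G -> R) (c d : G).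

(* The list a of pairs (r, d) encodes the element \sum r d of the group ring R[G];
   repetitions are allowed. *)
Definition lop a x c : R := \sum_(p <- a) p.1 * x (c * p.2)%g.
Definition l1norm a : R := \sum_(p <- a) `|p.1|.
Definition lmul a b : seq (R * G) :=
  [seq (p.1 * q.1, (p.2 * q.2)%g) | p <- a, q <- b].
Definition lopp a : seq (R * G) := [seq (- p.1, p.2) | p <- a].
Definition lstar a : seq (R * G) := [seq (p.1, (p.2^-1)%g) | p <- a].
Definition dlt d c : R := (c == d)%:R.

Lemma eq_lop a x y : x =1 y -> lop a x =1 lop a y.
Proof. by move=> xy c; apply: eq_bigr => p _; rewrite xy. Qed.

Lemma eq_in_lop a x y c :
  (forall p, p \in a -> x (c * p.2)%g = y (c * p.2)%g) -> lop a x c = lop a y c.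
Proof. by move=> xy; apply: eq_big_seq => p pa; rewrite xy. Qed.

Lemma lop_mul a b x : lop (lmul a b) x =1 lop a (lop b x).
Proof.
move=> c; rewrite /lop /lmul big_allpairs_dep; apply: eq_bigr => p _.
by rewrite mulr_sumr; apply: eq_bigr => q _ /=; rewrite mulrA mulgA.
Qed.

Lemma lop_cat a b x c : lop (a ++ b) x c = lop a x c + lop b x c.
Proof. exact: big_cat. Qed.

Lemma lop_opp a x c : lop (lopp a) x c = - lop a x c.
Proof. by rewrite /lop big_map -sumrN; apply: eq_bigr => p _; rewrite mulNr. Qed.

Lemma lopD a x y c : lop a (fun d => x d + y d) c = lop a x c + lop a y c.
Proof. by rewrite /lop -big_split; apply: eq_bigr => p _; rewrite mulrDr. Qed.

Lemma lopN a x c : lop a (fun d => - x d) c = - lop a x c.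
Proof. by rewrite /lop -sumrN; apply: eq_bigr => p _; rewrite mulrN. Qed.

Lemma lopB a x y c : lop a (fun d => x d - y d) c = lop a x c - lop a y c.
Proof. by rewrite lopD lopN. Qed.

Lemma lopZ a k x c : lop a (fun d => k * x d) c = k * lop a x c.
Proof. by rewrite /lop mulr_sumr; apply: eq_bigr => p _; rewrite mulrCA. Qed.

Lemma lop_sum (I : Type) (s : seq I) (F : I -> G -> R) a c :
  lop a (fun d => \sum_(i <- s) F i d) c = \sum_(i <- s) lop a (F i) c.
Proof.
rewrite /lop exchange_big; apply: eq_bigr => p _ /=; exact: mulr_sumr.
Qed.

Lemma lop_translate a x d c : lop a (fun e => x (d * e)%g) c = lop a x (d * c)%g.
Proof. by apply: eq_bigr => p _; rewrite mulgA. Qed.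

Lemma l1norm_ge0 a : 0 <= l1norm a.
Proof. exact: sumr_ge0. Qed.
Hint Extern 0 (is_true (@Order.le _ _ _ (@l1norm _ _ _))) => exact: l1norm_ge0 : core.

Lemma l1norm_mul a b : l1norm (lmul a b) = l1norm a * l1norm b.
Proof.
rewrite /l1norm /lmul big_allpairs_dep mulr_suml; apply: eq_bigr => p _.
by rewrite mulr_sumr; apply: eq_bigr => q _ /=; rewrite normrM.
Qed.

Lemma l1norm_cat a b : l1norm (a ++ b) = l1norm a + l1norm b.
Proof. exact: big_cat. Qed.

Lemma l1norm_opp a : l1norm (lopp a) = l1norm a.
Proof. by rewrite /l1norm big_map; apply: eq_bigr => p _; rewrite normrN. Qed.

Lemma l1norm_star a : l1norm (lstar a) = l1norm a.
Proof. by rewrite /l1norm big_map. Qed.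

Lemma lop_bound a x c K :
  (forall p, p \in a -> `|x (c * p.2)%g| <= K) -> `|lop a x c| <= l1norm a * K.
Proof.
move=> xK; apply: le_trans (ler_norm_sum _ _ _) _.
rewrite /l1norm mulr_suml [leLHS]big_seq [leRHS]big_seq.
by apply: ler_sum => p pa; rewrite normrM ler_wpM2l ?xK.
Qed.

(** This is transposition of matrices: [lop a (dlt d) c] is the entry of [a] at row [c] and column
    [d]. Every passage to the adjoint rests on it. *)
Lemma lop_dltC a d c : lop a (dlt d) c = lop (lstar a) (dlt c) d.
Proof.
rewrite /lop big_map; apply: eq_bigr => p _ /=; congr (_ * (nat_of_bool _)%:R).
by apply/eqP/eqP => [<-|<-]; rewrite -mulgA (mulgV, mulVg) mulg1.
Qed.

Lemma lstarK : involutive lstar.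
Proof. by elim=> //= -[k d] s IH; rewrite invgK; congr cons. Qed.

Lemma lop_star_mul a b x : lop (lstar (lmul a b)) x =1 lop (lmul (lstar b) (lstar a)) x.
Proof.
move=> c; rewrite /lop big_map !big_allpairs_dep exchange_big big_map /=.
apply: eq_bigr => p _; rewrite big_map; apply: eq_bigr => q _ /=.
by rewrite invgM [q.1 * _]mulrC.
Qed.

Definition intlist a := all (fun p => p.1 \is a Num.int) a.

Lemma intlist_lop a x c : intlist a ->
  (forall p, p \in a -> x (c * p.2)%g \is a Num.int) -> lop a x c \is a Num.int.
Proof.
move=> /allP aZ xZ; rewrite /lop big_seq; apply: rpred_sum => p pa.
by rewrite rpredM ?xZ ?aZ.
Qed.

Lemma intlist_star a : intlist (lstar a) = intlist a.
Proof. by rewrite /intlist all_map. Qed.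

Lemma intlist_mul a b : intlist a -> intlist b -> intlist (lmul a b).
Proof.
move=> /allP aZ /allP bZ; apply/allP => _ /allpairsP[[p q] [/= pa qb ->]] /=.
by apply: rpredM; [exact: aZ|exact: bZ].
Qed.

Definition grlist (f : group_ring G) : seq (R * G) :=
  [seq ((f d)%:~R, d) | d <- finsupp f].

Lemma intlist_gr f : intlist (grlist f).
Proof. by rewrite /intlist all_map; apply/allP => d _ /=; rewrite intr_int. Qed.

Lemma lop_grlist f x c : lop (grlist f) x c = \sum_(d <- finsupp f) (f d)%:~R * x (c * d)%g.
Proof. by rewrite /lop big_map. Qed.

Lemma lop_gr_sub (f : group_ring G) (S : {fset G}) x c : {subset finsupp f <= S} ->
  lop (grlist f) x c = \sum_(d <- S) (f d)%:~R * x (c * d)%g.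
Proof.
move=> fS; rewrite lop_grlist; apply/esym.
rewrite (bigID (mem (finsupp f))) /= [X in _ + X]big1 ?addr0; last first.
  by move=> d df; rewrite fsfun_dflt// mul0r.
rewrite -big_filter; apply: perm_big; apply: uniq_perm.
- exact/filter_uniq/fset_uniq.
- exact: fset_uniq _.
- by move=> d; rewrite mem_filter; apply/andP/idP => [[]//|df]; split => //; exact: fS.
Qed.

Lemma lop_gr_mul f g x : lop (grlist (gr_mul f g)) x =1 lop (grlist f) (lop (grlist g) x).
Proof.
move=> c; pose S := [fset (d * e)%g | d in finsupp f, e in finsupp g]%fset.
rewrite (@lop_gr_sub _ S); last first.
  move=> d; apply: contraTT => dS; rewrite memNfinsupp.
  by apply/eqP; rewrite /gr_mul fsfunE (negPf dS).
rewrite [RHS]lop_grlist.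
under eq_bigr do rewrite gr_mulE rmorph_sum mulr_suml.
rewrite exchange_big /= [LHS]big_seq [RHS]big_seq; apply: eq_bigr => d df.
under eq_bigr do rewrite rmorphM -mulrA.
rewrite -mulr_sumr; congr (_ * _).
pose S' := [fset (d^-1 * e)%g | e in S]%fset.
rewrite (@lop_gr_sub _ S'); last first.
  move=> e eg; apply/imfsetP; exists (d * e)%g; last by rewrite mulgA mulVg mul1g.
  by apply/imfset2P; exists d => //; exists e.
rewrite big_imfset /=; last by move=> e1 e2 _ _ /mulgI.
by apply: eq_bigr => e _; rewrite -!mulgA (mulgA d) mulgV mul1g.
Qed.

Lemma lop_gr_star f x : lop (grlist (gr_star f)) x =1 lop (lstar (grlist f)) x.
Proof.
move=> c; pose S := [fset (d^-1)%g | d in finsupp f]%fset.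
rewrite (@lop_gr_sub _ S); last first.
  move=> d; apply: contraTT => dS; rewrite memNfinsupp.
  by apply/eqP; rewrite /gr_star fsfunE (negPf dS).
rewrite /lop /lstar /grlist !big_map big_imfset /=; last by move=> e1 e2 _ _ /invg_inj.
by apply: eq_bigr => e _; rewrite gr_starE invgK.
Qed.

End ListOperators.
#[local] Hint Extern 0 (is_true (@Order.le _ _ _ (@l1norm _ _ _))) => exact: l1norm_ge0 : core.

(** * Approximate inverses in l^1 and the resulting bounds in l^2 *)

Section Inverses.
Variables (R : realType) (G : groupType).
Implicit Types (a b u r : seq (R * G)) (x y : G -> R) (c d : G).

(** Finite lists cannot hold an inverse in l^1, so an inverse comes with its defect [r], which a
    Neumann series makes as small as required. *)
Definition left_inverse_up_to (t : R) a u r :=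
  l1norm r <= t /\ forall x c, lop u (lop a x) c = x c + lop r x c.

(* Up to a Neumann series, a has a left inverse in l^1(G). *)
Definition left_inv a := exists u r, left_inverse_up_to (2^-1) a u r.

(** The partial sum over [k < n] of [(-r)^k u], in Horner form. It starts at 0, so the matching
    defect [neumann_rest] starts at -1. *)
Fixpoint neumann_inv u r n : seq (R * G) :=
  if n is n'.+1 then u ++ lopp (lmul r (neumann_inv u r n')) else [::].

Fixpoint neumann_rest r n : seq (R * G) :=
  if n is n'.+1 then lopp (lmul r (neumann_rest r n')) else [:: (-1, 1%g)].

Lemma l1norm_neumann_rest r n : l1norm (neumann_rest r n) = l1norm r ^+ n.
Proof.
elim: n => [|n IHn] /=; first by rewrite /l1norm big_seq1 normrN normr1.
by rewrite l1norm_opp l1norm_mul IHn exprS.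
Qed.

Lemma neumann_invP a u r n :
    (forall x c, lop u (lop a x) c = x c + lop r x c) ->
  forall x c, lop (neumann_inv u r n) (lop a x) c = x c + lop (neumann_rest r n) x c.
Proof.
move=> uar; elim: n => [|n IHn] x c /=.
  by rewrite /lop big_nil big_seq1 mulN1r mulg1 subrr.
rewrite lop_cat !lop_opp !lop_mul uar (eq_lop r (IHn x)) lopD.
by rewrite opprD addrA addrK.
Qed.

Lemma left_inv_small a (t : R) : left_inv a -> 0 < t -> exists u r, left_inverse_up_to t a u r.
Proof.
move=> [u [r [r2 uar]]] t0.
have [n nt] : exists n, (2^-1 : R) ^+ n < t.
  have h : `|2^-1 : R| < 1 by rewrite ger0_norm//; lra.
  have /cvgrPdist_lt/(_ _ t0)[N _ /(_ N (leqnn _))] := cvg_expr h.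
  by rewrite sub0r normrN => /(le_lt_trans (ler_norm _)); exists N.
exists (neumann_inv u r n), (neumann_rest r n); split; last exact: neumann_invP.
rewrite l1norm_neumann_rest; apply: le_trans (ltW nt).
by rewrite lerXn2r ?nnegrE ?l1norm_ge0 ?invr_ge0 ?ler0n.
Qed.

(** Take [u] with defect at most [e / (2 K)]. Then [x c] differs from [lop u (lop a x) c] by at most
    [e / 2], and the latter reads [lop a x] only on the translate by [c] of the support of [u]. The
    uniformity of [h] and [T] in [x] and [c] is what [shadowing] needs. *)
Lemma left_inv_local a : left_inv a -> forall K e : R, 0 < K -> 0 < e ->
  exists2 h, 0 < h & exists T : seq G, forall x c, (forall d, `|x d| <= K) ->
    (forall d, d \in T -> `|lop a x (c * d)%g| <= h) -> `|x c| <= e.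
Proof.
move=> ai K e K0 e0.
have [u [r [re uar]]] := left_inv_small ai (divr_gt0 e0 (mulr_gt0 (ltr0n R 2) K0)).
exists (e / (2 * (l1norm u + 1))).
  by rewrite divr_gt0// mulr_gt0// ltr_pwDr//.
exists [seq p.2 | p <- u] => x c xK ax.
have -> : x c = lop u (lop a x) c - lop r x c by rewrite uar addrK.
apply: le_trans (ler_normB _ _) _.
have h1 : `|lop u (lop a x) c| <= l1norm u * (e / (2 * (l1norm u + 1))).
  by apply: lop_bound => p pu; apply: ax; apply: map_f.
have h2 : `|lop r x c| <= l1norm r * K by apply: lop_bound.
apply: le_trans (lerD h1 h2) _.
have h3 : l1norm r * K <= e / 2.
  apply: le_trans (ler_wpM2r (ltW K0) re) _.
  by rewrite invfM mulrA -mulrA mulVf ?mulr1// gt_eqF.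
have h4 : l1norm u * (e / (2 * (l1norm u + 1))) <= e / 2.
  have N1 : 0 < l1norm u + 1 by rewrite ltr_pwDr.
  have -> : l1norm u * (e / (2 * (l1norm u + 1))) = e / 2 * (l1norm u / (l1norm u + 1)).
    by field; rewrite gt_eqF.
  by rewrite ler_piMr ?(ltW (divr_gt0 e0 (ltr0n R 2)))// ler_pdivrMr// mul1r lerDl.
by lra.
Qed.

Lemma left_inv_inj a x (K : R) : left_inv a -> (forall c, `|x c| <= K) ->
  (forall c, lop a x c = 0) -> forall c, x c = 0.
Proof.
move=> ai xK ax c; apply/eqP; rewrite -normr_eq0; apply/eqP/le_anti.
rewrite normr_ge0 andbT; apply/ler_addgt0Pl => e e0; rewrite addr0.
have K0 : 0 < `|K| + 1 by rewrite ltr_pwDr.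
have [h h0 [T HT]] := left_inv_local ai K0 e0.
apply: HT => [d|d _]; last by rewrite ax normr0 ltW.
apply: le_trans (xK d) _; apply: le_trans (ler_norm _) _; lra.
Qed.

Lemma left_inv_mul a b : left_inv a -> left_inv b -> left_inv (lmul a b).
Proof.
move=> ai bi.
have h4 : 0 < (4%:R^-1 : R) by rewrite invr_gt0.
have [v [s [sb vbs]]] := left_inv_small bi h4.
(* In [v u a b = v b + v r b] the defect [r] of [u] is magnified by the norms of [v] and [b]; hence
   [v] is chosen first and [r] is measured against it. *)
have h5 : 0 < (4%:R * (l1norm v * l1norm b + 1) : R)^-1.
  by rewrite invr_gt0 mulr_gt0// ltr_pwDr// mulr_ge0.
have [u [r [ra uar]]] := left_inv_small ai h5.
exists (lmul v u), (s ++ lmul v (lmul r b)); split.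
  rewrite l1norm_cat !l1norm_mul.
  have s1 : l1norm v * (l1norm r * l1norm b) <= 4^-1.
    have N1 : 0 < l1norm v * l1norm b + 1 by rewrite ltr_pwDr// mulr_ge0.
    have -> : l1norm v * (l1norm r * l1norm b) = l1norm r * (l1norm v * l1norm b) by ring.
    apply: le_trans (ler_wpM2r _ ra) _; first by rewrite mulr_ge0.
    by rewrite invfM -mulrA ler_piMr ?(ltW h4)// mulrC ler_pdivrMr ?mul1r ?lerDl.
  by rewrite (_ : (2^-1 : R) = 4^-1 + 4^-1) ?lerD//; field.
move=> x c; rewrite lop_cat !lop_mul.
have E : lop u (lop (lmul a b) x) =1 (fun d => lop b x d + lop r (lop b x) d).
  by move=> d; rewrite (eq_lop u (lop_mul a b x)) uar.
rewrite (eq_lop v E) lopD vbs addrA; congr (_ + _).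
exact/eq_lop/fsym/lop_mul.
Qed.

Definition finsum_on (s : seq G) x d : R := \sum_(c <- s) x c * dlt R c d.

Lemma finsum_onE s x d : uniq s -> d \in s -> finsum_on s x d = x d.
Proof.
move=> us ds; rewrite /finsum_on (bigD1_seq d)//= /dlt eqxx mulr1 big1 ?addr0//.
by move=> i id; rewrite eq_sym (negPf id) mulr0.
Qed.

Lemma lop_delta a x c s : uniq s -> (forall p, p \in a -> (c * p.2)%g \in s) ->
  lop a x c = \sum_(d <- s) x d * lop a (dlt R d) c.
Proof.
move=> us H; rewrite (@eq_in_lop _ _ _ _ (finsum_on s x)).
  by rewrite lop_sum; apply: eq_bigr => d _; rewrite lopZ.
by move=> p pa; rewrite finsum_onE// H.
Qed.

(** The two lists may be unrelated, so the adjoints are compared through matrix entries: on a finite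
    set with all points that they read at [c], both are determined by their values on point
    masses. *)
Lemma eq_lop_star a b : (forall x c, lop a x c = lop b x c) ->
  forall x c, lop (lstar a) x c = lop (lstar b) x c.
Proof.
move=> ab x c; pose s := undup [seq (c * p.2)%g | p <- lstar a ++ lstar b].
have us : uniq s := undup_uniq _.
rewrite (@lop_delta (lstar a) x c s)//; last first.
  by move=> p pa; rewrite mem_undup (map_f (fun p => (c * p.2)%g))// mem_cat pa.
rewrite (@lop_delta (lstar b) x c s)//; last first.
  by move=> p pa; rewrite mem_undup (map_f (fun p => (c * p.2)%g))// mem_cat pa orbT.
by apply: eq_bigr => d _; rewrite lop_dltC [in RHS]lop_dltC !lstarK ab.
Qed.

Lemma right_inverse_of_star a : left_inv (lstar a) ->
  exists u r, l1norm r <= 2^-1 /\ forall x c, lop a (lop u x) c = x c + lop r x c.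
Proof.
move=> [u [r [r2 uar]]]; exists (lstar u), (lstar r); rewrite l1norm_star; split=> // x c.
have E := @eq_lop_star (lmul u (lstar a)) ((1, 1%g) :: r).
rewrite -lop_mul -[in LHS](lstarK a) -lop_star_mul E.
  by rewrite {1}/lop big_cons /= invg1 mulg1 mul1r.
by move=> y d; rewrite lop_mul uar {2}/lop big_cons mul1r mulg1.
Qed.

Lemma cvg_lop (T : Type) (F : set_system T) (FF : Filter F) (X : T -> G -> R) x a c :
  (forall d, (fun t => X t d) @ F --> x d) -> (fun t => lop a (X t) c) @ F --> lop a x c.
Proof.
move=> Xx; elim: a => [|p a IHa].
  by rewrite /lop big_nil; under eq_fun do rewrite big_nil; exact: cvg_cst.
rewrite /lop big_cons; under eq_fun do rewrite big_cons.
by apply: cvgD => //; apply: cvgM => //; exact: cvg_cst.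
Qed.

(** With [w 0 = v] and [w n.+1 = - r w n], the solution is the sum of all [u (w n)]. As
    [a u w = w + r w], the images of the partial sums telescope to [v - w n], and [w n] decays like
    [2^-n]. *)
Lemma right_inv_solve a : left_inv (lstar a) ->
  exists2 C, 0 < C & forall v (K : R), (forall c, `|v c| <= K) ->
    exists x, (forall c, lop a x c = v c) /\ (forall c, `|x c| <= C * K).
Proof.
move=> /right_inverse_of_star[u [r [r2 aur]]].
exists (2 * l1norm u + 1); first by rewrite ltr_pwDr// mulr_ge0.
move=> v K vK.
have K0 : 0 <= K by apply: le_trans (vK 1%g).
pose w := fix w n : G -> R := if n is n'.+1 then fun c => - lop r (w n') c else v.
have wK n c : `|w n c| <= K * 2^-1 ^+ n.
  elim: n c => [|n IHn] c /=; first by rewrite expr0 mulr1.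
  rewrite normrN exprS mulrCA; apply: le_trans (lop_bound (fun p _ => IHn _)) _.
  by rewrite ler_wpM2r// mulr_ge0// exprn_ge0// invr_ge0.
pose y c n := lop u (w n) c.
have yK c n : `|y c n| <= l1norm u * K * 2^-1 ^+ n.
  by rewrite -mulrA; apply: lop_bound.
have h : `|2^-1 : R| < 1 by rewrite ger0_norm//; lra.
have gcv : cvgn (series (geometric (l1norm u * K) (2^-1 : R))) by apply: is_cvg_geometric_series.
have ycv c : cvgn [normed series (y c)].
  apply: series_le_cvg gcv => n.
  - exact: normr_ge0.
  - by rewrite !mulr_ge0// exprn_ge0// invr_ge0.
  - exact: yK.
have ycv' c := normed_cvg (ycv c).
exists (fun c => limn (series (y c))); split=> c.
  have c1 : (fun n => lop a (fun d => series (y d) n) c) @ \oo -->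
            lop a (fun d => limn (series (y d))) c.
    by apply: cvg_lop => d; exact: ycv'.
  have c2 : (fun n => lop a (fun d => series (y d) n) c) @ \oo --> v c.
    have E n : lop a (fun d => series (y d) n) c = v c - w n c.
      rewrite /series /= lop_sum.
      have E k : lop a (fun d => y d k) c = w k c - w k.+1 c.
        by rewrite /y /= opprK aur.
      under eq_bigr do rewrite E.
      rewrite -[RHS]opprB -(telescope_sumr (fun k => w k c) (leq0n n)) -sumrN.
      by apply: eq_bigr => k _; rewrite opprB.
    rewrite (funext E) -[X in _ --> X]subr0; apply: cvgB; first exact: cvg_cst.
    apply/cvgr0Pnorm_lt => e e0.
    have c3 : (fun n => K * 2^-1 ^+ n) @ \oo --> (0 : R).
      by rewrite -(mulr0 K); apply: cvgM; [exact: cvg_cst|exact: cvg_expr].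
    move/cvgr0Pnorm_lt: c3 => /(_ e e0); apply: filterS => n; apply: le_lt_trans.
    by apply: le_trans (wK _ _) (ler_norm _).
  exact: cvg_unique c1 c2.
have gl : limn (series (geometric (l1norm u * K) (2^-1 : R))) = 2 * (l1norm u * K).
  by rewrite (cvg_lim _ (cvg_geometric_series h))//; field.
apply: le_trans (lim_series_norm (ycv c)) _.
apply: (@le_trans _ _ (2 * (l1norm u * K))).
  rewrite -gl; apply: lim_series_le => //; first exact: ycv.
  by move=> n; apply: yK.
by rewrite mulrA ler_wpM2r// lerDl.
Qed.

(** A bound on the squared l^2 norm, tested on finite sums so that no summability has to be carried
    along. *)
Definition sqle x (E : R) := forall s, uniq s -> \sum_(c <- s) x c ^+ 2 <= E.

Lemma sqle_ge0 x E : sqle x E -> 0 <= E.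
Proof. by move=> /(_ [::] isT); rewrite big_nil. Qed.

Lemma sqle_fin x s : uniq s -> (forall c, c \notin s -> x c = 0) ->
  sqle x (\sum_(c <- s) x c ^+ 2).
Proof.
move=> us xs t ut; rewrite (bigID (mem s)) /= [X in _ + X]big1 ?addr0; last first.
  by move=> c /xs ->; rewrite expr0n.
rewrite [leRHS](bigID (mem t)) /= -big_filter -[X in _ <= X + _]big_filter.
rewrite (perm_big [seq i <- s | i \in t]) /=.
  by rewrite lerDl; apply: sumr_ge0 => *; apply: sqr_ge0.
by apply: uniq_perm; rewrite ?filter_uniq// => c; rewrite !mem_filter andbC.
Qed.

(** Young's inequality: Cauchy-Schwarz with weights [|p.1|] at each point, then injectivity of right
    translation. *)
Lemma sqle_lop a x E : sqle x E -> sqle (lop a x) (l1norm a ^+ 2 * E).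
Proof.
move=> xE s us.
have CS c : lop a x c ^+ 2 <= l1norm a * \sum_(p <- a) `|p.1| * x (c * p.2)%g ^+ 2.
  rewrite /lop /l1norm; elim: a => [|p a IHa]; first by rewrite !big_nil expr0n mul0r.
  rewrite !big_cons; set A := \sum_(j <- a) _ * _ in IHa *; set N := \sum_(j <- a) `|_| in IHa *.
  set B := \sum_(j <- a) `|_| * _ in IHa *; set y := x _.
  have N0 : 0 <= N by apply: sumr_ge0.
  have B0 : 0 <= B by apply: sumr_ge0 => *; rewrite mulr_ge0// sqr_ge0.
  rewrite sqrrD exprMn -(real_normK (num_real p.1)) mulrDl !mulrDr.
  set P := `|p.1|; have P0 : 0 <= P by apply: normr_ge0.
  have : p.1 * y * A *+ 2 <= P * B + N * (P * y ^+ 2).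
    apply: (@le_trans _ _ (P * `|y| * `|A| *+ 2)).
      by rewrite lerMn2r -!normrM ler_norm orbT.
    rewrite -[leRHS]addrC; rewrite -(real_normK (num_real y)).
    have A2 : `|A| ^+ 2 <= N * B by rewrite real_normK ?num_real.
    set Y := `|y|; have Y0 : 0 <= Y by apply: normr_ge0.
    set A' := `|A| in A2 *; have A0 : 0 <= A' by apply: normr_ge0.
    suff : Y * A' *+ 2 <= B + N * Y ^+ 2.
      move=> H; have := ler_wpM2l P0 H; rewrite mulrDr; lra.
    have [N00|N1] := eqVneq N 0.
      move: A2; rewrite N00 mul0r => A2.
      have -> : A' = 0.
        by apply/eqP; rewrite -sqrf_eq0; apply/eqP/le_anti; rewrite A2 sqr_ge0.
      by rewrite mulr0 mul0rn; rewrite mul0r addr0.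
    have N2 : 0 < N by rewrite lt_def N1.
    rewrite -(ler_pM2l N2).
    have : 0 <= (A' - N * Y) ^+ 2 by apply: sqr_ge0.
    nra.
  rewrite -mulrA; nra.
apply: (@le_trans _ _ (\sum_(c <- s) l1norm a * \sum_(p <- a) `|p.1| * x (c * p.2)%g ^+ 2)).
  exact: ler_sum.
rewrite -mulr_sumr expr2 -mulrA ler_wpM2l// exchange_big /l1norm mulr_suml.
apply: ler_sum => p _; rewrite -mulr_sumr ler_wpM2l//.
have := xE [seq (c * p.2)%g | c <- s]; rewrite big_map; apply.
by rewrite map_inj_uniq// => c d /mulIg.
Qed.

(** From [x = u (a x) - r x] the squared norm X satisfies [X <= 2 |u|^2 E + 2 |r|^2 X], and
    [|r|^2 <= 1/4] allows half of X to be absorbed. Finite support makes X finite beforehand. *)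
Lemma left_inv_sq a : left_inv a -> exists2 C, 0 < C &
  forall x s E, uniq s -> (forall c, c \notin s -> x c = 0) -> sqle (lop a x) E ->
    \sum_(c <- s) x c ^+ 2 <= C * E.
Proof.
move=> [u [r [r2 uar]]]; exists (4 * l1norm u ^+ 2 + 1).
  by rewrite ltr_pwDr// mulr_ge0// sqr_ge0.
move=> x s E us xs aE; have E0 := sqle_ge0 aE.
set X := \sum_(c <- s) _; have X0 : 0 <= X by apply: sumr_ge0 => *; apply: sqr_ge0.
have h1 := sqle_lop u aE us; have h2 := sqle_lop r (sqle_fin us xs) us.
have : X <= 2 * (\sum_(c <- s) lop u (lop a x) c ^+ 2) + 2 * (\sum_(c <- s) lop r x c ^+ 2).
  rewrite !mulr_sumr -big_split; apply: ler_sum => c _ /=.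
  have := uar x c; set A := lop u _ c; set B := lop r x c => ->.
  by have := sqr_ge0 (x c + B + B); nra.
have r0 := l1norm_ge0 r.
have : l1norm r ^+ 2 <= 4^-1.
  by rewrite (_ : (4^-1 : R) = 2^-1 ^+ 2) ?lerXn2r ?nnegrE ?invr_ge0//; field.
have := sqr_ge0 (l1norm u); move: h1 h2; rewrite -/X.
set N := l1norm u ^+ 2; set M := l1norm r ^+ 2; set A := \sum_(c <- s) _; set B := \sum_(c <- s) _.
nra.
Qed.

End Inverses.

(** * Leverage scores and large minors *)

Section Determinants.
Variable F : realFieldType.

Lemma unitmx_inj n (A : 'M[F]_n) :
  (forall y : 'cV[F]_n, A *m y = 0 -> y = 0) -> A \in unitmx.
Proof.
move=> Ainj; rewrite -unitmx_tr -row_free_unit -kermx_eq0; apply/eqP.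
apply: trmx_inj; apply/matrixP => i j; rewrite trmx0 !mxE.
have : col j (kermx A^T)^T = 0.
  by apply: Ainj; rewrite colE mulmxA -{1}[A]trmxK -trmx_mul mulmx_ker trmx0 mul0mx.
by move/matrixP/(_ i 0); rewrite !mxE.
Qed.

Lemma det_schur n (a : 'M[F]_1) (u : 'rV[F]_n) (v : 'cV[F]_n) (D : 'M[F]_n) : D \in unitmx ->
  \det (block_mx a u v D) = (a - u *m invmx D *m v) 0 0 * \det D.
Proof.
move=> uD.
have -> : block_mx a u v D =
    block_mx (a - u *m invmx D *m v) u 0 D *m block_mx 1%:M 0 (invmx D *m v) 1%:M.
  by rewrite mulmx_block !mulmx1 !mulmx0 !add0r mulmxA subrK mulKVmx.
by rewrite det_mulmx det_ublock det_lblock !det1 !mulr1 det_mx11.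
Qed.

(** The matrix determinant lemma, from two block factorisations of the same bordered matrix. *)
Lemma det_sub_rank1 n (A : 'M[F]_n) (v : 'cV[F]_n) (u : 'rV[F]_n) : A \in unitmx ->
  \det (A - v *m u) = \det A * (1 - (u *m invmx A *m v) 0 0).
Proof.
move=> uA.
have E : block_mx 1%:M u v A = block_mx 1%:M 0 v 1%:M *m block_mx 1%:M u 0 (A - v *m u).
  by rewrite mulmx_block !mulmx1 !mul1mx !mulmx0 ?mul0mx !addr0 ?add0r addrC subrK.
have := det_schur 1%:M u v uA; rewrite E det_mulmx det_lblock det_ublock !det1 !mul1r => ->.
by rewrite mulrC !mxE.
Qed.

Section Leverage.
Variables (N m : nat) (M : 'M[F]_(N, m)).
Hypothesis uM : M^T *m M \in unitmx.

(** The orthogonal projection onto the complement of the column space of [M]. Its diagonal entry at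
    [i] is one minus the leverage score of row [i], and also the squared distance of the basis
    vector [i] from the column space. *)
Definition coproj : 'M[F]_N := 1%:M - M *m invmx (M^T *m M) *m M^T.

Lemma mxtrace_coproj : \sum_i coproj i i = N%:R - m%:R.
Proof.
rewrite -/(\tr coproj) /coproj linearB /= mxtrace1 mxtrace_mulC mulmxA mulmxV//.
by rewrite mxtrace1.
Qed.

Lemma trmx_coproj : coproj^T = coproj.
Proof. by rewrite /coproj linearB /= trmx1 !trmx_mul trmxK trmx_inv trmx_mul trmxK mulmxA. Qed.

Lemma coproj_idem : coproj *m coproj = coproj.
Proof.
have cM : coproj *m M = 0.
  by rewrite /coproj mulmxBl mul1mx -(mulmxA _ M^T) mulmxKV// subrr.
by rewrite {2}/coproj mulmxBr mulmx1 !mulmxA cM !mul0mx subr0.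
Qed.

(** The diagonal of [coproj] has mean [(N - m) / N]. A small entry yields a point mass close to the
    image ([near_delta]), a large one a row that is cheap to delete ([exists_large_minor]). *)
Lemma exists_leverage_le : (0 < N)%N -> exists i, coproj i i <= (N%:R - m%:R) / N%:R.
Proof.
move=> N0; apply: contrapT => /forallNP H.
have : \sum_(i < N) (N%:R - m%:R) / N%:R < \sum_i coproj i i.
  case: N N0 coproj H => // n _ c H; rewrite !big_ord_recl.
  apply: ltr_leD; first by rewrite ltNge; apply/negP/H.
  by apply: ler_sum => i _; rewrite leNgt; apply/negP => /ltW /H.
rewrite mxtrace_coproj sumr_const card_ord -(mulr_natr (_ / _)) divfK ?ltxx//.
by rewrite pnatr_eq0 -lt0n.
Qed.

Lemma exists_leverage_ge : (0 < N)%N -> exists i, (N%:R - m%:R) / N%:R <= coproj i i.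
Proof.
move=> N0; apply: contrapT => /forallNP H.
have : \sum_i coproj i i < \sum_(i < N) (N%:R - m%:R) / N%:R.
  case: N N0 coproj H => // n _ c H; rewrite !big_ord_recl.
  apply: ltr_leD; first by rewrite ltNge; apply/negP/H.
  by apply: ler_sum => i _; rewrite leNgt; apply/negP => /ltW /H.
rewrite mxtrace_coproj sumr_const card_ord -(mulr_natr (_ / _)) divfK ?ltxx//.
by rewrite pnatr_eq0 -lt0n.
Qed.

End Leverage.

(** Deleting a row subtracts a rank one matrix from the Gram matrix. *)
Lemma det_gram_row' N m (M : 'M[F]_(N.+1, m)) i : M^T *m M \in unitmx ->
  \det ((row' i M)^T *m row' i M) = \det (M^T *m M) * coproj M i i.
Proof.
move=> uM.
have -> : (row' i M)^T *m row' i M = M^T *m M - (row i M)^T *m row i M.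
  apply/matrixP => j k; rewrite !mxE big_ord1 (bigD1_ord i)//= !mxE [M i j * M i k + _]addrC addrK.
  by apply: eq_bigr => l _; rewrite !mxE.
have cE : coproj M i i = 1 - (M *m invmx (M^T *m M) *m M^T) i i.
  by rewrite /coproj mxE [X in X + _]mxE eqxx [X in _ + X]mxE.
rewrite det_sub_rank1// -row_mul cE; congr (_ * (_ - _)).
by rewrite mxE [in RHS]mxE; apply: eq_bigr => j _; rewrite mxE [in RHS]mxE; congr (_ * _); rewrite !mxE.
Qed.

(* Greedily deleting the row of least leverage costs a factor (N - m)/N. *)
Lemma exists_large_minor N m (M : 'M[F]_(N, m)) : (m <= N)%N ->
  exists2 h : 'I_m -> 'I_N, injective h &
    `|\det (M^T *m M)| <= 'C(N, m)%:R * \det (rowsub h M) ^+ 2.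
Proof.
move=> mN; move: M; rewrite -(subnKC mN); move: (N - m)%N => {mN}k M.
elim: k M => [|k IHk].
  rewrite addn0 => M; exists id => //; have -> : rowsub id M = M by apply/matrixP => i j; rewrite !mxE.
  by rewrite binn mul1r det_mulmx det_tr -expr2 ger0_norm ?sqr_ge0.
rewrite addnS => M.
have [uM|nuM] := boolP (M^T *m M \in unitmx); last first.
  move: nuM; rewrite unitmxE unitfE negbK => /eqP ->; rewrite normr0.
  have mk : (m <= (m + k).+1)%N by rewrite -addnS leq_addr.
  exists (widen_ord mk); last by rewrite mulr_ge0// sqr_ge0.
  by move=> i j /(congr1 (@nat_of_ord _)) /= ij; apply: val_inj.
have [i Hi] := exists_leverage_ge uM isT.
have [h hI Hh] := IHk (row' i M).
exists (fun j => lift i (h j)); first by move=> j l /lift_inj /hI.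
have -> : rowsub (fun j => lift i (h j)) M = rowsub h (row' i M).
  by apply/matrixP => j l; rewrite !mxE.
move: Hh; rewrite det_gram_row'// normrM => Hh.
have c0 : 0 <= coproj M i i.
  by apply: le_trans Hi; rewrite divr_ge0// subr_ge0 ler_nat -addnS leq_addr.
have kE : ((m + k).+1%:R - m%:R : F) = k.+1%:R by rewrite -addnS natrD addrC addKr.
move: Hi; rewrite kE => Hi.
(* The factors [(k + 1) / (m + k + 1)] multiply up to [1 / 'C(N, m)], the constant that averaging
   the Cauchy-Binet formula would give. *)
rewrite -(ler_pM2r (_ : 0 < k.+1%:R / (m + k).+1%:R)) ?divr_gt0//.
apply: le_trans (ler_wpM2l _ Hi) _ => //.
rewrite -[X in _ * X]ger0_norm//; apply: le_trans Hh _.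
rewrite [X in _ <= X]mulrAC ler_wpM2r ?sqr_ge0//.
rewrite mulrA ler_pdivlMr// -!natrM ler_nat.
have := mul_bin_down (m + k).+1 m; rewrite /= (_ : ((m + k).+1 - m = k.+1)%N); last lia.
by move=> E; rewrite mulnC E mulnC.
Qed.

End Determinants.

(** * Almost invariant finite sets *)

Section Windows.
Variables (R : realType) (G : groupType).
Implicit Types (s w T : seq G) (k : R).

Definition invariant T k s :=
  [/\ uniq s, s != [::] &
      forall t, t \in T -> (count (fun q => (q * t)%g \notin s) s)%:R <= k * (size s)%:R].

(* As (alpha c q)_d = q_(c^-1 d), the joint iterates along a left Folner set F only
   see coordinates in F^-1, which is right invariant. *)
Definition windows : set_system (seq G) :=
  [set P | exists T k, 0 < k /\ forall s, invariant T k s -> P s].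

Lemma invariant_sub T T' k k' s : {subset T <= T'} -> k' <= k ->
  invariant T' k' s -> invariant T k s.
Proof.
move=> TT kk [us s0 H]; split=> // t /TT /H /le_trans; apply.
by rewrite ler_wpM2r.
Qed.

Global Instance windows_filter : Filter windows.
Proof.
split.
- by exists [::], 1; split.
- move=> P Q [T [k [k0 HP]]] [T' [k' [k'0 HQ]]].
  exists (T ++ T'), (Num.min k k'); split; first by rewrite lt_min k0.
  move=> s si; split.
    apply: HP; apply: invariant_sub si; rewrite ?ge_min ?lexx// => t.
    by rewrite mem_cat => ->.
  apply: HQ; apply: invariant_sub si; rewrite ?ge_min ?lexx ?orbT// => t.
  by rewrite mem_cat => ->; rewrite orbT.
- by move=> P Q PQ [T [k [k0 HP]]]; exists T, k; split=> // s /HP /PQ.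
Qed.

Lemma near_invariant T k : 0 < k -> windows (invariant T k).
Proof. by move=> k0; exists T, k. Qed.

Lemma count_shift (p : pred G) s t : uniq s ->
  (count (fun q => ((q * t)%g \in s) && p (q * t)%g) s <= count p s)%N.
Proof.
move=> us; rewrite -2!size_filter -(size_map (fun q => (q * t)%g)).
apply: uniq_leq_size.
  by rewrite map_inj_uniq ?filter_uniq// => a b /mulIg.
move=> x /mapP[q]; rewrite mem_filter => /andP[/andP[qs pq] _] ->.
by rewrite mem_filter pq.
Qed.

Lemma count_has_le (T : eqType) (s : seq T) (I : Type) (r : seq I) (P : I -> pred T) :
  (count (fun q => has (fun i => P i q) r) s <= \sum_(i <- r) count (P i) s)%N.
Proof.
elim: r => [|i r IHr]; first by rewrite big_nil -(count_pred0 s).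
rewrite big_cons; apply: leq_trans (leq_add (leqnn _) IHr).
have := count_predUI (P i) (fun q => has (fun i => P i q) r) s.
by move=> <-; rewrite /predU /=; exact: leq_addr.
Qed.

(** A set of bad points, boundary included, grows at most by the factor [size T] when every point
    with a bad neighbour is added. This controls how errors spread under [lop]. *)
Lemma count_neighbourhood T k s (p : pred G) : 0 <= k -> invariant T k s ->
  (count (fun q => has (fun t => ((q * t)%g \notin s) || p (q * t)%g) T) s)%:R
    <= (size T)%:R * (k * (size s)%:R + (count p s)%:R).
Proof.
move=> k0 [us s0 H].
apply: (@le_trans _ _ (\sum_(t <- T) (count (fun q => ((q * t)%g \notin s) || p (q * t)%g) s)%:R)).
  by rewrite -natr_sum ler_nat; exact: count_has_le.
apply: (@le_trans _ _ (\sum_(t <- T) (k * (size s)%:R + (count p s)%:R))); last first.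
  by rewrite big_const_seq count_predT iter_addr_0 mulr_natl.
rewrite !big_seq; apply: ler_sum => t tT.
apply: (@le_trans _ _ ((count (fun q => (q * t)%g \notin s) s)%:R +
    (count (fun q => ((q * t)%g \in s) && p (q * t)%g) s)%:R)).
  rewrite -natrD ler_nat -[X in (_ <= X)%N]count_predUI; apply: leq_trans (leq_addr _ _).
  by apply: sub_count => q /=; case: (_ \in s).
by rewrite lerD ?H// ler_nat count_shift.
Qed.

(** Properness of the filter [windows], the form in which amenability serves to pass to adjoints. *)
Definition windows_proper := forall T k, 0 < k -> exists s, invariant T k s.

Definition winv (s : seq G) := [seq (c^-1)%g | c <- s].

Lemma winv_uniq s : uniq (winv s) = uniq s.
Proof. by rewrite map_inj_uniq//; exact: invg_inj. Qed.

Lemma folner_windows (F : nat -> {fset G}) : folner R F ->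
  forall P, windows P -> \forall n \near \oo, P (winv (F n)).
Proof.
move=> [F0 HF] P [T [k [k0 HP]]].
suff : \forall n \near \oo, forall t, t \in T ->
    (count (fun q => (q * t)%g \notin winv (F n)) (winv (F n)))%:R <= k * (size (winv (F n)))%:R.
  apply: filterS => n Hn; apply: HP; split => //.
    by rewrite winv_uniq fset_uniq.
  by rewrite -size_eq0 size_map (cardfs_eq0 (F n)).
elim: T {P HP} => [|t T IHT]; first by apply: nearW.
have Ht : \forall n \near \oo,
    (count (fun q => (q * t)%g \notin winv (F n)) (winv (F n)))%:R <= k * (size (winv (F n)))%:R.
  (* [q^-1 t] leaves the inverse of [F n] exactly when [t^-1 q] leaves [F n], so the Folner
     condition is applied to [t^-1]. *)
  have /cvgrPdist_lt/(_ _ k0) := HF (t^-1)%g.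
  apply: filterS => n; rewrite sub0r normrN ger0_norm ?divr_ge0// => /ltW.
  have F1 : (0 : R) < #|` F n|%:R by rewrite ltr0n cardfs_gt0.
  rewrite ler_pdivrMr// size_map; apply: le_trans; rewrite ler_nat count_map.
  rewrite -size_filter -(size_map (fun q => (t^-1 * q)%g)).
  apply: uniq_leq_size.
    by rewrite map_inj_uniq ?filter_uniq ?fset_uniq// => a b /mulgI.
  move=> x /mapP[q]; rewrite mem_filter => /andP[/= qs qF] ->.
  rewrite /fsymdiff /ltranslate !inE; apply/orP; left; apply/andP; split.
    apply: contra qs => qF'; apply/mapP; exists (t^-1 * q)%g => //.
    by rewrite invgM invgK.
  by apply/imfsetP; exists q.
move: Ht IHT; apply: filterS2 => n Hn IHn t'; rewrite inE => /predU1P[->//|]; exact: IHn.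
Qed.

Lemma amenable_windows_proper : amenable R G -> windows_proper.
Proof.
move=> [F FF] T k k0; have [n _ /(_ n (leqnn n))] := folner_windows FF (near_invariant T k0).
by exists (winv (F n)).
Qed.

Definition wmul s T := undup [seq (q * t)%g | q <- s, t <- T].

Lemma mem_wmul s T q t : q \in s -> t \in T -> (q * t)%g \in wmul s T.
Proof. by move=> qs tT; rewrite mem_undup; apply/allpairsP; exists (q, t). Qed.

Lemma wmulP s T c :
  c \in wmul s T -> exists q t, [/\ q \in s, t \in T & c = (q * t)%g].
Proof. by rewrite mem_undup => /allpairsP[[q t] [/= qs tT E]]; exists q, t. Qed.

Lemma size_filter_wmul s T k : 0 <= k -> invariant T k s ->
  (size [seq c <- wmul s T | c \notin s])%:R <= (size T)%:R * k * (size s)%:R.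
Proof.
move=> k0 [us s0 H].
apply: (@le_trans _ _ (\sum_(t <- T) (count (fun q => (q * t)%g \notin s) s)%:R)); last first.
  apply: (@le_trans _ _ (\sum_(t <- T) (k * (size s)%:R))).
    by rewrite !big_seq; apply: ler_sum.
  by rewrite big_const_seq count_predT iter_addr_0 -mulrA mulr_natl.
rewrite -natr_sum ler_nat.
have -> : (\sum_(t <- T) count (fun q => (q * t)%g \notin s) s =
    size [seq (q * t)%g | t <- T, q <- [seq q <- s | (q * t)%g \notin s]])%N.
  by rewrite size_allpairs_dep sumnE big_map; apply: eq_bigr => t _; rewrite size_filter.
apply: uniq_leq_size; first by rewrite filter_uniq ?undup_uniq.
move=> c; rewrite mem_filter => /andP[cs /wmulP[q [t [qs tT E]]]].
by apply/allpairsPdep; exists t, q; rewrite mem_filter -E cs qs.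
Qed.

Lemma wmul_windows T : T != [::] -> forall P, windows P -> windows (fun s => P (wmul s T)).
Proof.
case: T => // t0 T' _; set T := t0 :: T' => P [S [k [k0 HP]]].
have T0 : 0 < (size T)%:R :> R by rewrite ltr0n.
(* If [q t c] is outside [wmul s T], then [q (t c t0^-1)] is outside [s], because multiplying it by
   [t0] gives [q t c]. So invariance of [s] under [A] passes to [wmul s T]. *)
pose A := [seq (t * c * t0^-1)%g | t <- T, c <- S].
exists A, (k / (size T)%:R); split; first by rewrite divr_gt0.
move=> s si; have [us s0 Hs] := si; apply: HP.
have sz : (size s <= size (wmul s T))%N.
  rewrite -(size_map (fun q => (q * t0)%g) s); apply: uniq_leq_size.
    by rewrite map_inj_uniq// => a b /mulIg.
  by move=> x /mapP[q qs ->]; rewrite mem_wmul// mem_head.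
split; first exact: undup_uniq.
  by rewrite -size_eq0 -lt0n (leq_trans _ sz)// lt0n size_eq0.
move=> c cS.
apply: (@le_trans _ _ (\sum_(t <- T) (count (fun q => (q * (t * c * t0^-1))%g \notin s) s)%:R)).
  rewrite -natr_sum ler_nat.
  have -> : (\sum_(t <- T) count (fun q => (q * (t * c * t0^-1))%g \notin s) s =
    size [seq (q * t)%g | t <- T, q <- [seq q <- s | (q * (t * c * t0^-1))%g \notin s]])%N.
    by rewrite size_allpairs_dep sumnE big_map; apply: eq_bigr => t _; rewrite size_filter.
  rewrite -size_filter; apply: uniq_leq_size; first by rewrite filter_uniq ?undup_uniq.
  move=> d; rewrite mem_filter => /andP[dc /wmulP[q [t [qs tT E]]]].
  apply/allpairsPdep; exists t, q; rewrite mem_filter qs andbT; split=> //.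
  apply: contra dc => qs'; rewrite (_ : (d * c = (q * (t * c * t0^-1)) * t0)%g).
    by rewrite mem_wmul// mem_head.
  by rewrite E !mulgA mulgKV.
apply: (@le_trans _ _ (\sum_(t <- T) (k / (size T)%:R * (size s)%:R))).
  rewrite !big_seq; apply: ler_sum => t tT; apply: Hs.
  by apply/allpairsP; exists (t, c).
rewrite big_const_seq count_predT iter_addr_0 -(mulr_natr (_ * _)) mulrAC divfK ?gt_eqF//.
by apply: ler_wpM2l; [exact: ltW|rewrite ler_nat].
Qed.

End Windows.

(** * Compressions to finite windows *)

Section Compressions.
Variables (R : realType) (G : groupType).
Implicit Types (a b u r : seq (R * G)) (x y : G -> R) (c d : G) (s w : seq G).

Lemma sum_seq_ord s (F : G -> R) : \sum_(c <- s) F c = \sum_(j < size s) F (nth 1%g s j).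
Proof. by rewrite (big_nth 1%g) big_mkord. Qed.

Definition vecf s (y : 'cV[R]_(size s)) c := \sum_j y j 0 * dlt R (nth 1%g s j) c.

Lemma vecf_nth s (y : 'cV[R]_(size s)) (j : 'I_(size s)) : uniq s -> vecf y (nth 1%g s j) = y j 0.
Proof.
move=> us; rewrite /vecf (bigD1 j)//= /dlt eqxx mulr1 big1 ?addr0// => i ij.
by rewrite nth_uniq// val_eqE eq_sym (negPf ij) mulr0.
Qed.

Lemma vecf_out s (y : 'cV[R]_(size s)) c : c \notin s -> vecf y c = 0.
Proof.
move=> cs; rewrite /vecf big1// => j _; rewrite /dlt; case: eqP => [E|_]; rewrite ?mulr0//.
by rewrite E mem_nth in cs.
Qed.

Definition mxop a w s : 'M[R]_(size w, size s) :=
  \matrix_(i, j) lop a (dlt R (nth 1%g s j)) (nth 1%g w i).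

Lemma mxop_vec a w s (y : 'cV[R]_(size s)) (i : 'I_(size w)) :
  lop a (vecf y) (nth 1%g w i) = (mxop a w s *m y) i 0.
Proof.
rewrite /vecf lop_sum mxE; apply: eq_bigr => j _.
by rewrite lopZ mxE mulrC.
Qed.

Lemma trmx_mxop a w s : (mxop a w s)^T = mxop (lstar a) s w.
Proof. by apply/matrixP => i j; rewrite !mxE lop_dltC. Qed.

(** [lop a x] at [c] reads [c * p.2], so if [x] lives on [s], its image lives on
    [wmul s (sinv a)]. *)
Definition sinv a := [seq (p.2^-1)%g | p <- a].

Lemma lop_out a x s c : (forall d, d \notin s -> x d = 0) ->
  c \notin wmul s (sinv a) -> lop a x c = 0.
Proof.
move=> xs cs; rewrite /lop big_seq big1// => p pa; rewrite xs ?mulr0//.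
apply: contra cs => ds; rewrite -(mulgK p.2 c) mem_wmul//.
exact: (map_f (fun p => (p.2^-1)%g)).
Qed.

(** The middle window has to contain the support of the image of [b], so that nothing is cut off
    between the two factors. *)
Lemma mxop_mul a b v w s : uniq w -> {subset wmul s (sinv b) <= w} ->
  mxop (lmul a b) v s = mxop a v w *m mxop b w s.
Proof.
move=> uw bw; apply/matrixP => i j; rewrite [in RHS]mxE.
under eq_bigr do rewrite !mxE.
rewrite mxE lop_mul.
set x := lop b _.
rewrite (@eq_lop _ _ a x (finsum_on w x)); last first.
  move=> d; case: (boolP (d \in w)) => dw; first by rewrite finsum_onE.
  have -> : x d = 0.
    apply: (lop_out (s := s)); last by apply: contra dw; exact: bw.
    by move=> e es; rewrite /dlt; case: eqP => // E; rewrite E mem_nth in es.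
  rewrite /finsum_on big_seq big1// => c cw.
  by rewrite /dlt; case: eqP => [E|]; rewrite ?mulr0//; rewrite E cw in dw.
rewrite /finsum_on lop_sum sum_seq_ord; apply: eq_bigr => k _.
by rewrite lopZ mulrC.
Qed.

Lemma sum_sqr_mx n (y : 'cV[R]_n) : \sum_j y j 0 ^+ 2 = (y^T *m y) 0 0.
Proof. by rewrite mxE; apply: eq_bigr => j _; rewrite mxE expr2. Qed.

Lemma sqle_vecf a s w (y : 'cV[R]_(size s)) : uniq w -> {subset wmul s (sinv a) <= w} ->
  sqle (lop a (vecf y)) (\sum_i (mxop a w s *m y) i 0 ^+ 2).
Proof.
move=> uw aw; have -> : \sum_i (mxop a w s *m y) i 0 ^+ 2 = \sum_(c <- w) lop a (vecf y) c ^+ 2.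
  by rewrite sum_seq_ord; apply: eq_bigr => i _; rewrite mxop_vec.
apply: sqle_fin => // c cw; apply: (lop_out (s := s)); first exact: vecf_out.
by apply: contra cw; exact: aw.
Qed.

Lemma mxop_lower a : left_inv a -> exists2 C, 0 < C &
  forall s w (y : 'cV[R]_(size s)), uniq s -> uniq w -> {subset wmul s (sinv a) <= w} ->
    \sum_j y j 0 ^+ 2 <= C * \sum_i (mxop a w s *m y) i 0 ^+ 2.
Proof.
move=> /left_inv_sq[C C0 H]; exists C => // s w y us uw aw.
have -> : \sum_j y j 0 ^+ 2 = \sum_(c <- s) vecf y c ^+ 2.
  by rewrite sum_seq_ord; apply: eq_bigr => i _; rewrite vecf_nth.
by apply: H => //; [exact: vecf_out|exact: sqle_vecf].
Qed.

Lemma mxop_gram_unit a s w : left_inv a -> uniq s -> uniq w -> {subset wmul s (sinv a) <= w} ->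
  (mxop a w s)^T *m mxop a w s \in unitmx.
Proof.
move=> /mxop_lower[C C0 H] us uw aw; apply: unitmx_inj => y My.
have := H s w y us uw aw; rewrite [in leRHS]sum_sqr_mx trmx_mul -!mulmxA (mulmxA (mxop a w s)^T) My !mulmx0 mxE mulr0.
move=> y0; apply/matrixP => i j; rewrite ord1 mxE; apply/eqP; rewrite -sqrf_eq0; apply/eqP.
apply: le_anti; rewrite sqr_ge0 andbT; apply: le_trans y0.
by rewrite (bigD1 i)//= lerDl; apply: sumr_ge0 => k _; exact: sqr_ge0.
Qed.

Lemma lop_dlt_translate a c d : lop a (dlt R c) d = lop a (dlt R 1%g) (c^-1 * d)%g.
Proof.
rewrite -lop_translate; apply: eq_lop => e; rewrite /dlt; congr (nat_of_bool _)%:R.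
by apply/eqP/eqP => [->|E]; [rewrite mulVg|rewrite -[e](mulKVg c) E mulg1].
Qed.

(* The images of the point masses of a window under [lop a] span a subspace of
   almost full dimension among the functions on a slightly larger window, so some
   point mass is almost in this subspace. *)
Lemma near_delta a : windows_proper R G -> left_inv a -> forall e : R, 0 < e ->
  exists y s, [/\ uniq s, forall c, c \notin s -> y c = 0 &
    sqle (fun c => lop a y c - dlt R 1%g c) e].
Proof.
move=> wp ai e e0; set T := sinv a; pose N : R := (size T)%:R + 1.
have N0 : 0 < N by rewrite ltr_pwDr.
have k0 : 0 < e / N by rewrite divr_gt0.
have [s si] := wp T _ k0; have [us s0 _] := si.
pose w := s ++ [seq c <- wmul s T | c \notin s].
have uw : uniq w.
  rewrite cat_uniq us filter_uniq ?undup_uniq// andbT /=.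
  by apply/hasPn => c; rewrite mem_filter => /andP[].
have aw : {subset wmul s T <= w}.
  by move=> c cs; rewrite mem_cat mem_filter cs andbT; case: (_ \in _).
have uM := mxop_gram_unit ai us uw aw; set M := mxop a w s in uM.
have w0 : (0 < size w)%N by rewrite size_cat ltn_addr// lt0n size_eq0.
have [i Hi] := exists_leverage_le uM w0.
(* [z] is the least squares solution: [M z] is the projection of the basis vector [i] to the column
   space, and the squared error is [coproj M i i] because [coproj M] is a symmetric idempotent. *)
pose z := invmx (M^T *m M) *m M^T *m delta_mx i (0 : 'I_1); set p := nth 1%g w i.
have Hz : sqle (fun c => lop a (vecf z) c - dlt R p c) e.
  have E : \sum_(c <- w) (lop a (vecf z) c - dlt R p c) ^+ 2 = coproj M i i.
    have -> : \sum_(c <- w) (lop a (vecf z) c - dlt R p c) ^+ 2 =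
        \sum_j (- (coproj M *m delta_mx i (0 : 'I_1))) j 0 ^+ 2.
      rewrite sum_seq_ord; apply: eq_bigr => j _; congr (_ ^+ 2).
      have -> : - (coproj M *m delta_mx i (0 : 'I_1)) = M *m z - delta_mx i 0.
        by rewrite /coproj mulmxBl mul1mx opprB /z !mulmxA.
      have D : (- delta_mx i 0 : 'cV[R]_(size w)) j 0 = - (j == i)%:R.
        by rewrite !mxE eqxx andbT.
      by rewrite mxop_vec [RHS]mxE D /dlt /p nth_uniq.
    under eq_bigr do rewrite mxE sqrrN.
    rewrite sum_sqr_mx trmx_mul trmx_coproj.
    by rewrite -mulmxA (mulmxA (coproj M)) coproj_idem// -colE trmx_delta -rowE !mxE.
  move=> t ut; apply: (@le_trans _ _ (\sum_(c <- w) (lop a (vecf z) c - dlt R p c) ^+ 2)).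
    apply: sqle_fin => // c cw; rewrite (lop_out (s := s)) ?sub0r.
    - rewrite /dlt; case: eqP => [E'|_]; rewrite ?oppr0//.
      by rewrite E' /p mem_nth in cw.
    - exact: vecf_out.
    - by apply: contra cw; exact: aw.
  rewrite E; apply: le_trans Hi _.
  have sw : (size w)%:R = (size s)%:R + (size [seq c <- wmul s T | c \notin s])%:R :> R.
    by rewrite size_cat natrD.
  rewrite ler_pdivrMr ?ltr0n// {1}sw [X in X - _]addrC addrK.
  apply: le_trans (size_filter_wmul (ltW k0) si) _.
  apply: ler_pM => //; last by rewrite sw lerDl.
    by rewrite mulr_ge0// ltW.
  by rewrite mulrC mulrAC ler_pdivrMr// ler_wpM2l ?(ltW e0)// /N lerDl.
exists (fun c => vecf z (p * c)%g), [seq (p^-1 * c)%g | c <- s]; split.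
- by rewrite map_inj_uniq// => c d /mulgI.
- move=> c cs; apply: vecf_out; apply: contra cs => cs.
  by apply/mapP; exists (p * c)%g => //; rewrite mulKg.
- move=> t ut; have := Hz [seq (p * c)%g | c <- t].
  rewrite map_inj_uniq => [/(_ ut)|c d /mulgI//].
  rewrite big_map; apply: le_trans; apply: ler_sum => c _.
  rewrite lop_translate; suff -> : dlt R 1%g c = dlt R p (p * c)%g by [].
  rewrite /dlt; congr (nat_of_bool _)%:R.
  by apply/eqP/eqP => [->|E]; [rewrite mulg1|apply: (mulgI p); rewrite mulg1].
Qed.

End Compressions.

(** * Left invertibility of the adjoint *)

Section DirectFiniteness.
Variables (R : realType) (G : groupType).
Implicit Types (a b u r p : seq (R * G)) (x y : G -> R) (c d : G) (s : seq G).

Lemma lop_seq1 (k : R) x c : lop [:: (k, 1%g)] x c = k * x c.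
Proof. by rewrite /lop big_seq1 mulg1. Qed.

Lemma lop_cons1 p x c : lop ((1, 1%g) :: p) x c = x c + lop p x c.
Proof. by rewrite /lop big_cons mul1r mulg1. Qed.

(** Merges the repetitions of each group element, so that cancellations are carried out and [l1norm]
    becomes the true l^1 norm. *)
Definition reduced p : seq (R * G) :=
  [seq (lop (lstar p) (dlt R 1%g) d, d) | d <- undup [seq q.2 | q <- p]].

Lemma lop_reduced p x c : lop (reduced p) x c = lop p x c.
Proof.
rewrite /lop big_map /= /lop.
under eq_bigr do rewrite mulr_suml.
rewrite exchange_big big_map /= [LHS]big_seq [RHS]big_seq.
apply: eq_bigr => q qp; rewrite (bigD1_seq q.2) ?undup_uniq ?mem_undup ?map_f//=.
rewrite mulgV /dlt eqxx mulr1 big1 ?addr0// => d dq.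
case: eqP => [E|]; rewrite ?mulr0 ?mul0r//; case/eqP: dq.
by apply: (mulIg q.2^-1%g); rewrite E mulgV.
Qed.

Lemma l1norm_reduced p K :
  (forall s, uniq s -> \sum_(c <- s) `|lop p (dlt R 1%g) c| <= K) -> l1norm (reduced p) <= K.
Proof.
move=> H; rewrite /l1norm big_map /=.
have := H [seq (d^-1)%g | d <- undup [seq q.2 | q <- p]].
rewrite map_inj_uniq ?undup_uniq => [/(_ isT)|]; last exact: invg_inj.
rewrite big_map; apply: le_trans; apply: ler_sum => d _.
by rewrite -(lop_dltC p) lop_dlt_translate mulg1.
Qed.

Lemma sum_lop_delta p s : uniq s -> \sum_(c <- s) `|lop p (dlt R 1%g) c| <= l1norm p.
Proof.
move=> us.
apply: (@le_trans _ _ (\sum_(c <- s) \sum_(q <- p) `|q.1| * dlt R 1%g (c * q.2)%g)).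
  apply: ler_sum => c _; apply: le_trans (ler_norm_sum _ _ _) _.
  by apply: ler_sum => q _; rewrite normrM [X in _ * X]ger0_norm// /dlt ler0n.
rewrite exchange_big; apply: ler_sum => q _ /=; rewrite -mulr_sumr ler_piMr//.
rewrite /dlt -natr_sum -[X in _ <= X]/(1%:R) ler_nat.
have -> : (\sum_(c <- s) (c * q.2 == 1)%g = count (pred1 (q.2^-1)%g) s)%N.
  rewrite -sum1_count [RHS]big_mkcond; apply: eq_bigr => c _ /=.
  have -> : (c * q.2 == 1)%g = (c == q.2^-1)%g.
    by apply/eqP/eqP => [E|->]; [rewrite -[c](mulgK q.2) E mul1g|rewrite mulVg].
  by case: eqP.
by rewrite count_uniq_mem// leq_b1.
Qed.

(** Let [U k] be the Neumann partial sums for [a]. The elements [a (U k) - 1] form a Cauchy sequence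
    in l^1 with geometric rate, and their coefficients tend to 0 because the point mass at 1 is
    close in l^2 to some [a y], on which [U k] nearly inverts [a]. So [a (U k) - 1] is small in l^1,
    and transposition gives the left inverse of the adjoint. *)
Lemma left_inv_star a : windows_proper R G -> left_inv a -> left_inv (lstar a).
Proof.
move=> wp ai; have [u [r [r2 uar]]] := ai.
pose U k := neumann_inv u r k.
(* [D k] is the increment [(-r)^k u] from [U k] to [U k.+1]. *)
pose D := fix D k := if k is k'.+1 then lopp (lmul r (D k')) else u.
have DE k x c : lop (U k.+1) x c = lop (U k) x c + lop (D k) x c.
  elim: k x c => [|k IHk] x c.
    by rewrite /U /= lop_cat lop_opp lop_mul /lop big_nil add0r [X in _ - X]big1 ?subr0// => p _; rewrite big_nil mulr0.
  rewrite {1}/U [neumann_inv _ _ _]/= lop_cat lop_opp lop_mul -/(U k.+1).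
  rewrite (eq_lop r (IHk x)) lopD opprD addrA; congr (_ + _).
    by rewrite /U /= lop_cat lop_opp lop_mul.
  by rewrite /= lop_opp lop_mul.
have nD k : l1norm (D k) <= l1norm u * 2^-1 ^+ k.
  elim: k => [|k IHk] /=; first by rewrite expr0 mulr1.
  by rewrite l1norm_opp l1norm_mul exprS mulrCA ler_pM.
have nU k : l1norm (U k) <= 2 * l1norm u.
  elim: k => [|k IHk]; first by rewrite /U /= {1}/l1norm big_nil mulr_ge0.
  rewrite /U /= l1norm_cat l1norm_opp l1norm_mul -/(U k).
  have := ler_pM (l1norm_ge0 r) (l1norm_ge0 (U k)) r2 IHk.
  by rewrite mulrA mulVf// mul1r => H; rewrite mulr_natl mulr2n lerD2l.
have rk k : l1norm (neumann_rest r k) <= 2^-1 ^+ k.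
  by rewrite l1norm_neumann_rest lerXn2r ?nnegrE ?l1norm_ge0 ?invr_ge0 ?ler0n.
pose h k c := lop a (lop (U k) (dlt R 1%g)) c - dlt R 1%g c.
have hk k n s : uniq s -> \sum_(c <- s) `|h k c| <=
    \sum_(c <- s) `|h (k + n)%N c| + 2 * l1norm a * l1norm u * (2^-1 ^+ k - 2^-1 ^+ (k + n)).
  move=> us; elim: n => [|n IHn]; first by rewrite addn0 subrr mulr0 addr0.
  apply: le_trans IHn _.
  apply: (@le_trans _ _ (\sum_(c <- s) (`|h (k + n.+1)%N c| + `|lop (lmul a (D (k + n)%N)) (dlt R 1%g) c|) +
      2 * l1norm a * l1norm u * (2^-1 ^+ k - 2^-1 ^+ (k + n)))).
    rewrite lerD2r; apply: ler_sum => c _; rewrite addnS /h lop_mul.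
    rewrite (eq_lop a (DE (k + n)%N _)) lopD.
    set A := lop a _ c; set B := lop a _ c; set d := dlt _ _ _.
    have -> : A - d = (A + B - d) - B by ring.
    exact: ler_normB.
  rewrite big_split -addrA lerD2l.
  have := sum_lop_delta (lmul a (D (k + n)%N)) us.
  set S := \sum_(c <- s) _; rewrite l1norm_mul => S1.
  have := le_trans S1 (ler_wpM2l (l1norm_ge0 a) (nD (k + n)%N)).
  rewrite addnS exprS; set P := 2^-1 ^+ (k + n); set Q := 2^-1 ^+ k.
  rewrite /=; have -> : 2 * l1norm a * l1norm u * (Q - 2^-1 * P) =
    2 * l1norm a * l1norm u * (Q - P) + l1norm a * (l1norm u * P) by field.
  lra.
have h0 c e : 0 < e -> exists n, forall m, (n <= m)%N -> `|h m c| <= e.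
  move=> e0; pose A := l1norm a; pose B := 2 * l1norm u.
  (* [h m c] is a signed sum of three terms with squares at most [A^2 B^2 e^2 / K], [e^2 / K] and
     [e^2 / K]; as the square of the sum is at most three times the sum of squares, this [K] gives
     [e^2]. *)
  pose K := 3 * (A ^+ 2 * B ^+ 2 + 1 + 1).
  have K0 : 0 < K by rewrite mulr_gt0// ltr_wpDl// addr_ge0// mulr_ge0 ?sqr_ge0.
  have e2 : 0 < e ^+ 2 / K by rewrite divr_gt0// exprn_gt0.
  have [y [s [us ys Hy]]] := near_delta wp ai e2.
  have Y := sqle_fin us ys; set Y2 := \sum_(c <- s) _ in Y.
  have Y0 : 0 <= Y2 := sqle_ge0 Y.
  have [n Hn] : exists n, forall m, (n <= m)%N -> A ^+ 2 * ((2^-1 ^+ m) ^+ 2 * Y2) <= e ^+ 2 / K.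
    have cv : (fun m => A ^+ 2 * ((2^-1 ^+ m) ^+ 2 * Y2)) @ \oo --> (A ^+ 2 * ((0 : R) ^+ 2 * Y2)).
      have h2 : `|2^-1 : R| < 1 by rewrite ger0_norm//; lra.
      apply: cvgM; first exact: cvg_cst; apply: cvgM; last exact: cvg_cst.
      by rewrite expr2; under eq_fun do rewrite expr2; apply: cvgM; exact: cvg_expr.
    move: cv; rewrite expr0n mul0r mulr0 => /cvgrPdist_le/(_ _ e2)[n _ Hn].
    by exists n => m nm; have := Hn m nm; rewrite sub0r normrN => /(le_trans (ler_norm _)).
  exists n => m nm; rewrite -(@ler_pXn2r _ 2)// ?nnegrE// ?(ltW e0)//.
  rewrite real_normK ?num_real//.
  have s1 := sqle_lop a (sqle_lop (U m) Hy).
  have s2 := sqle_lop a (sqle_lop (neumann_rest r m) Y).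
  have := s1 [:: c] isT; have := s2 [:: c] isT; have := Hy [:: c] isT.
  rewrite !big_seq1.
  have hE : h m c = - lop a (lop (U m) (fun d => lop a y d - dlt R 1%g d)) c +
      lop a (lop (neumann_rest r m) y) c + (lop a y c - dlt R 1%g c).
    rewrite /h (eq_lop a (lopB (U m) (lop a y) (dlt R 1%g))) lopB.
    rewrite (eq_lop a (neumann_invP m uar y)) lopD; ring.
  rewrite hE.
  set X1 := lop a (lop (U m) _) c; set X2 := lop a (lop (neumann_rest r m) y) c.
  set X3 := lop a y c - _ => I3 I2 I1.
  have J1 : X1 ^+ 2 <= A ^+ 2 * B ^+ 2 * (e ^+ 2 / K).
    apply: le_trans I1 _; rewrite -mulrA ler_wpM2l ?sqr_ge0// ler_wpM2r ?(ltW e2)//.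
    by rewrite lerXn2r ?nnegrE ?mulr_ge0.
  have J2 : X2 ^+ 2 <= e ^+ 2 / K.
    apply: le_trans I2 _; apply: le_trans _ (Hn _ nm); rewrite ler_wpM2l ?sqr_ge0//.
    by rewrite ler_wpM2r// lerXn2r ?nnegrE ?exprn_ge0 ?invr_ge0.
  have -> : e ^+ 2 = 3 * (A ^+ 2 * B ^+ 2 * (e ^+ 2 / K) + e ^+ 2 / K + e ^+ 2 / K).
    have -> : 3 * (A ^+ 2 * B ^+ 2 * (e ^+ 2 / K) + e ^+ 2 / K + e ^+ 2 / K) =
      K * (e ^+ 2 / K) by rewrite /K; ring.
    by rewrite mulrC divfK// gt_eqF.
  have := sqr_ge0 (X1 + X2); have := sqr_ge0 (X1 + X3); have := sqr_ge0 (X2 - X3).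
  move: J1 J2 I3; nra.
(* Let [n] grow in [hk]: on the finite set [s] the term with [h (k + n)] tends to 0 by [h0]. *)
have hs k s : uniq s -> \sum_(c <- s) `|h k c| <= 2 * l1norm a * l1norm u * 2^-1 ^+ k.
  move=> us; apply/ler_addgt0Pr => e e0.
  have [n Hn] : exists n, forall m, (n <= m)%N -> \sum_(c <- s) `|h m c| <= e.
    have e1 : 0 < e / (size s).+1%:R by rewrite divr_gt0.
    have [n Hn] : exists n, forall m, (n <= m)%N -> forall c, c \in s -> `|h m c| <= e / (size s).+1%:R.
      move: (e / _) e1 => z e1; elim: (s) => [|c t [n Hn]]; first by exists 0%N.
      have [n' Hn'] := h0 c _ e1; exists (maxn n n') => m; rewrite geq_max => /andP[nm n'm] d.
      by rewrite inE => /predU1P[->|]; [exact: Hn'|exact: Hn].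
    exists n => m nm; apply: (@le_trans _ _ (\sum_(c <- s) (e / (size s).+1%:R))).
      by rewrite !big_seq; apply: ler_sum => c cs; exact: Hn.
    rewrite big_const_seq count_predT iter_addr_0 -(mulr_natr (_ / _)) mulrAC ler_pdivrMr//.
    by rewrite ler_wpM2l ?(ltW e0)// ler_nat.
  apply: le_trans (hk k n s us) _; rewrite [leRHS]addrC lerD ?Hn ?leq_addl//.
  by rewrite ler_wpM2l ?mulr_ge0// gerBl exprn_ge0// invr_ge0.
have [k Hk] : exists k, 2 * l1norm a * l1norm u * 2^-1 ^+ k <= 2^-1.
  have h2 : `|2^-1 : R| < 1 by rewrite ger0_norm//; lra.
  have cv : (fun m => 2 * l1norm a * l1norm u * 2^-1 ^+ m) @ \oo --> (2 * l1norm a * l1norm u * (0 : R)).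
    by apply: cvgM; [exact: cvg_cst|exact: cvg_expr].
  have e2 : (0 : R) < 2^-1 by rewrite invr_gt0.
  move: cv; rewrite mulr0 => /cvgrPdist_le/(_ _ e2)[n _ /(_ n (leqnn n))].
  by rewrite sub0r normrN => Hn; exists n; apply: le_trans Hn; exact: ler_norm.
pose p := reduced (lmul a (U k) ++ [:: (-1, 1%g)]).
have pE x c : lop p x c = lop a (lop (U k) x) c - x c.
  by rewrite lop_reduced lop_cat lop_mul lop_seq1 mulN1r.
exists (lstar (U k)), (lstar p); split.
  rewrite l1norm_star; apply: l1norm_reduced => s us; apply: le_trans _ Hk.
  apply: le_trans _ (hs k s us); apply: ler_sum => c _.
  by rewrite lop_cat lop_mul lop_seq1 mulN1r.
move=> x c; have E := @eq_lop_star _ _ (lmul a (U k)) ((1, 1%g) :: p).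
rewrite -lop_mul -lop_star_mul E.
  by rewrite [lstar (_ :: _)]/= invg1 lop_cons1.
by move=> y d; rewrite lop_mul lop_cons1 pE addrC subrK.
Qed.

End DirectFiniteness.

(** * Expansiveness gives a left inverse in l^1 *)

Section HahnBanach.
Variable R : realType.

Definition sublinear n (p : 'rV[R]_n -> R) :=
  (forall x y : 'rV[R]_n, p (x + y) <= p x + p y) /\
  (forall (t : R) (x : 'rV[R]_n), 0 <= t -> p (t *: x) = t * p x).

(** Hahn-Banach by induction on the dimension. By homogeneity the value [s] on the new coordinate is
    constrained only at 1 and -1; [key] says that the lower constraints lie below the upper ones, so
    their supremum will do. *)
Lemma sublinear_dominates n (p : 'rV[R]_n -> R) : sublinear p ->
  exists l : 'rV[R]_n, forall x : 'rV[R]_n, \sum_i l 0 i * x 0 i <= p x.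
Proof.
elim: n p => [|n IHn].
  move=> p [pD pZ]; exists 0 => x; rewrite big_ord0 [x]thinmx0.
  by have := pZ 0 0 (lexx 0); rewrite scale0r mul0r => ->.
rewrite -(add1n n) => p [pD pZ].
pose q (x : 'rV[R]_n) := p (row_mx (0 : 'rV_1) x : 'rV_(1 + n)).
have [l Hl] : exists l : 'rV[R]_n, forall x : 'rV[R]_n, \sum_i l 0 i * x 0 i <= q x.
  apply: IHn; split=> [x y|t x t0]; rewrite /q.
    have := pD (row_mx (0 : 'rV_1) x : 'rV_(1 + n)) (row_mx (0 : 'rV_1) y : 'rV_(1 + n)).
    by rewrite add_row_mx addr0.
  by rewrite -pZ// scale_row_mx scaler0.
pose e1 (t : R) (x : 'rV[R]_n) := p (row_mx (t%:M : 'rV_1) x : 'rV_(1 + n)).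
pose L (x : 'rV[R]_n) := \sum_i l 0 i * x 0 i.
have LD x y : L (x + y) = L x + L y.
  by rewrite /L -big_split; apply: eq_bigr => i _; rewrite mxE mulrDr.
have LZ t x : L (t *: x) = t * L x.
  by rewrite /L mulr_sumr; apply: eq_bigr => i _; rewrite mxE mulrCA.
have key x y : L x - e1 (-1) x <= e1 1 y - L y.
  rewrite lerBrDr addrAC lerBlDr -LD.
  apply: le_trans (Hl _) _; rewrite /q /e1 -(_ : row_mx (1%:M : 'rV_1) y + row_mx ((-1)%:M : 'rV_1) x = row_mx 0 (x + y)).
    exact: pD.
  by rewrite add_row_mx -raddfD /= subrr raddf0 addrC.
pose A := [set L x - e1 (-1) x | x in [set: 'rV[R]_n]].
have A0 : A !=set0 by exists (L 0 - e1 (-1) 0); exists 0.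
have supA : has_sup A by split=> //; exists (e1 1 0 - L 0) => _ [x _ <-].
pose s := sup A.
have s1 x : L x - e1 (-1) x <= s by apply: sup_upper_bound => //; exists x.
have s2 x : s <= e1 1 x - L x by apply: ge_sup => // _ [y _ <-].
exists (row_mx (s%:M : 'rV_1) l : 'rV_(1 + n)) => x.
rewrite -[x]hsubmxK; move: (lsubmx x) (rsubmx x) => t y.
rewrite big_split_ord big_ord1 /= !row_mxEl mxE eqxx mulr1n.
under eq_bigr do rewrite !row_mxEr.
rewrite -/(L y) (mx11_scalar t); move: (t 0 0) => {}t; rewrite mxE eqxx mulr1n.
have [t0|t0|->] := ltrgt0P t.
- have := s2 (t^-1 *: y); rewrite -(ler_pM2l t0) mulrBr LZ mulVKf ?gt_eqF//.
  rewrite /e1 -(pZ _ _ (ltW t0)) scale_row_mx scalerA divff ?gt_eqF// scale1r scale_scalar_mx mulr1.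
  by rewrite lerBrDr mulrC.
- have nt0 : 0 < - t by rewrite oppr_gt0.
  have := s1 ((- t)^-1 *: y); rewrite -(ler_pM2l nt0) mulrBr LZ mulVKf ?gt_eqF//.
  rewrite /e1 -(pZ _ _ (ltW nt0)) scale_row_mx scalerA divff ?gt_eqF// scale1r scale_scalar_mx mulrN1 opprK.
  rewrite lerBlDr mulNr -lerBlDl opprK mulrC; lra.
- by rewrite mulr0 add0r; apply: le_trans (Hl y) _; rewrite /q raddf0.
Qed.

Definition supn n (x : 'rV[R]_n) : R := \big[Num.max/0]_i `|x 0 i|.

Lemma supn_ge n (x : 'rV[R]_n) i : `|x 0 i| <= supn x.
Proof. exact: le_bigmax. Qed.

Lemma supn_le n (x : 'rV[R]_n) K : 0 <= K -> (forall i, `|x 0 i| <= K) -> supn x <= K.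
Proof. by move=> K0 xK; apply: bigmax_le => // i _. Qed.

Lemma supn_ge0 n (x : 'rV[R]_n) : 0 <= supn x.
Proof. exact: bigmax_ge_id. Qed.

Lemma supnD n (x y : 'rV[R]_n) : supn (x + y) <= supn x + supn y.
Proof.
apply: supn_le => [|i]; first by rewrite addr_ge0 ?supn_ge0.
by rewrite mxE; apply: le_trans (ler_normD _ _) _; rewrite lerD ?supn_ge.
Qed.

Lemma supnZ_le n (x : 'rV[R]_n) t : supn (t *: x) <= `|t| * supn x.
Proof.
apply: supn_le => [|i]; first by rewrite mulr_ge0 ?supn_ge0.
by rewrite mxE normrM ler_wpM2l ?supn_ge.
Qed.

Lemma supn0 n : supn (0 : 'rV[R]_n) = 0.
Proof.
by apply/le_anti; rewrite supn_ge0 andbT; apply: supn_le => // i; rewrite mxE normr0.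
Qed.

Lemma supnN n (x : 'rV[R]_n) : supn (- x) = supn x.
Proof. by apply: eq_bigr => i _; rewrite mxE normrN. Qed.

(* Dual form of the inequality [|phi x| <= e |x| + C |L x|]. *)
Lemma dual_decomposition n m (L : 'M[R]_(n, m)) (phi : 'cV[R]_n) (e C : R) :
  0 <= e -> 0 <= C ->
  (forall x : 'rV[R]_n, `|(x *m phi) 0 0| <= e * supn x + C * supn (x *m L)) ->
  exists (v : 'cV[R]_n) (u : 'cV[R]_m), phi = v + L *m u /\ \sum_i `|v i 0| <= e.
Proof.
move=> e0 C0 H.
(* The infimum over [x] is an infimal convolution of the weighted norm with [phi] on the graph of
   [L]; the hypothesis keeps it finite. A linear functional below it agrees with [phi] on the graph
   and has norm at most [e] on the first factor. *)
pose f (z : 'rV[R]_(n + m)) (x : 'rV[R]_n) :=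
  e * supn (lsubmx z - x) + C * supn (rsubmx z - x *m L) + (x *m phi) 0 0.
have fge z x : - (e * supn (lsubmx z) + C * supn (rsubmx z)) <= f z x.
  have h := H x; rewrite /f.
  have h1 := ler_wpM2l e0 (supnD (lsubmx z) (x - lsubmx z)).
  have h2 := ler_wpM2l C0 (supnD (rsubmx z) (x *m L - rsubmx z)).
  rewrite addrC subrK in h1; rewrite addrC subrK in h2.
  rewrite -(opprB (lsubmx z)) supnN in h1; rewrite -(opprB (rsubmx z)) supnN in h2.
  move: h; rewrite ler_norml => /andP[h _]; lra.
have l0 : lsubmx (0 : 'rV[R]_(n + m)) = 0 by apply/matrixP => i j; rewrite !mxE.
have r0 : rsubmx (0 : 'rV[R]_(n + m)) = 0 by apply/matrixP => i j; rewrite !mxE.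
pose F z := [set f z x | x in [set: 'rV[R]_n]].
have F0 z : F z !=set0 by exists (f z 0); exists 0.
have infF z : has_inf (F z).
  by split=> //; exists (- (e * supn (lsubmx z) + C * supn (rsubmx z))) => _ [x _ <-].
pose p z := inf (F z).
have ple z x : p z <= f z x by apply: inf_lbound; [exact: (infF z).2|exists x].
have lep z (K : R) : (forall x, K <= f z x) -> K <= p z.
  by move=> HK; apply: lb_le_inf => // _ [x _ <-].
have sp : sublinear p.
  split=> [z z'|t z].
    rewrite -lerBlDr; apply: (lep) => x; rewrite lerBlDr -lerBlDl; apply: (lep) => x'.
    rewrite lerBlDl; apply: le_trans (ple _ (x + x')) _; rewrite /f.
    have -> : lsubmx (z + z') - (x + x') = (lsubmx z - x) + (lsubmx z' - x').
      by rewrite linearD /= opprD addrACA.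
    have -> : rsubmx (z + z') - (x + x') *m L = (rsubmx z - x *m L) + (rsubmx z' - x' *m L).
      by rewrite linearD /= mulmxDl opprD addrACA.
    rewrite mulmxDl mxE.
    have := ler_wpM2l e0 (supnD (lsubmx z - x) (lsubmx z' - x')).
    have := ler_wpM2l C0 (supnD (rsubmx z - x *m L) (rsubmx z' - x' *m L)).
    lra.
  have half t' z' : 0 < t' -> p (t' *: z') <= t' * p z'.
    move=> t0; rewrite mulrC -ler_pdivrMr//; apply: (lep) => x; rewrite ler_pdivrMr// mulrC.
    apply: le_trans (ple _ (t' *: x)) _; rewrite /f.
    have -> : lsubmx (t' *: z') - t' *: x = t' *: (lsubmx z' - x).
      by rewrite linearZ /= scalerBr.
    have -> : rsubmx (t' *: z') - (t' *: x) *m L = t' *: (rsubmx z' - x *m L).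
      by rewrite linearZ /= -scalemxAl scalerBr.
    rewrite -scalemxAl mxE !mulrDr lerD2r.
    have := ler_wpM2l e0 (supnZ_le (lsubmx z' - x) t').
    have := ler_wpM2l C0 (supnZ_le (rsubmx z' - x *m L) t').
    rewrite gtr0_norm//; lra.
  rewrite le_eqVlt => /predU1P[<-|t0].
    rewrite scale0r mul0r; apply/le_anti/andP; split.
      apply: le_trans (ple 0 0) _; rewrite /f l0 r0 !mul0mx !subr0 mxE addr0.
      by rewrite !supn0 !mulr0 addr0.
    apply: (lep) => x; apply: le_trans (fge 0 x); rewrite l0 r0.
    by rewrite !supn0 !mulr0 addr0 oppr0.
  apply/le_anti; rewrite half//= -ler_pdivlMl//.
  have := half t^-1 (t *: z); rewrite invr_gt0 scalerA mulVf ?gt_eqF// scale1r; exact.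
have [l Hl] := sublinear_dominates sp.
have Hl' z : (z *m l^T) 0 0 <= p z.
  by rewrite mxE; under eq_bigr do rewrite mxE mulrC; exact: Hl.
exists (lsubmx l)^T, (rsubmx l)^T.
have lE (x : 'rV[R]_n) (y : 'rV[R]_m) : (row_mx x y *m l^T) 0 0 = (x *m (lsubmx l)^T) 0 0 + (y *m (rsubmx l)^T) 0 0.
  by rewrite -{1}[l]hsubmxK tr_row_mx mul_row_col mxE.
split.
  (* On the graph only an inequality is available; using it for both [x] and [- x] gives
     equality. *)
  have half (x : 'rV[R]_n) : (x *m ((lsubmx l)^T + L *m (rsubmx l)^T)) 0 0 <= (x *m phi) 0 0.
    have := le_trans (Hl' (row_mx x (x *m L))) (ple _ x).
    rewrite lE /f row_mxKl row_mxKr !subrr.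
    rewrite !supn0 !mulr0 !add0r => h; rewrite mulmxDr mulmxA.
    by rewrite [X in X <= _]mxE.
  apply/matrixP => i j; rewrite (ord1 j).
  have rE (M : 'cV[R]_n) : M i 0 = (delta_mx (0 : 'I_1) i *m M) 0 0.
    by rewrite -rowE mxE.
  rewrite rE [RHS]rE; apply/le_anti; rewrite half andbT.
  by have := half (- delta_mx 0 i); rewrite !mulNmx mxE [X in _ <= X]mxE lerN2.
(* The sign vector turns the bound by [e * supn x] into a bound on the l^1 norm of [v]. *)
pose x : 'rV[R]_n := \row_i Num.sg ((lsubmx l)^T i 0).
have := le_trans (Hl' (row_mx x 0)) (ple _ 0).
have z0 : (0 : 'M[R]_1) 0 0 = 0 by rewrite mxE.
rewrite lE /f row_mxKl row_mxKr !mul0mx !subr0 supn0 mulr0 z0 !addr0 => Hx.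
apply: (@le_trans _ _ (e * supn x)).
  apply: le_trans Hx; rewrite mxE le_eqVlt; apply/orP; left; apply/eqP.
  by apply: eq_bigr => i _; rewrite [x _ _]mxE -normrEsg.
rewrite ler_piMr//; apply: supn_le => // i; rewrite mxE normr_sg.
by case: (_ != 0).
Qed.

End HahnBanach.

(** * From injectivity on bounded functions to an inverse, by compactness and duality *)

Section CompactnessArgument.
Variables (R : realType) (G : groupType).
Implicit Types (a : seq (R * G)) (x y : G -> R) (c d : G) (S T : seq G).

Notation cfg := {ptws G -> R^o}.

Lemma nbhs_ptws_box (x : cfg) S (e : R) : 0 < e ->
  nbhs x [set y : cfg | forall c, c \in S -> `|x c - y c| < e].
Proof.
move=> e0; elim: S => [|d S IHS]; first by apply: filterS filterT => y _ c.
have Hd : nbhs x [set y : cfg | `|x d - y d| < e].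
  have Hb : nbhs (x d : R^o) [set z : R^o | `|x d - z| < e] by exact: nbhsx_ballx.
  exact: (@proj_continuous G (fun=> R^o) d x _ Hb).
apply: filterS2 IHS Hd => y H1 H2 c.
by rewrite inE => /predU1P[->|/H1].
Qed.

Lemma compact_cube (B : R) : compact [set x : cfg | forall c, `|x c| <= B].
Proof.
have -> : [set x : cfg | forall c, `|x c| <= B] = [set x : cfg | forall c, `[- B, B]%classic (x c)].
  by apply/seteqP; split=> x H c; have := H c; rewrite /= in_itv/= ler_norml.
exact: (@tychonoff G (fun=> R^o) (fun=> `[- B, B]%classic) (fun=> @segment_compact R (- B) B)).
Qed.

Lemma lop_close a x y c (e : R) :
  (forall d, d \in [seq (c * p.2)%g | p <- a] -> `|x d - y d| <= e) ->
  `|lop a x c - lop a y c| <= l1norm a * e.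
Proof.
move=> H; rewrite -lopB; apply: lop_bound => p pa; apply: H.
exact: (map_f (fun p => (c * p.2)%g)).
Qed.

(** Tychonoff's theorem in the form needed for arguments by contradiction: counterexamples [P T h]
    at ever finer precision accumulate at one bounded function. *)
Lemma cube_cluster (B : R) (P : seq G -> R -> set cfg) :
  (forall T h, 0 < h -> P T h !=set0) ->
  (forall T T' h h', {subset T <= T'} -> h' <= h -> P T' h' `<=` P T h) ->
  (forall T h x, P T h x -> forall c, `|x c| <= B) ->
  exists x : cfg, (forall c, `|x c| <= B) /\
    forall T h S e, 0 < h -> 0 < e -> exists2 y, P T h y & forall c, c \in S -> `|x c - y c| < e.
Proof.
move=> Pne Pmono PB.
pose F : set_system cfg := [set A | exists T h, 0 < h /\ P T h `<=` A].
have FF : ProperFilter F.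
  split.
    by move=> [T [h [h0 H]]]; have [x /H] := Pne T h h0.
  split.
  - by exists [::], 1; split.
  - move=> A A' [T [h [h0 H]]] [T' [h' [h'0 H']]].
    exists (T ++ T'), (Num.min h h'); split; first by rewrite lt_min h0.
    move=> x Px; split.
      apply: H; apply: Pmono Px; rewrite ?ge_min ?lexx// => t.
      by rewrite mem_cat => ->.
    apply: H'; apply: Pmono Px; rewrite ?ge_min ?lexx ?orbT// => t.
    by rewrite mem_cat => ->; rewrite orbT.
  - by move=> A A' AA [T [h [h0 H]]]; exists T, h; split=> // x /H /AA.
have FB : F [set x : cfg | forall c, `|x c| <= B].
  by exists [::], 1; split=> // x /PB.
have [x [xB cx]] := compact_cube FF FB.
exists x; split=> // T h S e h0 e0.
have FP : F (P T h) by exists T, h; split.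
have [y [Py yS]] := cx _ _ FP (nbhs_ptws_box x S e0).
by exists y.
Qed.

Definition bounded_injective a := forall x (K : R), (forall c, `|x c| <= K) ->
  (forall c, lop a x c = 0) -> forall c, x c = 0.

(** If every finite test failed, the counterexamples would accumulate at a bounded [x] with
    [lop a x = 0]. Then [x = 0], whereas the approximants stay at least 1/2 at the identity. *)
Lemma injective_local a : bounded_injective a ->
  exists T h, 0 < h /\ forall x, (forall c, `|x c| <= 1) ->
    (forall t, t \in T -> `|lop a x t| <= h) -> `|x 1%g| <= 2^-1.
Proof.
move=> ai; apply: contrapT => H.
pose P T h := [set x : cfg | [/\ forall c, `|x c| <= 1,
   forall t, t \in T -> `|lop a x t| <= h & 2^-1 <= `|x 1%g|]].
have [|||x [x1 Hx]] := @cube_cluster 1 P.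
- move=> T h h0; apply: contrapT => H'; apply: H; exists T, h; split=> // x x1 xT.
  rewrite leNgt; apply/negP => x2; apply: H'; exists x; split=> //; exact: ltW.
- by move=> T T' h h' TT hh x [x1 xT x2]; split=> // t /TT /xT /le_trans; exact.
- by move=> T h x [].
have x0 c : x c = 0.
  apply: ai x1 _ c => c; apply/eqP; rewrite -normr_le0; apply/ler_addgt0Pl => e e0.
  rewrite addr0.
  have n0 : 0 < l1norm a + 1 by rewrite ltr_wpDl.
  have e2 : 0 < e / 2 by rewrite divr_gt0.
  have e3 : 0 < e / 2 / (l1norm a + 1) by rewrite divr_gt0.
  have [y [_ /(_ c (mem_head _ _)) yc _] xy] := Hx [:: c] _ [seq (c * p.2)%g | p <- a] _ e2 e3.
  have := @lop_close a x y c _ (fun d Hd => ltW (xy d Hd)).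
  have : l1norm a * (e / 2 / (l1norm a + 1)) <= e / 2.
    rewrite mulrA ler_pdivrMr// mulrC ler_wpM2l ?(ltW e2)// lerDl//.
  have := ler_normD (lop a x c - lop a y c) (lop a y c); rewrite subrK.
  rewrite (splitr e); lra.
have e4 : (0 : R) < 4^-1 by rewrite invr_gt0.
have [y [_ _ y2] xy] := Hx [::] 1 [:: 1%g] _ ltr01 e4.
have := xy 1%g (mem_head _ _); rewrite x0 sub0r normrN.
move=> y4; have : (2^-1 : R) < 4^-1 := le_lt_trans y2 y4.
by rewrite ltf_pV2 ?posrE// ltr_nat.
Qed.

(** By homogeneity [injective_local] says [|x 1| <= (|x| + |a x| / h) / 2] for [x] supported in [S],
    with sup norms over [S] and [T]. Duality writes evaluation at 1 as [v + L u] with l^1 norm of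
    [v] at most 1/2: then [u] is the inverse and [- v] its defect, and translation carries the
    identity from 1 to all points. *)
Lemma left_inv_of_injective a : bounded_injective a -> left_inv a.
Proof.
move=> /injective_local[T [h [h0 H]]].
pose S := undup (1%g :: [seq (t * p.2)%g | t <- T, p <- a]).
have uS : uniq S := undup_uniq _.
have S1 : 1%g \in S by rewrite mem_undup mem_head.
have ST t p : t \in T -> p \in a -> (t * p.2)%g \in S.
  by move=> tT pa; rewrite mem_undup inE; apply/orP; right; apply/allpairsP; exists (t, p).
pose L := (mxop a T S)^T.
pose phi : 'cV[R]_(size S) := \col_i dlt R (nth 1%g S i) 1%g.
have xphi (x : 'rV[R]_(size S)) : (x *m phi) 0 0 = vecf x^T 1%g.
  by rewrite mxE; apply: eq_bigr => i _; rewrite !mxE.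
have xL (x : 'rV[R]_(size S)) j : (x *m L) 0 j = lop a (vecf x^T) (nth 1%g T j).
  by rewrite mxop_vec -[x *m L]trmxK trmx_mul trmxK mxE.
have xb (x : 'rV[R]_(size S)) c K : 0 <= K -> supn x <= K -> `|vecf x^T c| <= K.
  move=> K0 xK; have [cS|cS] := boolP (c \in S); last by rewrite vecf_out// normr0.
  have iS : (index c S < size S)%N by rewrite index_mem.
  rewrite -(nth_index 1%g cS) (@vecf_nth _ _ S x^T (Ordinal iS))// mxE.
  exact: le_trans (supn_ge _ _) xK.
have scaled (x : 'rV[R]_(size S)) l : 0 < l -> supn x <= l -> supn (x *m L) <= h * l ->
    `|(x *m phi) 0 0| <= 2^-1 * l.
  move=> l0 x1 x2; rewrite xphi -ler_pdivrMr//.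
  have := H (fun c => l^-1 * vecf x^T c).
  rewrite normrM gtr0_norm ?invr_gt0// mulrC; apply.
    move=> c; rewrite normrM gtr0_norm ?invr_gt0// mulrC ler_pdivrMr// mul1r.
    by apply: xb => //; exact: ltW.
  move=> t tT; rewrite lopZ normrM gtr0_norm ?invr_gt0// mulrC ler_pdivrMr//.
  have iT : (index t T < size T)%N by rewrite index_mem.
  rewrite -(nth_index 1%g tT) -(xL x (Ordinal iT)).
  exact: le_trans (supn_ge _ _) x2.
have e2 : (0 : R) <= 2^-1 by rewrite invr_ge0.
have C0 : 0 <= (2 * h)^-1 by rewrite invr_ge0 mulr_ge0 ?ltW.
have [|v [u [phiE v2]]] := @dual_decomposition R _ _ L phi 2^-1 (2 * h)^-1 e2 C0.
  move=> x; set l := supn x + supn (x *m L) / h.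
  have -> : 2^-1 * supn x + (2 * h)^-1 * supn (x *m L) = 2^-1 * l.
    by rewrite /l; field; rewrite gt_eqF.
  have s0 := supn_ge0 x; have s1 : 0 <= supn (x *m L) / h by rewrite divr_ge0 ?supn_ge0// ltW.
  (* The scaling argument divides by a positive factor, but [l] vanishes at [x = 0]; hence the slack
     [e]. *)
  apply/ler_addgt0Pr => e e0.
  have le0 : 0 < l + 2 * e by rewrite ltr_wpDl ?mulr_gt0// addr_ge0.
  have -> : 2^-1 * l + e = 2^-1 * (l + 2 * e) by field.
  apply: scaled => //; first by rewrite /l -addrA lerDl addr_ge0// mulr_ge0// ltW.
  rewrite mulrC -ler_pdivrMr// /l -addrA addrCA lerDl addr_ge0// mulr_ge0// ltW//.
exists [seq (u j 0, nth 1%g T j) | j <- enum 'I_(size T)].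
exists [seq (- v i 0, nth 1%g S i) | i <- enum 'I_(size S)].
split.
  rewrite /l1norm big_map big_enum /=; under eq_bigr do rewrite normrN.
  exact: v2.
have key x : lop [seq (u j 0, nth 1%g T j) | j <- enum 'I_(size T)] (lop a x) 1%g =
    x 1%g + lop [seq (- v i 0, nth 1%g S i) | i <- enum 'I_(size S)] x 1%g.
  have lE n (F : 'I_n -> R) (e : 'I_n -> G) y :
      lop [seq (F i, e i) | i <- enum 'I_n] y 1%g = \sum_i F i * y (e i).
    by rewrite /lop big_map big_enum; apply: eq_bigr => i _; rewrite mul1g.
  rewrite !lE.
  have -> : x 1%g = \sum_(i < size S) x (nth 1%g S i) * phi i 0.
    rewrite -(@finsum_onE _ _ S x 1%g uS S1) /finsum_on sum_seq_ord.
    by apply: eq_bigr => i _; rewrite mxE.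
  have phii i : phi i 0 = v i 0 + \sum_j L i j * u j 0.
    by rewrite phiE mxE [X in _ + X]mxE.
  transitivity (\sum_(i < size S) \sum_(j < size T) x (nth 1%g S i) * (L i j * u j 0)); last first.
    rewrite -big_split; apply: eq_bigr => i _ /=.
    by rewrite phii mulNr mulrDr [v i 0 * _]mulrC addrAC subrr add0r mulr_sumr.
  rewrite exchange_big /=; apply: eq_bigr => j _.
  rewrite (@lop_delta _ _ a x (nth 1%g T j) S uS); last first.
    by move=> p pa; rewrite ST// mem_nth.
  rewrite sum_seq_ord mulr_sumr; apply: eq_bigr => i _.
  by rewrite !mxE; ring.
move=> x c; have := key (fun d => x (c * d)%g).
rewrite lop_translate mulg1 => <-.
rewrite (eq_lop _ (fun d => lop_translate a x c d)).
by rewrite lop_translate mulg1.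
Qed.

End CompactnessArgument.

(** * Lifting solutions from the circle to the reals *)

Section Circle.
Variable R : realType.
Local Open Scope quotient_scope.

Definition cpi (t : R) : circle R := \pi_(circle R) t.

Lemma cpiD s t : cpi (s + t) = cpi s + cpi t.
Proof. exact: (@Quotient.pi_add R (integers R)). Qed.

Lemma cpi0 : cpi 0 = 0.
Proof. by apply: (addIr (cpi 0)); rewrite -cpiD !add0r. Qed.

Lemma cpiN t : cpi (- t) = - cpi t.
Proof. by apply: (addIr (cpi t)); rewrite -cpiD !addNr cpi0. Qed.

Lemma cpi_sum (I : Type) (r : seq I) (F : I -> R) :
  cpi (\sum_(i <- r) F i) = \sum_(i <- r) cpi (F i).
Proof. by elim: r => [|i r IHr]; rewrite ?big_nil ?cpi0// !big_cons cpiD IHr. Qed.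

Lemma cpi_mulrz t (n : int) : cpi (n%:~R * t) = cpi t *~ n.
Proof.
have H k : cpi (k%:R * t) = cpi t *+ k.
  elim: k => [|k IHk]; first by rewrite mul0r cpi0.
  by rewrite -natr1 mulrDl mul1r cpiD IHk mulrSr.
case: n => n; first exact: H.
by rewrite NegzE mulrNz mulNr cpiN H.
Qed.

Lemma cpi_eq s t : cpi s = cpi t <-> s - t \is a Num.int.
Proof.
have E := @Quotient.idealrBE R (integers R) s t.
split=> [st|st].
  by apply: (etrans E); apply/eqP; exact: st.
exact: (eqP (etrans (esym E) st)).
Qed.

Lemma cpi_continuous : continuous (cpi : R -> circle R).
Proof. exact: (@pi_continuous R (Quotient.quot (integers R))). Qed.

Lemma open_arc (s e : R) : open [set z : circle R | exists2 t, cpi t = z & `|t - s| < e].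
Proof.
rewrite /open /= /quotient_open.
rewrite openE => t0 [t tt0 ts]; rewrite /interior.
have d0 : 0 < e - `|t - s| by rewrite subr_gt0.
have : nbhs t0 [set u : R | `|t0 - u| < e - `|t - s|] by exact: nbhsx_ballx.
apply: filterS => u /= Hu; exists (u + (t - t0)).
  rewrite -[RHS]/(cpi u); apply/cpi_eq; rewrite addrAC subrr add0r.
  exact/cpi_eq.
have -> : u + (t - t0) - s = (u - t0) + (t - s) by ring.
apply: le_lt_trans (ler_normD _ _) _.
by rewrite distrC -ltrBrDr.
Qed.

End Circle.

Section ProductBasis.

(** The sets that contain a cylinder around [x] form a filter converging to [x] in each coordinate,
    hence in the product topology; so it contains all neighbourhoods. *)
Lemma nbhs_ptws_basis (I : eqType) (T : topologicalType) (x : {ptws I -> T}) (A : set {ptws I -> T}) :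
  nbhs x A -> exists (S : seq I) (B : I -> set T),
    (forall c, nbhs (x c) (B c)) /\ forall y, (forall c, c \in S -> B c (y c)) -> A y.
Proof.
pose F : set_system {ptws I -> T} := [set A | exists (S : seq I) (B : I -> set T),
    (forall c, nbhs (x c) (B c)) /\ forall y, (forall c, c \in S -> B c (y c)) -> A y].
have FF : Filter F.
  split.
  - by exists [::], (fun=> setT); split=> // c; exact: filterT.
  - move=> A1 A2 [S1 [B1 [n1 H1]]] [S2 [B2 [n2 H2]]].
    exists (S1 ++ S2), (fun c => B1 c `&` B2 c); split=> [c|y Hy]; first exact: filterI.
    split; [apply: H1|apply: H2] => c cS.
      by have [|//] := Hy c; rewrite mem_cat cS.
    by have [|//] := Hy c; rewrite mem_cat cS orbT.
  - by move=> A1 A2 AA [S1 [B1 [n1 H1]]]; exists S1, B1; split=> // y /H1 /AA.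
have : F --> (x : {ptws I -> T}).
  apply/cvg_sup => i A1 /= [U [[V oV VU] Ux] UA].
  exists [:: i], (fun j => if j == i then V else setT); split=> [c|y /(_ i)].
    case: eqP => [->|_]; last exact: filterT.
    by apply: open_nbhs_nbhs; split=> //; move: Ux; rewrite -VU.
  by rewrite mem_head eqxx => /(_ isT) Vy; apply: UA; rewrite -VU.
by move=> H /H.
Qed.

End ProductBasis.

(** * Expansiveness in terms of real lifts *)

Section Expansiveness.
Variables (R : realType) (G : groupType).
Implicit Types (f g : group_ring G) (x y : G -> R) (c d : G) (S : seq G).

Definition solution (a : seq (R * G)) x := forall c, lop a x c \is a Num.int.

Lemma solution_Xspace f x : solution (grlist R f) x <-> Xspace R f (fun c => cpi (x c)).
Proof.
have E c : \sum_(d <- finsupp f) cpi (x (c * d)%g) *~ f d = cpi (lop (grlist R f) x c).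
  by rewrite lop_grlist cpi_sum; apply: eq_bigr => d _; rewrite cpi_mulrz.
split=> H c.
  by rewrite E -(cpi0 R); apply/cpi_eq; rewrite subr0.
by have := H c; rewrite E -(cpi0 R) => /cpi_eq; rewrite subr0.
Qed.

Definition of_solution f x (H : solution (grlist R f) x) : Xspace R f :=
  exist (fun y : {ptws G -> circle R} => y \in Xspace R f) _ (mem_set ((solution_Xspace f x).1 H)).

Definition lifts f x (q : Xspace R f) := forall c, cpi (x c) = \val q c.

Lemma lifts_of_solution f x (H : solution (grlist R f) x) : lifts x (of_solution H).
Proof. by []. Qed.

Lemma lifts_solution f x (q : Xspace R f) : lifts x q -> solution (grlist R f) x.
Proof.
move=> xq; apply/solution_Xspace.
by rewrite (funext xq); exact: set_mem (valP q).
Qed.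

Lemma exists_lift f (q : Xspace R f) : exists2 x, lifts x q & forall c, 0 <= x c < 1.
Proof.
exists (fun c => generic_quotient.repr (\val q c) - (Num.floor (generic_quotient.repr (\val q c)))%:~R) => c.
  have H : cpi (generic_quotient.repr (\val q c)) = \val q c by exact: reprK.
  by rewrite -[RHS]H; apply/cpi_eq; rewrite addrAC subrr add0r rpredN intr_int.
by apply/andP; split; rewrite ?subr_ge0 ?floor_le// ltrBlDl; have := floorD1_gt (generic_quotient.repr (\val q c)); rewrite intrD.
Qed.

Lemma lifts_alpha f x (q : Xspace R f) c :
  lifts x q -> lifts (fun d => x (c^-1 * d)%g) (alpha R f c q).
Proof. by move=> xq d; rewrite xq. Qed.

Lemma lifts_inj f x (q q' : Xspace R f) : lifts x q -> lifts x q' -> q = q'.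
Proof. by move=> xq xq'; apply: val_inj; apply: funext => c; rewrite -xq -xq'. Qed.

Lemma lifts_zero f : lifts (fun=> 0) (Xspace_zero R f).
Proof. by move=> c; rewrite cpi0. Qed.

Lemma open_Xspace_box f (U : set (Xspace R f)) (q : Xspace R f) x : open U -> U q -> lifts x q ->
  exists S (e : R), 0 < e /\ forall (q' : Xspace R f) y, lifts y q' ->
    (forall c, c \in S -> `|x c - y c| < e) -> U q'.
Proof.
move=> [V oV VU] Uq xq.
have nV : nbhs (\val q : {ptws G -> circle R}) V.
  by apply: open_nbhs_nbhs; split=> //; move: Uq; rewrite -VU.
have [S [B [nB HB]]] := nbhs_ptws_basis nV.
have [e [e0 He]] : exists e : R, 0 < e /\ forall c t, c \in S -> `|x c - t| < e -> B c (cpi t).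
  elim: S {HB} => [|c S [e [e0 He]]]; first by exists 1.
  have : nbhs (x c) (@cpi R @^-1` B c) by apply: cpi_continuous; rewrite xq.
  move=> /nbhs_ballP[e' /= e'0 He'].
  exists (Num.min e e'); split=> [|d t]; first by rewrite lt_min e0.
  rewrite inE lt_min => /predU1P[->|dS] /andP[te te']; last exact: He.
  exact: He'.
exists S, e; split=> // q' y yq' Hy; rewrite -VU; apply: HB => c cS.
by have := He c (y c) cS (Hy c cS); rewrite yq'.
Qed.

Lemma open_Xspace_arc f c (s e : R) :
  open [set q : Xspace R f | exists2 t, cpi t = \val q c & `|t - s| < e].
Proof.
exists [set z : {ptws G -> circle R} | exists2 t, cpi t = z c & `|t - s| < e]; last by [].
rewrite openE => z Hz.
have Hn : nbhs (z c) [set z : circle R | exists2 t, cpi t = z & `|t - s| < e].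
  by apply: open_nbhs_nbhs; split=> //; exact: open_arc.
exact: (@proj_continuous G (fun=> circle R) c z _ Hn).
Qed.

(** A bounded kernel element, scaled down, becomes a point of X_f whose whole orbit stays in [U],
    hence the zero point; its values are then integers of absolute value below 1. *)
Lemma expansive_injective f : expansive (Xspace_zero R f) (alpha R f) ->
  bounded_injective (grlist R f).
Proof.
move=> [U [oU U0 Ucap]] x K xK fx.
have [S [e [e0 He]]] := open_Xspace_box oU U0 (lifts_zero f).
pose k := `|K| + 1; have k0 : 0 < k by rewrite ltr_wpDl.
pose t := Num.min e 1 / 2 / k.
have m0 : 0 < Num.min e 1 by rewrite lt_min e0 ltr01.
have t0 : 0 < t by rewrite !divr_gt0.
have tx c : `|t * x c| < Num.min e 1.
  rewrite normrM gtr0_norm//; apply: (@le_lt_trans _ _ (t * k)).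
    apply: (ler_wpM2l (ltW t0)); apply: le_trans (xK c) _; apply: le_trans (ler_norm _) _.
    by rewrite lerDl.
  by rewrite /t divfK ?gt_eqF// ltr_pdivrMr// mulr_natr mulr2n ltrDl.
have sx : solution (grlist R f) (fun c => t * x c).
  by move=> c; rewrite lopZ fx mulr0 rpred0.
pose q := of_solution sx.
have : (\bigcap_(c in [set: G]) (alpha R f c @` U)) q.
  move=> c _; have l1 := lifts_alpha (c^-1)%g (lifts_of_solution sx).
  exists (alpha R f (c^-1)%g q).
    apply: (He _ _ l1) => d _.
    by rewrite sub0r normrN (lt_le_trans (tx _))// ge_min lexx.
  apply: (@lifts_inj _ (fun d => t * x d)); last by [].
  by move=> d; rewrite -(lifts_alpha c l1 d) /= invgK mulgA mulgV mul1g.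
rewrite Ucap => q0 c.
have : t * x c \is a Num.int.
  have := lifts_of_solution sx c; rewrite -/q q0 -(lifts_zero f c) => /cpi_eq.
  by rewrite subr0.
move=> /intrP[n tn]; have := tx c; rewrite tn lt_min => /andP[_].
rewrite -intr_norm -[1]/(1%:~R) ltr_int => n1.
have n0 : n = 0 by lia.
move: tn; rewrite n0 => /eqP; rewrite mulf_eq0 gt_eqF//= => /eqP; exact.
Qed.

(** The radius [n^-1] is such that a lift with all values below it satisfies [|f x| < 1]. Being
    integral, [f x] vanishes, and injectivity on bounded functions gives [x = 0]. *)
Lemma left_inv_expansive f : left_inv (grlist R f) ->
  expansive (Xspace_zero R f) (alpha R f).
Proof.
move=> fi; pose n := l1norm (grlist R f) + 1.
have n0 : 0 < n by rewrite ltr_wpDl.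
exists [set q : Xspace R f | exists2 t, cpi t = \val q 1%g & `|t - 0| < n^-1]; split.
- exact: open_Xspace_arc.
- by exists 0; rewrite ?cpi0 ?subr0 ?normr0 ?invr_gt0.
apply/seteqP; split=> q /=; last first.
  move=> -> c _; exists (Xspace_zero R f).
    by exists 0; rewrite ?cpi0 ?subr0 ?normr0 ?invr_gt0.
  by apply: (@lifts_inj _ (fun=> 0)); [exact: (lifts_alpha c (lifts_zero f))|exact: lifts_zero].
move=> Hq.
have {}Hq c : exists t, cpi t = \val q c /\ `|t| < n^-1.
  have [u [t tu t1] <-] := Hq c I; exists t; rewrite subr0 in t1; split=> //.
  by rewrite tu /= mulVg.
have [x Hx] := choice Hq.
have xq : lifts x q by move=> c; exact: (Hx c).1.
have x0 : forall c, x c = 0.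
  apply: (left_inv_inj (K := n^-1) fi) => [c|c]; first exact/ltW/(Hx c).2.
  have := lifts_solution xq c => /intrP[k Ek].
  have : `|lop (grlist R f) x c| < 1.
    apply: (@le_lt_trans _ _ (l1norm (grlist R f) * n^-1)).
      by apply: lop_bound => p _; exact/ltW/(Hx _).2.
    by rewrite ltr_pdivrMr// mul1r ltrDl.
  rewrite Ek -intr_norm -[1]/(1%:~R) ltr_int => k1.
  by have -> : k = 0 by lia.
apply: (@lifts_inj _ x) => //; move=> c; rewrite x0; exact: lifts_zero.
Qed.

End Expansiveness.

(** * Separated sets of solutions *)

Section SparseCodes.
Variable R : realType.

Definition weight N B (c : {ffun 'I_N -> option 'I_B}) : nat := #|[set i | c i != None]%SET|.

Lemma sum_weight N B (t : R) :
  \sum_(c : {ffun 'I_N -> option 'I_B}) t ^+ weight c = (1 + B%:R * t) ^+ N.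
Proof.
have -> : 1 + B%:R * t = \sum_(o : option 'I_B) (if o is None then 1 else t).
  rewrite (bigD1 None)//=; congr (_ + _).
  rewrite (reindex_omap Some id) => [|[i|]//]; rewrite /=.
  rewrite (eq_bigl xpredT) => [|i]; last by rewrite eqxx.
  by rewrite sumr_const card_ord mulr_natl.
rewrite -[X in _ = _ ^+ X](card_ord N) -prodr_const bigA_distr_bigA /=.
apply: eq_bigr => c _; rewrite /weight -prodr_const big_mkcond /=.
rewrite [RHS](eq_bigr (fun i => if i \in [set i | c i != None]%SET then t else 1))//.
by move=> i _; rewrite inE; case: (c i).
Qed.

(** A Chernoff bound: weighting codes by [t ^+ weight] with [t <= 1] gives
    [#|A| * t^(k N) <= (1 + B t)^N]. Here [None] is the default symbol, so low weight means few
    exceptional positions. *)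
Lemma sparse_codes B (e : R) : 0 < e -> exists2 k : R, 0 < k &
  forall (I : finType) (A : {set I}) N (code : I -> {ffun 'I_N -> option 'I_B}),
    {in A &, injective code} -> (forall i, i \in A -> (weight (code i))%:R <= k * N%:R) ->
    #|A|%:R <= expR (e * N%:R).
Proof.
move=> e0; pose t := Num.min 1 (e / (2 * B.+1%:R)).
have t0 : 0 < t by rewrite lt_min ltr01 divr_gt0// mulr_gt0.
have t1 : t <= 1 by rewrite ge_min lexx.
have lt0 : ln t <= 0 by rewrite ln_le0.
(* [t] makes [1 + B t] at most [expR (e / 2)], and [k] makes [t^(- k)] at most the same; dividing by
   [1 - ln t] instead of [- ln t] covers [t = 1]. *)
pose k := e / 2 / (1 - ln t).
have d0 : 0 < 1 - ln t by lra.
have k0 : 0 < k by rewrite !divr_gt0.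
exists k => // I A N code cI cw.
have h1 : 1 + B%:R * t <= expR (e / 2).
  apply: le_trans (expR_ge1Dx _); rewrite lerD2l.
  apply: (@le_trans _ _ (B.+1%:R * t)); first by rewrite ler_wpM2r ?ler_nat// ltW.
  rewrite mulrC -ler_pdivlMr// /t ge_min; apply/orP; right.
  by rewrite -mulrA -invfM.
have h2 : #|A|%:R * expR (k * N%:R * ln t) <= (1 + B%:R * t) ^+ N.
  rewrite -(card_in_imset cI) -sum_weight.
  rewrite mulr_natl -sumr_const big_mkcond; apply: ler_sum => c _ /=.
  case: ifPn => [/imsetP[i iA ->]|_]; last by rewrite exprn_ge0// ltW.
  rewrite -[X in X ^+ _](lnK t0) -expRM_natr ler_expR [leRHS]mulrC.
  by apply: (ler_wnM2r lt0); exact: cw.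
have h3 : (1 + B%:R * t) ^+ N <= expR (e / 2 * N%:R).
  rewrite expRM_natr; apply: lerXn2r => //; rewrite nnegrE ?expR_ge0//.
  by rewrite addr_ge0// mulr_ge0// ltW.
have h4 : expR (- (k * N%:R * ln t)) <= expR (e / 2 * N%:R).
  have kE : k * (1 - ln t) = e / 2 by rewrite /k divfK// gt_eqF.
  have -> : - (k * N%:R * ln t) = k * (- ln t) * N%:R by ring.
  by rewrite ler_expR -kE; apply: ler_wpM2r => //; apply: (ler_wpM2l (ltW k0)); lra.
have h5 : 0 <= #|A|%:R * expR (k * N%:R * ln t) by rewrite mulr_ge0// expR_ge0.
have := ler_pM h5 (expR_ge0 _) (le_trans h2 h3) h4.
rewrite -(mulrA #|A|%:R) -expRD subrr expR0 mulr1 -expRD => /le_trans; apply.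
by rewrite ler_expR; lra.
Qed.

End SparseCodes.

(** * Separated families modulo Z *)

Section Separation.
Variables (R : realType) (G : groupType).
Implicit Types (x y z : G -> R) (Q : seq G) (e k : R) (P : set (G -> R)).

Definition nearZ e (t : R) := exists n : int, `|t - n%:~R| <= e.

Lemma nearZ_le e e' t : e <= e' -> nearZ e t -> nearZ e' t.
Proof. by move=> ee [n tn]; exists n; exact: le_trans ee. Qed.

Lemma nearZD e e' t u : nearZ e t -> nearZ e' u -> nearZ (e + e') (t + u).
Proof.
move=> [n tn] [m um]; exists (n + m).
rewrite intrD opprD addrACA; apply: le_trans (ler_normD _ _) _; exact: lerD.
Qed.

Lemma nearZN e t : nearZ e (- t) <-> nearZ e t.
Proof.
have H u : nearZ e u -> nearZ e (- u).
  by move=> [n un]; exists (- n); rewrite mulrNz -opprD normrN.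
by split=> [/H|/H//]; rewrite opprK.
Qed.

Lemma nearZ_int e t : 0 <= e -> t \is a Num.int -> nearZ e t.
Proof. by move=> e0 /intrP[n ->]; exists n; rewrite subrr normr0. Qed.

Lemma nearZ_add_int e t u : u \is a Num.int -> nearZ e (t + u) <-> nearZ e t.
Proof.
move=> uZ; split=> [H|H].
  have := nearZD H (nearZ_int (lexx 0) (rpredNr uZ)); by rewrite addr0 addrK.
by have := nearZD H (nearZ_int (lexx 0) uZ); rewrite addr0.
Qed.

Lemma nearZ_triangle e e' t u v : nearZ e (t - u) -> nearZ e' (u - v) -> nearZ (e + e') (t - v).
Proof. by move=> tu uv; have := nearZD tu uv; rewrite addrA subrK. Qed.

Lemma nearZ_sym e t u : nearZ e (t - u) -> nearZ e (u - t).
Proof. by move=> H; rewrite -opprB; apply/nearZN. Qed.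

Definition round (t : R) : int := Num.floor (t + 2^-1).

Lemma round_le t : `|t - (round t)%:~R| <= 2^-1.
Proof.
rewrite /round ler_norml; have := floor_le (t + 2^-1); have := floorD1_gt (t + 2^-1).
by rewrite intrD; lra.
Qed.

Lemma round_near e t : e < 2^-1 -> nearZ e t -> `|t - (round t)%:~R| <= e.
Proof.
move=> e2 [n tn]; suff -> : round t = n by [].
have h1 := round_le t.
have : `|(round t)%:~R - n%:~R : R| < 1.
  have -> : (round t)%:~R - n%:~R = (t - n%:~R) - (t - (round t)%:~R) by ring.
  by apply: le_lt_trans (ler_normB _ _) _; lra.
by rewrite -intrB -intr_norm -[1]/(1%:~R) ltr_int => h; lia.
Qed.

Definition frac (t : R) : R := t - (Num.floor t)%:~R.

Lemma frac_itv t : 0 <= frac t < 1.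
Proof.
rewrite /frac; have := floor_le t; have := floorD1_gt t; rewrite intrD => h1 h2.
by apply/andP; split; lra.
Qed.

Lemma frac_int t : frac t - t \is a Num.int.
Proof. by rewrite /frac addrAC subrr add0r rpredN intr_int. Qed.

Definition far Q e x y : nat := count (fun q => ~~ `[< nearZ e (x q - y q) >]) Q.

Definition separated Q e x y := exists2 q, q \in Q & ~ nearZ e (x q - y q).

Lemma notin_separated Q e x y : ~ separated Q e x y -> forall q, q \in Q -> nearZ e (x q - y q).
Proof. by move=> H q qQ; apply: contrapT => nq; apply: H; exists q. Qed.

Lemma far_triangle Q e e' x y z : (far Q (e + e') x z <= far Q e x y + far Q e' y z)%N.
Proof.
rewrite /far -count_predUI; apply: leq_trans (leq_addr _ _).
apply: sub_count => q /=; rewrite -negb_and; apply: contra => /andP[/asboolP h1 /asboolP h2].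
by apply/asboolP; exact: nearZ_triangle h1 h2.
Qed.

Lemma far_sym Q e x y : far Q e x y = far Q e y x.
Proof.
by apply: eq_count => q /=; congr (~~ _); apply/asboolP/asboolP; exact: nearZ_sym.
Qed.

Lemma far0 Q e x y : (forall q, q \in Q -> nearZ e (x q - y q)) -> far Q e x y = 0%N.
Proof.
move=> H; apply/eqP; rewrite -leqn0 leqNgt -has_count; apply/hasPn => q qQ /=.
by rewrite negbK; apply/asboolP; exact: H.
Qed.

Lemma far_le Q e e' x y : e <= e' -> (far Q e' x y <= far Q e x y)%N.
Proof.
move=> ee; apply: sub_count => q /=; apply: contra => /asboolP H.
by apply/asboolP; exact: nearZ_le H.
Qed.

Definition bins e : nat := (Num.truncn (e^-1)).+1.

Definition bin e (t : R) : 'I_(bins e) := inord (Num.truncn ((bins e)%:R * frac t)).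

Lemma bins_ge e : 0 < e -> e^-1 <= (bins e)%:R.
Proof. by move=> e0; rewrite /bins ltW// truncnS_gt. Qed.

Lemma bin_near e t u : 0 < e -> bin e t = bin e u -> nearZ e (t - u).
Proof.
move=> e0 E; have b0 : 0 < (bins e)%:R :> R by rewrite ltr0n.
have be := bins_ge e0.
have f1 v : (Num.truncn ((bins e)%:R * frac v) < bins e)%N.
  have /andP[v0 v1] := frac_itv v.
  by rewrite truncn_lt_nat ?(mulr_ge0 (ltW b0) v0)// -[ltRHS]mulr1 (ltr_pM2l b0).
have f0 v : 0 <= (bins e)%:R * frac v by have /andP[v0 _] := frac_itv v; exact: mulr_ge0 (ltW b0) v0.
move/(congr1 val): E; rewrite /bin /= !inordK//.
set m := Num.truncn _; set m' := Num.truncn _ => E.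
have := truncn_itv (f0 t); have := truncn_itv (f0 u); rewrite -/m -/m' E -(natr1 m').
move=> /andP[h1 h2] /andP[h3 h4].
suff H : `|frac t - frac u| <= e.
  exists (Num.floor t - Num.floor u); rewrite intrB.
  by have -> : t - u - ((Num.floor t)%:~R - (Num.floor u)%:~R) = frac t - frac u by rewrite /frac; ring.
rewrite -(ler_pM2l b0) -[X in X * `|_|](gtr0_norm b0) -normrM mulrBr.
apply: (@le_trans _ _ 1).
  by rewrite ler_norml; apply/andP; split; lra.
by rewrite -ler_pdivrMr// div1r.
Qed.

Lemma count_ord Q (p : pred G) : count p Q = #|[set i : 'I_(size Q) | p (nth 1%g Q i)]%SET|.
Proof.
rewrite -sum1_count (big_nth 1%g) big_mkord -sum1_card.
by apply: eq_bigl => i; rewrite inE.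
Qed.

(** Record the bin of [s i] only where it is not [e / 2]-near [y]. Two members with equal codes are
    [e]-near everywhere, through [y] or through the common bin, so the codes are distinct, and they
    are sparse. *)
Lemma packing e (d : R) : 0 < e -> 0 < d -> exists2 k : R, 0 < k &
  forall (I : finType) (A : {set I}) Q (s : I -> G -> R) y,
    {in A &, forall i j, i != j -> separated Q e (s i) (s j)} ->
    (forall i, i \in A -> (far Q (e / 2) (s i) y)%:R <= k * (size Q)%:R) ->
    #|A|%:R <= expR (d * (size Q)%:R).
Proof.
move=> e0 d0; have [k k0 H] := sparse_codes (bins e) d0; exists k => // I A Q s y ssep sfar.
pose code i := [ffun j : 'I_(size Q) => let q := nth 1%g Q j in
  if `[< nearZ (e / 2) (s i q - y q) >] then None else Some (bin e (s i q))].
apply: (H I A (size Q) code).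
  move=> i j iA jA E; apply/eqP; apply: contrapT => /negP ij.
  have [q qQ] := ssep i j iA jA ij; apply.
  have qs : (index q Q < size Q)%N by rewrite index_mem.
  have := congr1 (fun c : {ffun 'I_(size Q) -> option 'I_(bins e)} => c (Ordinal qs)) E.
  rewrite !ffunE /= nth_index//; case: asboolP => h1; case: asboolP => h2 //.
    by move=> _; rewrite [e]splitr; apply: nearZ_triangle h1 _; exact: nearZ_sym.
  by move=> [] /bin_near; exact.
move=> i iA; apply: le_trans (sfar i iA); rewrite ler_nat /far count_ord /weight.
apply: subset_leq_card; apply/fintype.subsetP => j; rewrite !inE ffunE /=.
by case: asboolP.
Qed.

Definition has_separated P Q e n := exists s : 'I_n -> G -> R,
  (forall i, P (s i)) /\ forall i j, i != j -> separated Q e (s i) (s j).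

Lemma has_separated_bound P Q e n : 0 < e -> has_separated P Q e n -> (n <= bins e ^ size Q)%N.
Proof.
move=> e0 [s [_ ssep]].
pose code i := [ffun j : 'I_(size Q) => bin e (s i (nth 1%g Q j))].
have : injective code.
  move=> i j E; apply/eqP; apply: contrapT => /negP ij.
  have [q qQ] := ssep i j ij; apply.
  have qs : (index q Q < size Q)%N by rewrite index_mem.
  have := congr1 (fun c : {ffun 'I_(size Q) -> 'I_(bins e)} => c (Ordinal qs)) E.
  by rewrite !ffunE /= nth_index// => /bin_near; exact.
by move=> /leq_card; rewrite card_ffun !card_ord.
Qed.

(** The cutoff is the pigeonhole bound of [has_separated_bound], so for [e > 0] this is the true
    maximal size of a separated family. *)
Definition Nsep P Q e : nat :=
  \max_(n < (bins e ^ size Q).+1 | `[< has_separated P Q e n >]) n.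

Lemma has_separated0 P Q e : has_separated P Q e 0.
Proof. by exists (fun=> fun=> 0); split=> -[]. Qed.

Lemma Nsep_has P Q e : has_separated P Q e (Nsep P Q e).
Proof.
have [//|i Pi E] := @eq_bigmax_cond _ (fun n : 'I_(bins e ^ size Q).+1 => `[< has_separated P Q e n >]) val.
  apply/card_gt0P; exists ord0; apply/asboolP; exact: has_separated0.
by rewrite /Nsep E; apply/asboolP.
Qed.

Lemma Nsep_ge P Q e n : 0 < e -> has_separated P Q e n -> (n <= Nsep P Q e)%N.
Proof.
move=> e0 H; have nb := has_separated_bound e0 H; rewrite -ltnS in nb.
by apply: (@leq_bigmax_cond _ _ _ (Ordinal nb)); apply/asboolP.
Qed.

(** A separated family of maximal size spans, since a point separated from all its members would
    enlarge it. *)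
Lemma spanning_family P Q e : 0 < e -> exists s : 'I_(Nsep P Q e) -> G -> R,
  [/\ forall i, P (s i), forall i j, i != j -> separated Q e (s i) (s j) &
   forall x, P x -> exists i, forall q, q \in Q -> nearZ e (x q - s i q)].
Proof.
move=> e0; have [s [sP ssep]] := Nsep_has P Q e; exists s; split=> // x Px.
apply: contrapT => H.
suff /(Nsep_ge e0) : has_separated P Q e (Nsep P Q e).+1 by rewrite ltnn.
have Hx i : separated Q e x (s i).
  by apply: contrapT => /notin_separated h; apply: H; exists i.
exists (fun i : 'I_(Nsep P Q e).+1 => oapp s x (unlift ord0 i)); split=> [i|i j].
  by case: unliftP => [i' _|_] /=; [exact: sP|].
case: unliftP => [i' ->|->]; case: unliftP => [j' ->|->] //=.
- by rewrite (inj_eq lift_inj) => /ssep.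
- by move=> _; have [q qQ nq] := Hx i'; exists q => // /nearZ_sym.

Qed.

Lemma Nsep_le P Q e e' : 0 < e -> e <= e' -> (Nsep P Q e' <= Nsep P Q e)%N.
Proof.
move=> e0 ee; apply: Nsep_ge => //; have [s [sP ssep]] := Nsep_has P Q e'.
exists s; split=> // i j /ssep[q qQ nq]; exists q => // /(nearZ_le ee); exact: nq.
Qed.

Lemma card_fibers (I J : finType) (phi : I -> J) (K : R) :
  (forall j, #|[set i | phi i == j]%SET|%:R <= K) -> #|I|%:R <= #|J|%:R * K.
Proof.
move=> H; have -> : #|I|%:R = \sum_j #|[set i | phi i == j]%SET|%:R :> R.
  rewrite -natr_sum; congr _%:R; rewrite -sum1_card (partition_big phi xpredT)//=.
  by apply: eq_bigr => j _; rewrite -sum1_card; apply: eq_bigl => i; rewrite inE.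
by rewrite mulr_natl -sumr_const; apply: ler_sum.
Qed.

End Separation.

(** * Determinants and separated sets *)

Section LatticeIndex.

(** After a Smith normal form [L D T], the map [invmx L] carries the lattice to that of the diagonal
    matrix [D], whose classes are tuples of residues. *)
Lemma lattice_index m (B : 'M[int]_m) : \det B != 0 ->
  exists (I : finType) (cl : 'cV[int]_m -> I) (rep : I -> 'cV[int]_m),
    [/\ #|I| = `|\det B|%N, cancel rep cl &
        forall u v, cl u = cl v <-> exists z, u - v = B *m z].
Proof.
have [L uL [T uT [d _ ->]]] := int_Smith_normal_form B.
set D := \matrix_(i, j) _; rewrite !det_mulmx.
have Dmul (z : 'cV[int]_m) i : (D *m z) i 0 = d`_i * z i 0.
  rewrite mxE (bigD1 i)//= mxE eqxx mulr1n big1 ?addr0// => k ki.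
  by rewrite mxE val_eqE eq_sym (negPf ki) mulr0n mul0r.
have detD : \det D = \prod_(i < m) d`_i.
  rewrite (_ : D = diag_mx (\row_i d`_i)); first by rewrite det_diag; apply: eq_bigr => i _; rewrite mxE.
  by apply/matrixP => i j; rewrite !mxE val_eqE; case: eqP.
have absunit (M : 'M[int]_m) : M \in unitmx -> `|\det M|%N = 1%N.
  by rewrite unitmxE => H; have : (\det M == 1) || (\det M == -1) := H; case/orP => /eqP ->.
rewrite detD => det0.
have dn (i : 'I_m) : d`_i != 0.
  by apply: contraNneq det0 => di; rewrite (bigD1 i)//= di mul0r mulr0 mul0r.
pose e (i : 'I_m) : int := d`_i.
have lt_mod (x : int) (i : 'I_m) : (`|(x %% e i)%Z| < `|e i|)%N.
  by have := ltz_mod x (dn i); rewrite -ltz_nat (gez0_abs (modz_ge0 x (dn i))) -abszE.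
pose I := {dffun forall i : 'I_m, 'I_(`|e i|%N)}.
pose cl (u : 'cV[int]_m) : I := [ffun i : 'I_m => Ordinal (lt_mod ((invmx L *m u) i 0) i)].
pose rep (c : I) : 'cV[int]_m := L *m \col_i ((c i : nat)%:Z).
have clE u v : cl u = cl v <-> forall i : 'I_m, (d`_i %| ((invmx L *m (u - v)) i 0)%R)%Z.
  have H i : ((invmx L *m (u - v)) i 0) = (invmx L *m u) i 0 - (invmx L *m v) i 0.
    by rewrite mulmxBr mxE [X in _ + X]mxE.
  split=> [E i|E].
    have := congr1 (fun c : I => (c i : nat)%:Z) E; rewrite !ffunE /= !gez0_abs ?modz_ge0 ?(dn i)//.
    by rewrite H -eqz_mod_dvd => ->.
  apply/ffunP => i; apply/val_inj; rewrite !ffunE /=.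
  by have := E i; rewrite H -eqz_mod_dvd => /eqP ->.
exists I, cl, rep; split.
- rewrite card_dep_ffun foldrE big_map big_enum /= !abszM absunit// (absunit T)// mul1n muln1.
  have -> : `|(\prod_(i < m) d`_i)%R|%N = (\prod_(i < m) `|e i|)%N.
    by rewrite (big_morph absz abszM (erefl : `|1%R|%N = 1%N)).
  by apply: eq_bigr => i _; rewrite card_ord.
- move=> c; apply/ffunP => i; rewrite ffunE; apply/val_inj => /=.
  rewrite /rep mulKmx// mxE -modz_abs modz_small ?absz_nat//.
  by rewrite ltz_nat; exact: ltn_ord (c i).
- move=> u v; rewrite clE; split=> [E|[z ->] i]; last first.
    by rewrite -!mulmxA mulKmx// Dmul dvdz_mulr.
  have Hi i : exists q, (invmx L *m (u - v)) i 0 = d`_i * q.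
    by have /dvdzP[q ->] := E i; exists q; rewrite mulrC.
  have [q Hq] := choice Hi.
  exists (invmx T *m \col_i q i); rewrite -!mulmxA mulKVmx//.
  have -> : D *m \col_i q i = invmx L *m (u - v).
    by apply/matrixP => i j; rewrite ord1 Dmul Hq mxE.
  by rewrite mulKVmx.
Qed.

End LatticeIndex.

(** * Shadowing, and counts for products *)

Section SeparatedSets.
Variables (R : realType) (G : groupType).
Implicit Types (a b : seq (R * G)) (x y z : G -> R) (Q T : seq G) (c : G) (e k d : R).

Lemma lop_frac_int a x c : intlist a -> lop a (fun c0 => frac (x c0)) c - lop a x c \is a Num.int.
Proof. by move=> aZ; rewrite -lopB; apply: intlist_lop => // p _; exact: frac_int. Qed.

Lemma solution_frac a x : intlist a -> solution a x -> solution a (fun c => frac (x c)).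
Proof. by move=> aZ xa c; rewrite -(subrK (lop a x c) (lop _ _ _)) rpredD ?lop_frac_int. Qed.

Lemma nearZ_lop a x c e : intlist a ->
  (forall p, p \in a -> nearZ e (x (c * p.2)%g)) -> nearZ (l1norm a * e) (lop a x c).
Proof.
elim: a => [|p a IHa] /=.
  move=> _ _; apply: nearZ_int; rewrite /l1norm /lop !big_nil ?mul0r// rpred0.
move=> /andP[pZ aZ] H; rewrite /l1norm /lop !big_cons mulrDl; apply: nearZD.
  have [n xn] := H p (mem_head _ _).
  have /intrP[m pm] := pZ; exists (m * n).
  by rewrite pm intrM -mulrBr normrM ler_wpM2l.
by apply: IHa => // q qa; apply: H; rewrite inE qa orbT.
Qed.

Lemma far_lop a Q T k e x y : intlist a -> 0 <= k -> T = [seq p.2 | p <- a] ->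
  invariant T k Q ->
  (far Q (l1norm a * e) (lop a x) (lop a y))%:R
    <= (size T)%:R * (k * (size Q)%:R + (far Q e x y)%:R).
Proof.
move=> aZ k0 TE Qi; have := count_neighbourhood (fun q => ~~ `[< nearZ e (x q - y q) >]) k0 Qi.
apply: le_trans; rewrite ler_nat /far; apply: sub_count => q /=; apply: contraR => /hasPn H.
apply/asboolP; rewrite -lopB; apply: nearZ_lop => // p pa.
have := H p.2; rewrite TE map_f// => /(_ isT); rewrite negb_or !negbK => /andP[_].
by move=> /asboolP.
Qed.

Section Shadowing.
Variable a : seq (R * G).
Hypotheses (ai : left_inv a) (ai' : left_inv (lstar a)).

(** Round [a x] to an integral function [v] and solve [a z = v] with [z] bounded. Near most points
    [a (x - z)] is the small rounding error, so [left_inv_local] makes [x - z] small there. *)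
Lemma shadowing e : 0 < e -> exists2 h : R, 0 < h & forall k : R, 0 < k -> exists2 k' : R, 0 < k' &
  windows R (fun Q => forall x, (forall c, 0 <= x c < 1) ->
    (count (fun q => ~~ `[< nearZ h (lop a x q) >]) Q)%:R <= k' * (size Q)%:R ->
    exists2 z, solution a z & (far Q e x z)%:R <= k * (size Q)%:R).
Proof.
move=> e0; have [C C0 HC] := right_inv_solve ai'.
(* [K] bounds [x - z]: the values of [x] are below 1, and those of the rounded [a x] are at most
   [l1norm a + 1/2]. *)
pose K := 1 + C * (l1norm a + 2^-1).
have K0 : 0 < K by rewrite ltr_pwDl// mulr_ge0 ?(ltW C0)// addr_ge0// invr_ge0.
have [h0 h00 [T HT]] := left_inv_local ai K0 e0.
(* Below 1/2, rounding picks the integer that witnesses [nearZ]. *)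
pose h := Num.min h0 4^-1.
have h1 : 0 < h by rewrite lt_min h00 invr_gt0 ltr0n.
exists h => // k k0; pose k' := k / (2 * (size T).+1%:R).
have k'0 : 0 < k' by rewrite divr_gt0// mulr_gt0.
exists k' => //; exists T, k'; split=> // Q Qi x x01 xQ.
have x1 c : `|x c| <= 1 by have /andP[x0 x1] := x01 c; rewrite ger0_norm// ltW.
pose v c : R := (round (lop a x c))%:~R.
have vb c : `|v c| <= l1norm a + 2^-1.
  rewrite -[v c](subrK (lop a x c)) -[X in X <= _]normrN opprD; apply: le_trans (ler_normB _ _) _.
  rewrite opprB addrC lerD ?round_le//.
  by rewrite -[X in _ <= X]mulr1; apply: lop_bound => p _.
have [z [zv zb]] := HC v _ vb.
exists z; first by move=> c; rewrite zv intr_int.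
have db c : `|x c - z c| <= K.
  by apply: le_trans (ler_normB _ _) _; rewrite lerD.
apply: (@le_trans _ _ (count (fun q => has (fun t => ((q * t)%g \notin Q) ||
     ~~ `[< nearZ h (lop a x (q * t)%g) >]) T) Q)%:R).
  rewrite ler_nat /far; apply: sub_count => q /=; apply: contraR => /hasPn H.
  apply/asboolP; exists 0; rewrite subr0.
  apply: (HT (fun c => x c - z c)) => // t tT.
  have := H t tT; rewrite negb_or !negbK => /andP[_ /asboolP xn].
  rewrite lopB zv; apply: le_trans (round_near _ xn) _; last by rewrite /h ge_min lexx.
  by rewrite /h gt_min; apply/orP; right; rewrite ltf_pV2 ?posrE// ltr_nat.
apply: le_trans (count_neighbourhood (fun q => ~~ `[< nearZ h (lop a x q) >]) (ltW k'0) Qi) _.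
apply: (@le_trans _ _ ((size T).+1%:R * (k' * (size Q)%:R + k' * (size Q)%:R))).
  apply: ler_pM => //; first by rewrite addr_ge0// mulr_ge0// ltW.
    by rewrite ler_nat.
  by rewrite lerD2l.
have kE : 2 * (size T).+1%:R * k' = k by rewrite mulrC divfK// gt_eqF// mulr_gt0.
by rewrite -[in leRHS]kE le_eqVlt; apply/orP; left; apply/eqP; ring.
Qed.

End Shadowing.

Lemma invariant_far0 T k Q : invariant T k Q -> 0 <= k ->
  forall a, T = [seq p.2 | p <- a] -> intlist a -> forall e x y,
  (forall q, q \in Q -> nearZ e (x q - y q)) ->
  (far Q (l1norm a * e) (lop a x) (lop a y))%:R <= (size T)%:R * k * (size Q)%:R.
Proof.
move=> Qi k0 a TE aZ e x y xy.
by apply: le_trans (far_lop e x y aZ k0 TE Qi) _; rewrite far0// addr0 mulrA.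
Qed.

(* Solutions x of a and t of b are combined into the solution y + t of a b,
   where b y = x. *)
Lemma Nsep_mul_ge a b : intlist a -> intlist b -> left_inv (lstar b) ->
  forall e, 0 < e -> exists2 e' : R, 0 < e' & forall d, 0 < d ->
  windows R (fun Q => (Nsep (solution a) Q e)%:R * (Nsep (solution b) Q e)%:R
     <= (Nsep (solution (lmul a b)) Q e')%:R * expR (d * (size Q)%:R)).
Proof.
move=> aZ bZ bi e e0; have [C C0 HC] := right_inv_solve bi.
pose T := [seq p.2 | p <- b].
pose n := l1norm b + 1; have n0 : 0 < n by rewrite ltr_wpDl.
have n1 : 1 <= n by rewrite lerDr.
(* Both [2 e'] and its image bound [l1norm b * 2 e'] are at most [e / 2]. *)
pose e' := e / 4 / n; have e'0 : 0 < e' by rewrite !divr_gt0.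
have e'e : e' + e' <= e / 2.
  rewrite -mulr2n -mulr_natl /e'; have : e / 4 / n <= e / 4.
    by rewrite ler_pdivrMr// ler_peMr// divr_ge0// ltW.
  by move: (e / 4 / n) => w; lra.
have e'b : l1norm b * (e' + e') <= e / 2.
  apply: (@le_trans _ _ (n * (e' + e'))).
    by rewrite ler_wpM2r ?addr_ge0 ?(ltW e'0)// lerDl.
  by rewrite /e' -mulr2n -[_ *+ 2]mulr_natr mulrA mulrC mulrA mulrC le_eqVlt; apply/orP; left; apply/eqP; field; rewrite gt_eqF.
exists e' => // d d0; have [k k0 Hk] := packing G e0 d0.
pose k' := k / (size T).+1%:R; have k'0 : 0 < k' by rewrite divr_gt0.
exists T, k'; split=> // Q Qi.
have [s [sP ssep]] := Nsep_has (solution a) Q e.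
have [t [tP tsep]] := Nsep_has (solution b) Q e.
have [r [rP rsep rspan]] := spanning_family (solution (lmul a b)) Q e'0.
have Hy i : exists y, forall c, lop b y c = frac (s i c).
  have [|y [Hy _]] := HC (fun c => frac (s i c)) 1; last by exists y.
  by move=> c; have /andP[f0 f1] := frac_itv (s i c); rewrite ger0_norm// ltW.
have [y yP] := choice Hy.
pose p (ij : 'I__ * 'I__) c := y ij.1 c + t ij.2 c.
have pP ij : solution (lmul a b) (p ij).
  move=> c; rewrite lop_mul (eq_lop a (lopD b (y ij.1) (t ij.2))) lopD.
  rewrite (eq_lop a (yP ij.1)); apply: rpredD; first exact: (solution_frac aZ (sP ij.1) c).
  by apply: intlist_lop => // q _; exact: tP.
have Hphi ij : exists l, forall q, q \in Q -> nearZ e' (p ij q - r l q) by exact: rspan.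
have [phi Hp] := choice Hphi.
have -> : (Nsep (solution a) Q e)%:R * (Nsep (solution b) Q e)%:R =
    #|{: 'I_(Nsep (solution a) Q e) * 'I_(Nsep (solution b) Q e)}|%:R :> R.
  by rewrite card_prod !card_ord natrM.
(* In a fibre the sums [y + t] are [2 e']-near on [Q]. Equal first indices would make two members of
   [t] near, so the first index determines the pair; applying [b], the corresponding [s] are near
   off the boundary, and [packing] applies. *)
rewrite -[X in _ <= X%:R * _]card_ord; apply: (card_fibers (phi := phi)) => l.
have pp ij ij' : phi ij = phi ij' -> forall q, q \in Q -> nearZ (e' + e') (p ij q - p ij' q).
  move=> E q qQ; apply: nearZ_triangle (Hp ij q qQ) _.
  by rewrite E; apply: nearZ_sym; exact: Hp.
have [->|[ij0]] := set_0Vmem [set ij | phi ij == l]%SET; first by rewrite cards0 expR_ge0.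
rewrite inE => /eqP E0.
apply: (Hk _ _ Q (fun ij => s ij.1) (s ij0.1)).
  move=> ij ij'; rewrite !inE => /eqP E /eqP E'; case: ij ij' E E' => [i j] [i' j'] E E' ne /=.
  have [ii|ii] := eqVneq i i'; last exact: ssep.
  have jj : j != j' by apply: contraNneq ne => ->; rewrite ii.
  have [q qQ nq] := tsep _ _ jj; exfalso; apply: nq.
  have := pp _ _ (etrans E (esym E')) q qQ; rewrite /p /= ii opprD addrACA subrr add0r.
  by apply: nearZ_le; lra.
move=> ij; rewrite inE => /eqP E.
have h1 := invariant_far0 Qi (ltW k'0) (erefl _) bZ (pp _ _ (etrans E (esym E0))).
apply: (@le_trans _ _ ((size T)%:R * k' * (size Q)%:R)); last first.
  rewrite ler_wpM2r// /k' mulrCA ler_piMr ?(ltW k0)//.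
  by rewrite ler_pdivrMr// mul1r ler_nat.
apply: le_trans h1; rewrite ler_nat; apply: leq_trans (far_le _ _ _ e'b).
apply: sub_count => q /=; apply: contra => /asboolP H; apply/asboolP.
move: H; rewrite !(lopD b (y _) (t _)) !yP opprD addrACA => H.
have := H; rewrite (nearZ_add_int _ _ (_ : lop b (t ij.2) q - lop b (t ij0.2) q \is a Num.int)).
  have -> : frac (s ij.1 q) - frac (s ij0.1 q) =
    (s ij.1 q - s ij0.1 q) + ((frac (s ij.1 q) - s ij.1 q) - (frac (s ij0.1 q) - s ij0.1 q)) by ring.
  by rewrite nearZ_add_int// rpredB ?frac_int.
by rewrite rpredB ?tP.
Qed.

(** A solution [w] of [a b] is recorded by the member of a spanning family near [b w]. Two solutions
    with the same record differ by an approximate solution of [b], which is shadowed by a true one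
    and recorded in turn; [packing] bounds what shares both records. *)
Lemma Nsep_mul_le a b : intlist a -> intlist b -> left_inv b -> left_inv (lstar b) ->
  forall e d, 0 < e -> 0 < d -> exists2 e1 : R, 0 < e1 &
  windows R (fun Q => (Nsep (solution (lmul a b)) Q e)%:R <=
    (Nsep (solution a) Q e1)%:R * (Nsep (solution b) Q (e / 8))%:R * expR (d * (size Q)%:R)).
Proof.
move=> aZ bZ bi bi' e d e0 d0.
have e8 : 0 < e / 8 by rewrite divr_gt0.
have [k k0 Hk] := packing G e0 d0.
have [h h0 Hh] := shadowing bi bi' e8.
have [k' k'0 HW] := Hh k k0.
have h2 : 0 < h / 2 by rewrite divr_gt0.
exists (h / 2) => //; apply: filterS HW => Q HQ.
have [s [sP ssep]] := Nsep_has (solution (lmul a b)) Q e.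
have [r [rP rsep rspan]] := spanning_family (solution a) Q h2.
have [r' [r'P r'sep r'span]] := spanning_family (solution b) Q e8.
have Hphi i : exists l, forall q, q \in Q -> nearZ (h / 2) (lop b (s i) q - r l q).
  by apply: rspan => c; rewrite -lop_mul; exact: sP.
have [phi Hp] := choice Hphi.
(* A reference member of the fibre that depends only on [phi i]; the default is never taken, as [i]
   itself is in the fibre. *)
pose base i := odflt i [pick j | phi j == phi i].
have baseE i : phi (base i) = phi i.
  by rewrite /base; case: pickP => [j /eqP//|].
have base_eq i j : phi i = phi j -> base i = base j.
  rewrite /base => E; rewrite E; case: pickP => // /(_ j); by rewrite eqxx.
have Hpsi i : exists l, (far Q (e / 4) (s i) (fun c => s (base i) c + r' l c))%:R <= k * (size Q)%:R.
  pose x c := frac (s i c - s (base i) c).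
  have [||z zP xz] := HQ x; first by move=> c; exact: frac_itv.
    rewrite (_ : count _ _ = 0%N) ?mulr_ge0 ?(ltW k'0)//.
    apply/eqP; rewrite -leqn0 leqNgt -has_count; apply/hasPn => q qQ /=.
    rewrite negbK; apply/asboolP.
    rewrite -(subrK (lop b (fun c => s i c - s (base i) c) q) (lop b x q)) addrC.
    apply/nearZ_add_int; first exact: lop_frac_int.
    rewrite lopB [h]splitr; apply: nearZ_triangle (Hp i q qQ) _.
    by rewrite -baseE; apply: nearZ_sym; exact: Hp.
  have [l Hl] := r'span z zP; exists l; apply: le_trans xz; rewrite ler_nat.
  have -> : far Q (e / 4) (s i) (fun c => s (base i) c + r' l c) = far Q (e / 8 + e / 8) x (r' l).
    apply: eq_count => q /=; have -> : e / 8 + e / 8 = e / 4 by field.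
    have E : x q - r' l q = (s i q - (s (base i) q + r' l q)) + (x q - (s i q - s (base i) q)).
      by ring.
    have N := nearZ_add_int (e / 4) (s i q - (s (base i) q + r' l q)) (frac_int (s i q - s (base i) q)).
    by congr (~~ _); apply/asboolP/asboolP; rewrite E => /N.
  by apply: leq_trans (far_triangle _ _ _ _ z _) _; rewrite (far0 Hl) addn0.
have [psi Hpsi'] := choice Hpsi.
rewrite -natrM -[X in X%:R <= _]card_ord.
have -> : (Nsep (solution a) Q (h / 2) * Nsep (solution b) Q (e / 8))%N =
    #|{: 'I_(Nsep (solution a) Q (h / 2)) * 'I_(Nsep (solution b) Q (e / 8))}|.
  by rewrite card_prod !card_ord.
apply: (card_fibers (phi := fun i => (phi i, psi i))) => l.
have [->|[i0]] := set_0Vmem [set i | (phi i, psi i) == l]%SET; first by rewrite cards0 expR_ge0.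
rewrite inE => /eqP E0.
apply: (Hk _ _ Q s (fun c => s (base i0) c + r' (psi i0) c)) => [i j _ _|i]; first exact: ssep.
rewrite inE => /eqP; rewrite -E0 => -[E1 E2].
have := Hpsi' i; rewrite (base_eq _ _ E1) E2; apply: le_trans; rewrite ler_nat.
by apply: far_le; lra.
Qed.

End SeparatedSets.

(** * Counts of solutions against determinants *)

Section DeterminantBounds.
Variables (R : realType) (G : groupType).
Implicit Types (a b : seq (R * G)) (x : G -> R) (Q T : seq G) (c : G) (e k d : R).

Lemma lattice_index_real m (B : 'M[R]_m) : (forall i j, B i j \is a Num.int) -> \det B != 0 ->
  exists (I : finType) (cl : 'cV[int]_m -> I) (rep : I -> 'cV[int]_m),
    [/\ `|\det B| = #|I|%:R, cancel rep cl &
        forall u v, cl u = cl v <-> exists z : 'cV[int]_m,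
          map_mx intr u - map_mx intr v = B *m map_mx intr z].
Proof.
move=> BZ; pose C : 'M[int]_m := map_mx Num.floor B.
have CB : map_mx intr C = B.
  by apply/matrixP => i j; rewrite !mxE; have /intrP[n ->] := BZ i j; rewrite intrKfloor.
rewrite -CB det_map_mx intr_eq0 => /lattice_index[I [cl [rep [cI repK clE]]]].
exists I, cl, rep; split=> // [|u v].
  by rewrite cI -intr_norm -abszE.
rewrite clE; split=> -[z E]; exists z.
  by rewrite -map_mxM -E map_mxB.
have inj (A A' : 'cV[int]_m) : map_mx intr A = map_mx intr A' :> 'cV[R]_m -> A = A'.
  by move=> /matrixP H; apply/matrixP => i j; have := H i j; rewrite !mxE => /intr_inj.
by apply: inj; rewrite map_mxM -E map_mxB.
Qed.

Lemma int_small (t : R) : t \is a Num.int -> `|t| < 1 -> t = 0.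
Proof.
move=> /intrP[m ->]; rewrite -intr_norm -[1]/(1%:~R) ltr_int => m1.
by have -> : m = 0 by lia.
Qed.

Lemma inord_abs_inj (M : nat) (m m' : int) : `|m| <= M%:Z -> `|m'| <= M%:Z ->
  inord (absz (m + M%:Z)%R) = inord (absz (m' + M%:Z)%R) :> 'I_(M + M).+1 -> m = m'.
Proof. by move=> mM mM' /(congr1 val); rewrite /= !inordK; lia. Qed.

Definition vecw m (w : 'I_m -> G) (y : 'I_m -> R) c := \sum_j y j * dlt R (w j) c.

(** Rows and columns have separate enumerations of the same length: the large minors are square, but
    their rows may leave the window. *)
Definition mxw a m (w1 w2 : 'I_m -> G) : 'M[R]_m := \matrix_(i, j) lop a (dlt R (w2 j)) (w1 i).

Lemma vecw_at m (w : 'I_m -> G) y j : injective w -> vecw w y (w j) = y j.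
Proof.
move=> wI; rewrite /vecw (bigD1 j)//= /dlt eqxx mulr1 big1 ?addr0// => i ij.
by rewrite (inj_eq wI) eq_sym (negPf ij) mulr0.
Qed.

Lemma vecw_cases m (w : 'I_m -> G) y c : injective w ->
  vecw w y c = 0 /\ (forall j, c != w j) \/ exists2 j, c = w j & vecw w y c = y j.
Proof.
move=> wI; have [[j ->]|H] := pselect (exists j, c = w j).
  by right; exists j; rewrite ?vecw_at.
left; split=> [|j]; last by apply: contra_notN H => /eqP ->; exists j.
rewrite /vecw big1// => j _; rewrite /dlt; case: eqP => [E|]; rewrite ?mulr0//.
by case: H; exists j.
Qed.

Lemma lop_vecw a m (w1 w2 : 'I_m -> G) y i :
  lop a (vecw w2 y) (w1 i) = (mxw a w1 w2 *m \col_j y j) i 0.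
Proof.
by rewrite /vecw lop_sum mxE; apply: eq_bigr => j _; rewrite lopZ !mxE mulrC.
Qed.

Lemma mxw_int a m (w1 w2 : 'I_m -> G) i j : intlist a -> mxw a w1 w2 i j \is a Num.int.
Proof.
move=> aZ; rewrite mxE; apply: intlist_lop => // p _.
by rewrite /dlt; case: eqP.
Qed.

Lemma count_notin_image Q (w : 'I_(size Q) -> G) : uniq Q -> injective w ->
  (count (fun q => q \notin codom w) Q <= #|[pred i | w i \notin Q]|)%N.
Proof.
move=> uQ wI; have h1 := count_predC (mem (codom w)) Q.
have h2 : (#|[pred i | w i \in Q]| <= count (mem (codom w)) Q)%N.
  rewrite cardE -(size_map w) -size_filter; apply: uniq_leq_size.
    by rewrite map_inj_uniq ?enum_uniq.
  move=> c /mapP[i]; rewrite mem_enum inE => iQ ->.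
  by rewrite mem_filter iQ andbT; exact: codom_f.
have h3 := cardC [pred i | w i \in Q]; rewrite card_ord in h3.
have h4 : #|[predC [pred i | w i \in Q]]| = #|[pred i | w i \notin Q]| by apply: eq_card.
move: h1 h2 h3; rewrite h4 /predC /=; set A := count _ _; set B := count _ _.
set C := #|_|; set D := #|_|; lia.
Qed.

Lemma count_pred_image m (w : 'I_m -> G) (p : pred 'I_m) (s : seq G) : injective w ->
  (forall i, p i -> w i \in s) -> (#|p| <= size s)%N.
Proof.
move=> wI ps; rewrite cardE -(size_map w); apply: uniq_leq_size.
  by rewrite map_inj_uniq ?enum_uniq.
by move=> c /mapP[i]; rewrite mem_enum => /ps iS ->.
Qed.

Lemma col_frac m (v : 'cV[R]_m) :
  \col_j frac (v j 0) = v - map_mx intr (\col_j Num.floor (v j 0)).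
Proof. by apply/matrixP => j l; rewrite ord1 !mxE. Qed.

(** [|det B|] counts the classes modulo the lattice of [B]. Each class gives a vector [y] in the
    unit cube with [B y] integral; extended by zero it is a solution at most points of [Q] and is
    shadowed by a true one. Classes with the same shadow have vectors that differ, modulo integers,
    by a vector [ep] that is small at most places. Then [B ep] is integral, bounded and mostly zero,
    so few values occur, and it determines the class. *)
Lemma det_le_Nsep a : intlist a -> left_inv a -> left_inv (lstar a) ->
  exists2 e0 : R, 0 < e0 & forall d, 0 < d -> exists2 k : R, 0 < k &
  windows R (fun Q => forall w1 w2 : 'I_(size Q) -> G, injective w1 -> injective w2 ->
    #|[pred i | w1 i \notin Q]|%:R <= k * (size Q)%:R ->
    #|[pred i | w2 i \notin Q]|%:R <= k * (size Q)%:R ->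
    `|\det (mxw a w1 w2)| <= (Nsep (solution a) Q e0)%:R * expR (d * (size Q)%:R)).
Proof.
move=> aZ ai ai'; pose n := l1norm a + 1; have n0 : 0 < n by rewrite ltr_wpDl.
have n1 : 1 <= n by rewrite lerDr.
(* Vectors in a fibre are [4 e0]-near at most places. This is below 1/2, so rounding finds the right
   integer, and [l1norm a * 4 e0 < 1] forces an integral entry of [B ep] to vanish. *)
pose e0 := (16 * n)^-1; have e00 : 0 < e0 by rewrite invr_gt0 mulr_gt0.
have e0n : 16 * (n * e0) = 1 by rewrite /e0; field; rewrite gt_eqF.
have e0le : 16 * e0 <= 1.
  apply: (@le_trans _ _ (16 * (n * e0))); last by rewrite e0n.
  by rewrite ler_wpM2l// ler_peMl// ltW.
have e0h : 4 * e0 < 2^-1 by lra.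
have e0a : l1norm a * (4 * e0) < 1.
  apply: (@le_lt_trans _ _ (n * (4 * e0))); first by rewrite ler_wpM2r ?lerDl// mulr_ge0// ltW.
  by rewrite mulrCA; lra.
exists e0 => // d d0.
pose M := (Num.truncn (l1norm a)).+1.
have [k2 k20 Hk2] := sparse_codes (M + M).+1 d0.
have [h h0 Hh] := shadowing ai ai' e00.
pose s1 : R := (size a).+1%:R; have s10 : 0 < s1 by rewrite ltr0n.
(* The code has weight at most [s1 (k + 2 k1) (size Q)], which is below [k2 (size Q)] when
   [k <= k1]. *)
pose k1 := k2 / (4 * s1); have k10 : 0 < k1 by rewrite divr_gt0// mulr_gt0.
have [k' k'0 HW] := Hh k1 k10.
pose k := Num.min k' k1; have k0 : 0 < k by rewrite lt_min k'0.
exists k => //; apply: filterS2 HW (near_invariant [::] ltr01) => Q HQ [uQ Q0 _] w1 w2 w1I w2I b1 b2.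
set B := mxw a w1 w2.
have [->|dB] := eqVneq (\det B) 0; first by rewrite normr0 mulr_ge0// expR_ge0.
have BZ i j : B i j \is a Num.int by exact: mxw_int.
have [I [cl [rep [-> repK clE]]]] := lattice_index_real BZ dB.
have uB : B \in unitmx by rewrite unitmxE unitfE.
pose yv i : 'cV[R]_(size Q) := invmx B *m map_mx intr (rep i).
pose fl i : 'cV[int]_(size Q) := \col_j Num.floor (yv i j 0).
pose y i j := frac (yv i j 0).
have yE i : \col_j y i j = yv i - map_mx intr (fl i).
  exact: col_frac.
have By i : B *m (\col_j y i j) = map_mx intr (rep i) - B *m map_mx intr (fl i).
  by rewrite yE mulmxBr /yv mulKVmx.
have Bint (v : 'cV[int]_(size Q)) l : (B *m map_mx intr v) l 0 \is a Num.int.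
  by rewrite mxE; apply: rpred_sum => j _; rewrite rpredM// mxE intr_int.
have Zsub (A C : 'cV[R]_(size Q)) j : A j 0 \is a Num.int -> C j 0 \is a Num.int ->
    (A - C) j 0 \is a Num.int.
  by move=> hA hC; rewrite mxE [X in _ + X]mxE rpredB.
pose Y i := vecw w2 (y i).
have Y01 i c : 0 <= Y i c < 1.
  rewrite /Y; have [[-> _]|[j _ ->]] := vecw_cases (y i) c w2I; first by rewrite lexx ltr01.
  exact: frac_itv.
have Yint i j : lop a (Y i) (w1 j) \is a Num.int.
  by rewrite lop_vecw -/B By; apply: (Zsub) => //; rewrite mxE intr_int.
have [r [rP rsep rspan]] := spanning_family (solution a) Q e00.
have Hphi i : exists l, (far Q (2 * e0) (Y i) (r l))%:R <= k1 * (size Q)%:R.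
  have [||z zP xz] := HQ (Y i); first exact: Y01.
    apply: (@le_trans _ _ (k * (size Q)%:R)); last first.
      by rewrite ler_wpM2r// /k ge_min lexx.
    apply: le_trans b1; rewrite ler_nat; apply: leq_trans (count_notin_image uQ w1I).
    apply: sub_count => q /=; apply: contra => /codomP[j ->].
    by apply/asboolP/nearZ_int => //; exact: ltW.
  have [l Hl] := rspan z zP; exists l; apply: le_trans xz; rewrite ler_nat.
  have -> : 2 * e0 = e0 + e0 by ring.
  by apply: leq_trans (far_triangle _ _ _ _ z _) _; rewrite (far0 Hl) addn0.
have [phi Hp] := choice Hphi.
rewrite -[X in _ <= X%:R * _]card_ord; apply: (card_fibers (phi := phi)) => l.
have [->|[i0]] := set_0Vmem [set i | phi i == l]%SET; first by rewrite cards0 expR_ge0.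
rewrite inE => /eqP E0.
have Yfar i : phi i = l -> (far Q (4 * e0) (Y i) (Y i0))%:R <= 2 * k1 * (size Q)%:R.
  move=> E; have -> : 4 * e0 = 2 * e0 + 2 * e0 by ring.
  apply: (@le_trans _ _ ((far Q (2 * e0) (Y i) (r l))%:R + (far Q (2 * e0) (Y i0) (r l))%:R)).
    by rewrite -natrD ler_nat (far_sym _ _ (Y i0)) far_triangle.
  have := lerD (Hp i) (Hp i0); rewrite E E0 => /le_trans; apply.
  by rewrite -mulrDl ler_wpM2r//; lra.
pose ro i : 'cV[int]_(size Q) := \col_j round (y i j - y i0 j).
pose ep i j := y i j - y i0 j - (round (y i j - y i0 j))%:~R.
have epE i : \col_j ep i j = \col_j y i j - \col_j y i0 j - map_mx intr (ro i).
  by apply/matrixP => j l'; rewrite ord1 !mxE.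
have ep2 i j : `|ep i j| <= 2^-1 by exact: round_le.
pose u i := B *m \col_j ep i j.
have uE i : u i = map_mx intr (rep i) - map_mx intr (rep i0) - B *m map_mx intr (fl i - fl i0 + ro i).
  rewrite /u epE !mulmxBr !By map_mxD map_mxB mulmxDr mulmxBr.
  by rewrite !opprD !opprK; apply/matrixP => j l'; rewrite !mxE; ring.
have uint i j : u i j 0 \is a Num.int.
  by rewrite uE; apply: (Zsub) => //; apply: (Zsub); rewrite mxE intr_int.
have ulop i j : u i j 0 = lop a (vecw w2 (ep i)) (w1 j) by rewrite lop_vecw.
have ub i j : `|u i j 0| <= l1norm a.
  rewrite ulop -[leRHS]mulr1; apply: lop_bound => p _.
  have [[-> _]|[j' _ ->]] := vecw_cases (ep i) (w1 j * p.2)%g w2I; first by rewrite normr0.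
  by apply: le_trans (ep2 i j') _; rewrite invf_le1 ?ler1n.
pose badj i := [pred j | ~~ `[< nearZ (4 * e0) (y i j - y i0 j) >]].
pose bad i := [seq w2 j | j <- enum (badj i)].
have badsize i : phi i = l -> (size (bad i))%:R <= (k + 2 * k1) * (size Q)%:R.
  move=> E; rewrite mulrDl; apply: le_trans (lerD b2 (Yfar i E)); rewrite -natrD ler_nat.
  rewrite size_map -cardE; pose B2 := [pred j | badj i j & w2 j \in Q].
  apply: (@leq_trans (#|[pred i | w2 i \notin Q]| + #|B2|)).
    rewrite -cardUI; apply: leq_trans (leq_addr _ _); apply: subset_leq_card.
    by apply/fintype.subsetP => j; rewrite !inE => ->; case: (_ \in Q).
  rewrite leq_add2l /far -size_filter; apply: (count_pred_image w2I) => j /andP[bj jQ].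
  by rewrite mem_filter jQ andbT /Y !vecw_at.
have ubad i j : (forall p, p \in a -> (w1 j * p.2)%g \notin bad i) -> u i j 0 = 0.
  move=> H; apply: int_small (uint i j) _.
  apply: le_lt_trans e0a; rewrite ulop; apply: lop_bound => p pa.
  have [[-> _]|[j' E ->]] := vecw_cases (ep i) (w1 j * p.2)%g w2I.
    by rewrite normr0 mulr_ge0// ltW.
  have := H p pa; rewrite E /bad (mem_map w2I) mem_enum inE negbK => /asboolP.
  exact: round_near.
pose code i : {ffun 'I_(size Q) -> option 'I_(M + M).+1} :=
  [ffun j => if u i j 0 == 0 then None else Some (inord (absz (Num.floor (u i j 0) + M%:Z)%R))].
have uM i j : exists2 m : int, u i j 0 = m%:~R & `|m| <= M%:Z.
  have /intrP[m um] := uint i j; exists m => //.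
  rewrite -(ler_int R) intr_norm -um; apply: le_trans (ub i j) _.
  by rewrite -pmulrn ltW// truncnS_gt.
have codeI i i' : code i = code i' -> u i = u i'.
  move=> E; apply/matrixP => j o; rewrite (ord1 o).
  have := congr1 (fun c : {ffun 'I_(size Q) -> option 'I_(M + M).+1} => c j) E.
  rewrite !ffunE; case: eqP => [->|_]; case: eqP => [->|_] //.
  have [m -> mM] := uM i j; have [m' -> mM'] := uM i' j.
  by move=> []; rewrite !intrKfloor => /(inord_abs_inj mM mM') ->.
apply: (Hk2 _ _ _ code).
  (* [u i] equals [rep i - rep i0] modulo the lattice, so equal values put [rep i] and [rep i'] in
     one class. *)
  move=> i i' _ _ /codeI; rewrite !uE => H.
  rewrite -(repK i) -(repK i'); apply/clE.
  exists ((fl i - fl i0 + ro i) - (fl i' - fl i0 + ro i')).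
  rewrite map_mxB mulmxBr; apply/eqP; rewrite subr_eq addrC addrA.
  move/eqP: H; rewrite subr_eq => /eqP H.
  apply/eqP; rewrite -[LHS](subrK (map_mx intr (rep i0))) H; apply/matrixP => j o.
  by rewrite !mxE; ring.
move=> i; rewrite inE => /eqP E.
apply: (@le_trans _ _ ((size a)%:R * (size (bad i))%:R)).
  rewrite -natrM ler_nat /weight.
  apply: (@leq_trans #|[pred j | has (fun p => (w1 j * p.2)%g \in bad i) a]|).
    apply: subset_leq_card; apply/fintype.subsetP => j; rewrite !inE ffunE.
    apply: contraR => /hasPn H; rewrite ubad ?eqxx// => p pa; exact: H.
  elim: (a) => [|p a' IHa]; first by rewrite leqn0; apply/eqP; apply: eq_card0 => j; rewrite inE.
  rewrite mulSn; apply: (@leq_trans (#|[pred j | (w1 j * p.2)%g \in bad i]| +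
    #|[pred j | has (fun p => (w1 j * p.2)%g \in bad i) a']|)).
    by rewrite -cardUI leq_addr.
  apply: leq_add => //; apply: (@count_pred_image _ (fun j => (w1 j * p.2)%g)) => // j j' /mulIg.
  exact: w1I.
apply: (@le_trans _ _ (s1 * ((k1 + 2 * k1) * (size Q)%:R))).
  apply: ler_pM => //; first by rewrite ler_nat.
  apply: le_trans (badsize i E) _; rewrite ler_wpM2r// lerD2r.
  by rewrite /k ge_min lexx orbT.
rewrite mulrA ler_wpM2r//.
have -> : k2 = 4 * (s1 * k1) by rewrite /k1; field; rewrite gt_eqF.
have sk0 : 0 <= s1 * k1 by rewrite mulr_ge0// ltW.
have skE : s1 * (k1 + 2 * k1) = 3 * (s1 * k1) by ring.
by rewrite skE; move: (s1 * k1) sk0 => w w0; lra.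
Qed.

(** For a solution cut to [Q], [B x] is integral up to an error [b] carried by the boundary. If the
    integral parts of two solutions lie in one class modulo [B], then [x i - x i0] minus an integral
    vector is mapped by [B] to a vector of small l^2 norm, so it is itself small in l^2. Hence the
    two are near at most points, and [packing] bounds the fibre over each of the [|det B|]
    classes. *)
Lemma Nsep_le_det a C : intlist a -> 0 < C ->
  (forall Q, uniq Q -> forall y : 'cV[R]_(size Q),
     \sum_j y j 0 ^+ 2 <= C * \sum_j (mxop a Q Q *m y) j 0 ^+ 2) ->
  forall e d, 0 < e -> 0 < d ->
  windows R (fun Q => (Nsep (solution a) Q e)%:R <=
    `|\det (mxop a Q Q)| * expR (d * (size Q)%:R)).
Proof.
move=> aZ C0 HC e d e0 d0; have [k k0 Hk] := packing G e0 d0.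
pose T := [seq p.2 | p <- a]; pose s1 : R := (size T).+1%:R.
have s10 : 0 < s1 by rewrite ltr0n.
have e4 : 0 < (e / 2) ^+ 2 by rewrite exprn_gt0// divr_gt0.
pose k' := k * (e / 2) ^+ 2 / (C * s1).
have k'0 : 0 < k' by rewrite divr_gt0// mulr_gt0.
exists T, k'; split=> // Q Qi; have [uQ Q0 _] := Qi.
set B := mxop a Q Q.
have uB : B \in unitmx.
  apply: unitmx_inj => y By; have := HC Q uQ y; rewrite -/B By.
  rewrite [X in _ <= _ * X]big1 ?mulr0 => [H|j _]; last by rewrite mxE expr0n.
  apply/matrixP => j o; rewrite (ord1 o) mxE; apply/eqP; rewrite -sqrf_eq0; apply/eqP/le_anti.
  rewrite sqr_ge0 andbT; apply: le_trans H.
  by rewrite (bigD1 j)//= lerDl; apply: sumr_ge0 => l _; exact: sqr_ge0.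
have dB : \det B != 0 by rewrite -unitfE -unitmxE.
have BZ i j : B i j \is a Num.int.
  rewrite mxE; apply: intlist_lop => // p _.
  by rewrite /dlt; case: eqP.
have [I [cl [rep [-> repK clE]]]] := lattice_index_real BZ dB.
have [s [sP ssep]] := Nsep_has (solution a) Q e.
pose x i : 'cV[R]_(size Q) := \col_j frac (s i (nth 1%g Q j)).
pose u i : 'cV[int]_(size Q) := \col_j round ((B *m x i) j 0).
pose b i := B *m x i - map_mx intr (u i).
have bE i j : b i j 0 = (B *m x i) j 0 - (round ((B *m x i) j 0))%:~R.
  by rewrite mxE [X in _ + X]mxE; congr (_ - _); rewrite [in LHS]mxE [in LHS]mxE.
have b2 i j : `|b i j 0| <= 2^-1 by rewrite bE; exact: round_le.
pose out q := has (fun t => (q * t)%g \notin Q) T.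
have bin_ i (j : 'I_(size Q)) : ~~ out (nth 1%g Q j) -> b i j 0 = 0.
  move=> /hasPn H; have : (B *m x i) j 0 \is a Num.int.
    rewrite -mxop_vec (@eq_in_lop _ _ _ _ (fun c => frac (s i c))).
      exact: (solution_frac aZ (sP i)).
    move=> p pa; have := H p.2; rewrite map_f// => /(_ isT); rewrite negbK => qQ.
    have qs : (index (nth 1%g Q j * p.2)%g Q < size Q)%N by rewrite index_mem.
    by rewrite -{1}(nth_index 1%g qQ) (vecf_nth _ (Ordinal qs))// mxE /= nth_index.
  move=> bZ; apply: int_small; last by apply: le_lt_trans (b2 i j) _; rewrite invf_lt1// ltr1n.
  by rewrite bE rpredB// intr_int.
have bsum i i' : \sum_j (b i - b i') j 0 ^+ 2 <= (size T)%:R * k' * (size Q)%:R.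
  apply: (@le_trans _ _ (count out Q)%:R); last first.
    have := count_neighbourhood pred0 (ltW k'0) Qi.
    rewrite count_pred0 addr0 mulrA; apply: le_trans; rewrite ler_nat.
    by apply: sub_count => q; apply: sub_has => t /=; rewrite orbF.
  rewrite count_ord -sum1_card natr_sum [leRHS]big_mkcond; apply: ler_sum => j _.
  have -> : (b i - b i') j 0 = b i j 0 - b i' j 0 by rewrite mxE [X in _ + X]mxE.
  rewrite inE; case: ifPn => [_|nj]; last by rewrite !bin_// subr0 expr0n.
  rewrite -real_normK ?num_real// expr_le1//.
  apply: le_trans (ler_normB _ _) _; have := b2 i j; have := b2 i' j; lra.
rewrite -[X in X%:R <= _]card_ord; apply: (card_fibers (phi := fun i => cl (u i))) => l.
have [->|[i0]] := set_0Vmem [set i | cl (u i) == l]%SET; first by rewrite cards0 expR_ge0.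
rewrite inE => /eqP E0.
apply: (Hk _ _ Q s (s i0)) => [i j _ _|i]; first exact: ssep.
rewrite inE => /eqP E; have /clE[z Ez] := etrans E (esym E0).
pose w := x i - x i0 - map_mx intr z.
have Bw : B *m w = b i - b i0.
  rewrite /w !mulmxBr -Ez /b; apply/matrixP => j o; rewrite !mxE; ring.
have wsum : \sum_j w j 0 ^+ 2 <= k * (e / 2) ^+ 2 * (size Q)%:R.
  apply: le_trans (HC Q uQ w) _; rewrite -/B Bw.
  apply: le_trans (ler_wpM2l (ltW C0) (bsum i i0)) _.
  have -> : k * (e / 2) ^+ 2 = C * s1 * k' by rewrite /k' [RHS]mulrC divfK// gt_eqF// mulr_gt0.
  rewrite -!(mulrA C) ler_wpM2l ?(ltW C0)// ler_wpM2r// ler_wpM2r ?(ltW k'0)//.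
  by rewrite ler_nat.
(* Chebyshev: each coordinate that is not [e / 2]-near contributes at least [(e / 2)^2] to
   [wsum]. *)
rewrite -(ler_pM2r e4) mulrAC; apply: le_trans wsum.
rewrite /far count_ord -sum1_card natr_sum mulr_suml big_mkcond; apply: ler_sum => j _.
rewrite inE mul1r; case: ifPn => [nj|_]; last exact: sqr_ge0.
rewrite -[leRHS]real_normK ?num_real// lerXn2r ?nnegrE//; first by rewrite divr_ge0// ltW.
rewrite leNgt; apply: contra nj => wj; apply/asboolP.
have wE : w j 0 = frac (s i (nth 1%g Q j)) - frac (s i0 (nth 1%g Q j)) - (z j 0)%:~R.
  by rewrite mxE [X in _ + X]mxE [in X in _ - X]mxE mxE [X in _ + X - _]mxE mxE mxE.
have : nearZ (e / 2) (frac (s i (nth 1%g Q j)) - frac (s i0 (nth 1%g Q j))).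
  by exists (z j 0); rewrite -wE ltW.
have -> : frac (s i (nth 1%g Q j)) - frac (s i0 (nth 1%g Q j)) =
  (s i (nth 1%g Q j) - s i0 (nth 1%g Q j)) +
   ((frac (s i (nth 1%g Q j)) - s i (nth 1%g Q j)) - (frac (s i0 (nth 1%g Q j)) - s i0 (nth 1%g Q j))) by ring.
by rewrite nearZ_add_int// rpredB ?frac_int.
Qed.

End DeterminantBounds.

(** * Growth of principal minors *)

Section PrincipalMinors.
Variables (R : realType) (G : groupType) (a : seq (R * G)).
Implicit Types (x y : G -> R) (s Q T C : seq G) (c d : G).

Hypothesis a_sym : forall x c, lop (lstar a) x c = lop a x c.
Hypothesis a_pos : forall s (y : 'cV[R]_(size s)), uniq s -> y != 0 ->
  0 < (y^T *m mxop a s s *m y) 0 0.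
Hypothesis aZ : intlist a.

Definition minor s : R := \det (mxop a s s).

Lemma mxop_sym s : (mxop a s s)^T = mxop a s s.
Proof. by rewrite trmx_mxop; apply/matrixP => i j; rewrite !mxE a_sym. Qed.

Lemma mxop_unit s : uniq s -> mxop a s s \in unitmx.
Proof.
move=> us; apply: unitmx_inj => y Ay; apply/eqP; apply: contraT => /(a_pos us).
by rewrite -mulmxA Ay mulmx0 mxE ltxx.
Qed.

Lemma minor_mxw m s : size s = m -> minor s = \det (mxw a (fun i : 'I_m => nth 1%g s i) (fun i : 'I_m => nth 1%g s i)).
Proof. by move=> <-. Qed.

Lemma minor_perm s s' : perm_eq s s' -> minor s = minor s'.
Proof.
move=> /(@tuple_permP _ _ s (in_tuple s'))[p ->].
rewrite (minor_mxw (size_tuple _)) (minor_mxw (erefl (size s'))).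
set w := fun i : 'I_(size s') => nth 1%g s' i.
have -> : mxw a (fun i => nth 1%g [tuple tnth (in_tuple s') (p i) | i < size s'] i)
    (fun i => nth 1%g [tuple tnth (in_tuple s') (p i) | i < size s'] i) =
    row_perm p (col_perm p (mxw a w w)).
  apply/matrixP => i j; rewrite !mxE -!tnth_nth !tnth_mktuple !(tnth_nth 1%g).
  by rewrite /w.
rewrite row_permE col_permE !det_mulmx !det_perm odd_permV mulrCA -signr_addb addbb mulr1.
by [].
Qed.

Lemma minor_translate c s : minor [seq (c * d)%g | d <- s] = minor s.
Proof.
rewrite (minor_mxw (size_map _ _)) (minor_mxw (erefl (size s))).
congr (\det _); apply/matrixP => i j; rewrite !mxE !(nth_map 1%g)//.
rewrite lop_dlt_translate [RHS]lop_dlt_translate; congr (lop _ _ _).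
by rewrite invgM -mulgA mulKg.
Qed.

(** The Schur complement of [s] in [c0 :: s]. By [form_schur] it is the minimum of the quadratic
    form over functions supported in [c0 :: s] with value 1 at [c0]. *)
Definition schur c0 s : R :=
  mxop a [:: c0] [:: c0] 0 0 - ((mxop a s [:: c0])^T *m invmx (mxop a s s) *m mxop a s [:: c0]) 0 0.

Lemma mxop_cons c0 s : mxop a (c0 :: s) (c0 :: s) =
  block_mx (mxop a [:: c0] [:: c0]) (mxop a s [:: c0])^T (mxop a s [:: c0]) (mxop a s s)
    :> 'M[R]_(1 + size s).
Proof.
rewrite -[LHS](@submxK R 1 (size s) 1 (size s)); congr block_mx; apply/matrixP => i j; rewrite !mxE ?(ord1 i) ?(ord1 j) //=.
by rewrite lop_dltC a_sym.
Qed.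

Lemma minor_cons c0 s : uniq s -> minor (c0 :: s) = schur c0 s * minor s.
Proof.
move=> us; have := det_schur (mxop a [:: c0] [:: c0]) (mxop a s [:: c0])^T (mxop a s [:: c0]) (mxop_unit us).
rewrite -mxop_cons /minor /schur => ->; congr (_ * _).
by rewrite mxE [X in _ + X]mxE.
Qed.

Definition form s x := \sum_(c <- s) x c * lop a x c.

Lemma formE s (y : 'cV[R]_(size s)) : uniq s -> form s (vecf y) = (y^T *m mxop a s s *m y) 0 0.
Proof.
move=> us; rewrite /form sum_seq_ord -mulmxA mxE; apply: eq_bigr => i _.
by rewrite vecf_nth// mxop_vec [y^T _ _]mxE.
Qed.

Lemma form_sub s s' x : uniq s -> uniq s' -> {subset s <= s'} -> (forall c, c \notin s -> x c = 0) ->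
  form s' x = form s x.
Proof.
move=> us us' ss' xs; rewrite /form (bigID (mem s)) /= [X in _ + X]big1 ?addr0; last first.
  by move=> c /xs ->; rewrite mul0r.
rewrite -big_filter; apply: perm_big; apply: uniq_perm; rewrite ?filter_uniq// => c.
by rewrite mem_filter; apply/andP/idP => [[]//|cs]; split=> //; exact: ss'.
Qed.

Lemma block_form n (A0 : 'M[R]_1) (v : 'cV[R]_n) (A : 'M[R]_n) (y : 'cV[R]_n) :
  ((col_mx 1%:M y)^T *m block_mx A0 v^T v A *m col_mx 1%:M y) 0 0 =
  A0 0 0 + (v^T *m y) 0 0 + (y^T *m v) 0 0 + (y^T *m A *m y) 0 0.
Proof.
rewrite tr_col_mx mul_row_block mul_row_col trmx1 !mul1mx mulmx1 mulmxDl.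
rewrite [LHS]mxE [X in X + _]mxE [X in _ + X]mxE; ring.
Qed.

Lemma form_schur c0 s (y : 'cV[R]_(size s)) : uniq (c0 :: s) ->
  form (c0 :: s) (@vecf R G (c0 :: s) (col_mx 1%:M y)) = schur c0 s +
   (let w := y + invmx (mxop a s s) *m mxop a s [:: c0] in (w^T *m mxop a s s *m w) 0 0).
Proof.
move=> uxs; have /andP[_ us] := uxs; rewrite formE// mxop_cons.
have uA := mxop_unit us.
set A := mxop a s s in uA *; set v := mxop a s [:: c0]; set A0 := mxop a [:: c0] [:: c0].
have At : A^T = A := mxop_sym s.
apply: (etrans (block_form _ _ _ _)); cbv zeta.
have -> : (y + invmx A *m v)^T *m A *m (y + invmx A *m v) =
   y^T *m A *m y + y^T *m v + v^T *m y + v^T *m invmx A *m v.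
  have -> : (y + invmx A *m v)^T = y^T + v^T *m invmx A.
    by rewrite -{2}At -trmx_inv -trmx_mul; apply/matrixP => i j; rewrite !mxE.
  rewrite !mulmxDl !mulmxDr.
  by rewrite -!mulmxA !(mulmxA A) mulmxV// mul1mx !mulmxA mulmxKV// -!addrA.
rewrite /schur -/A -/v -/A0; set W := v^T *m invmx A *m v.
have S (M1 M2 M3 M4 : 'M[R]_1) : (M1 + M2 + M3 + M4) 0 0 = M1 0 0 + M2 0 0 + M3 0 0 + M4 0 0.
  by rewrite !mxE.
rewrite S; ring.
Qed.

Lemma col_mx_head n (y : 'cV[R]_n) : (col_mx 1%:M y : 'cV[R]_(1 + n)) ord0 0 = 1.
Proof.
have -> : ord0 = lshift n (0 : 'I_1) :> 'I_(1 + n) by exact: val_inj.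
by rewrite col_mxEu mxE eqxx.
Qed.

(** The minimiser for [s] is one of the competitors for the larger set [s']. *)
Lemma schur_mono c0 s s' : uniq (c0 :: s) -> uniq (c0 :: s') -> {subset s <= s'} ->
  schur c0 s' <= schur c0 s.
Proof.
move=> us us' ss'.
pose x := @vecf R G (c0 :: s) (col_mx 1%:M (- (invmx (mxop a s s) *m mxop a s [:: c0]))).
have xE : form (c0 :: s) x = schur c0 s.
  by rewrite /x form_schur// /= addNr mulmx0 mxE addr0.
have xs c : c \notin c0 :: s -> x c = 0 by exact: vecf_out.
have ss : {subset c0 :: s <= c0 :: s'}.
  by move=> c; rewrite !inE => /predU1P[->|/ss' ->]; rewrite ?eqxx ?orbT.
rewrite -xE -(form_sub us us' ss xs).
pose y : 'cV[R]_(size s') := \col_j x (nth 1%g s' j).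
have x1 : x c0 = 1.
  have := @vecf_nth R G (c0 :: s) (col_mx 1%:M (- (invmx (mxop a s s) *m mxop a s [:: c0]))) ord0 us.
  rewrite -/x /= => ->; exact: col_mx_head.
have -> : form (c0 :: s') x = form (c0 :: s') (@vecf R G (c0 :: s') (col_mx 1%:M y)).
  have E c : x c = @vecf R G (c0 :: s') (col_mx 1%:M y) c.
    have [cs|cs] := boolP (c \in c0 :: s'); last first.
      rewrite xs ?vecf_out//; apply: contra cs; exact: ss.
    have iS : (index c (c0 :: s') < size (c0 :: s'))%N by rewrite index_mem.
    rewrite -[c in RHS](nth_index 1%g cs) (vecf_nth _ (Ordinal iS))//.
    move: iS; rewrite [index c _]/=; case: eqP => [<- iS|ne iS].
      rewrite x1 (_ : Ordinal iS = lshift (size s') (ord0 : 'I_1)); last exact: val_inj.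
      by rewrite (@col_mxEu R 1 (size s') 1) mxE eqxx.
    have jS : (index c s' < size s')%N by [].
    rewrite (_ : Ordinal iS = rshift 1 (Ordinal jS)); last exact: val_inj.
    rewrite (@col_mxEd R 1 (size s') 1) mxE /= nth_index//.
    by move: cs; rewrite inE => /predU1P[E|//]; rewrite E in ne.
  by rewrite /form; apply: eq_bigr => c _; rewrite E (eq_lop a E).
rewrite form_schur//= lerDl.
have /andP[_ us2] := us'.
set w := y + _; have [->|w0] := eqVneq w 0; first by rewrite mulmx0 mxE.
exact/ltW/a_pos.
Qed.

Lemma schur_gt0 c0 s : uniq (c0 :: s) -> 0 < schur c0 s.
Proof.
move=> us; have := form_schur (- (invmx (mxop a s s) *m mxop a s [:: c0])) us.
rewrite /= addNr mulmx0 mxE addr0 => <-; rewrite formE//; apply: a_pos => //.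
apply/eqP => /matrixP /(_ ord0 0); rewrite [RHS]mxE => /(etrans (esym (col_mx_head _))).
by move/eqP; rewrite oner_eq0.
Qed.

Lemma minor_gt0 s : uniq s -> 0 < minor s.
Proof.
elim: s => [|c0 s IHs] us; first by rewrite /minor det_mx00.
have /andP[_ us'] := us.
by rewrite minor_cons// mulr_gt0 ?schur_gt0 ?IHs.
Qed.

(** A positive integer is at least 1. This keeps [lminor] nonnegative. *)
Lemma minor_ge1 s : uniq s -> 1 <= minor s.
Proof.
move=> us; have : minor s \is a Num.int.
  apply: rpred_sum => p _; rewrite rpredM ?rpredX ?rpredN1//; apply: rpred_prod => i _.
  by rewrite !mxE; apply: intlist_lop => // q _; rewrite /dlt; case: eqP.
move=> /intrP[n nE]; have := minor_gt0 us; rewrite nE ltr0z => n0.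
by rewrite -[1]/(1%:~R) ler_int.
Qed.

Definition lminor s := ln (minor s).

Lemma lminor_ge0 s : uniq s -> 0 <= lminor s.
Proof. by move=> us; rewrite ln_ge0// minor_ge1. Qed.

Lemma lminor_cons c0 s : uniq (c0 :: s) -> lminor (c0 :: s) = ln (schur c0 s) + lminor s.
Proof.
move=> us; have /andP[_ us'] := us.
by rewrite /lminor minor_cons// lnM ?posrE ?schur_gt0 ?minor_gt0.
Qed.

Lemma lminor_le : exists2 K : R, 0 < K & forall s, uniq s -> lminor s <= K * (size s)%:R.
Proof.
pose k := schur 1%g [::]; exists (Num.max 1 (ln k)); first by rewrite lt_max ltr01.
elim=> [|c0 s IHs] us; first by rewrite mulr0 /lminor /minor det_mx00 ln1.
have /andP[_ us'] := us.
rewrite lminor_cons// -natr1 mulrDr mulr1 addrC lerD ?IHs//.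
have uc0 : uniq [:: c0] by [].
apply: (@le_trans _ _ (ln (schur c0 [::]))).
  by rewrite ler_ln ?posrE ?schur_gt0//; apply: schur_mono.
have E : minor [:: c0] = minor [:: 1%g].
  by have := minor_translate c0 [:: 1%g]; rewrite /= mulg1.
rewrite !minor_cons// /minor det_mx00 !mulr1 in E.
by rewrite E le_max lexx orbT.
Qed.

(** Add the points of [s] one by one. A new point [c0] lies in exactly [size T] of the translates,
    and in each of them its increment is at least [ln (schur c0 s)] by [schur_mono]. *)
Lemma shearer T C s : uniq T -> uniq C -> uniq s ->
  (forall c t, c \in s -> t \in T -> (c * t^-1)%g \in C) ->
  (size T)%:R * lminor s <= \sum_(c <- C) lminor [seq q <- s | q \in [seq (c * t)%g | t <- T]].
Proof.
move=> uT uC; elim: s => [|c0 s IHs] us sC.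
  by rewrite /= big1 ?mulr0// => [|c _]; rewrite /lminor /minor det_mx00 ln1 ?mulr0.
have /andP[c0s us'] := us.
rewrite lminor_cons// mulrDr.
apply: (@le_trans _ _ (\sum_(c <- C) ((if c0 \in [seq (c * t)%g | t <- T] then ln (schur c0 s) else 0) +
   lminor [seq q <- s | q \in [seq (c * t)%g | t <- T]]))).
  rewrite big_split /= lerD ?IHs//; last by move=> c t cs; apply: sC; rewrite inE cs orbT.
  rewrite -big_mkcond big_const_seq iter_addr_0 -(mulr_natl (ln _)).
  suff -> : count (fun c => c0 \in [seq (c * t)%g | t <- T]) C = size T by [].
  rewrite -size_filter -(size_map (fun t => (c0 * t^-1)%g) T); apply: perm_size; apply: uniq_perm.
  - by rewrite filter_uniq.
  - by rewrite map_inj_uniq// => t t' /mulgI /invg_inj.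
  move=> c; rewrite mem_filter; apply/andP/mapP => [[/mapP[t tT E] _]|[t tT ->]].
    by exists t => //; rewrite E mulgK.
  by split; [apply/mapP; exists t => //; rewrite mulgKV|apply: sC; rewrite ?mem_head].
apply: ler_sum => c _ /=; case: ifPn => [xc|_]; last by rewrite add0r.
have uf : uniq (c0 :: [seq q <- s | q \in [seq (c * t)%g | t <- T]]).
  by rewrite /= filter_uniq// andbT mem_filter negb_and c0s orbT.
rewrite lminor_cons// lerD2r ler_ln ?posrE ?schur_gt0//; apply: schur_mono => //.
by move=> q; rewrite mem_filter => /andP[].
Qed.

(* The translates of T meeting a window cover it uniformly, and almost all of
   them are contained in it. *)
Lemma lminor_window T (e : R) : uniq T -> T != [::] -> 0 < e ->
  windows R (fun Q => (size T)%:R * lminor Q <= (lminor T + e) * (size Q)%:R).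
Proof.
move=> uT T0 e0; have [K K0 HK] := lminor_le.
pose A := [seq (t^-1 * t')%g | t <- T, t' <- T].
pose n : R := (size T)%:R; pose m : R := (size A)%:R.
pose k := e / (n * K * n * m + 1).
have nm0 : 0 <= n * K * n * m by rewrite !mulr_ge0// ltW.
have k0 : 0 < k by rewrite divr_gt0// ltr_wpDl.
exists A, k; split=> // Q Qi; have [uQ Q0 _] := Qi.
pose C : seq G := undup [seq (q * t^-1)%g | q <- Q, t <- T].
have uC : uniq C := undup_uniq _.
have HC c t : c \in Q -> t \in T -> (c * t^-1)%g \in C.
  by move=> cQ tT; rewrite mem_undup; apply/allpairsP; exists (c, t).
apply: le_trans (shearer uT uC uQ HC) _.
pose ct c := [seq (c * t)%g | t <- T].
have uct c : uniq (ct c) by rewrite map_inj_uniq// => t t' /mulgI.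
pose inside c := all (mem Q) (ct c).
rewrite (bigID inside) /= mulrDl; apply: lerD.
  apply: (@le_trans _ _ (\sum_(c <- C | inside c) lminor T)).
    rewrite le_eqVlt; apply/orP; left; apply/eqP; apply: eq_bigr => c /allP ic.
    rewrite -[lminor T]/(ln _) -(minor_translate c T); congr ln; apply: minor_perm.
    apply: uniq_perm; rewrite ?filter_uniq//; first exact: uct.
    by move=> q; rewrite mem_filter; apply/andP/idP => [[]//|qc]; split=> //; exact: ic.
  rewrite big_const_seq iter_addr_0 -(mulr_natr (lminor T)) ler_wpM2l ?lminor_ge0// ler_nat.
  have [t tT] : exists t, t \in T by case: (T) T0 => // t T' _; exists t; rewrite mem_head.
  rewrite -size_filter -(size_map (fun c => (c * t)%g) [seq x <- C | inside x]); apply: uniq_leq_size.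
    by rewrite map_inj_uniq ?filter_uniq// => c d /mulIg.
  move=> _ /mapP[c + ->]; rewrite mem_filter => /andP[/allP ic _].
  by apply: ic; exact: map_f.
apply: (@le_trans _ _ (\sum_(c <- C | ~~ inside c) K * n)).
  apply: ler_sum => c _; apply: le_trans (HK _ (filter_uniq _ uQ)) _.
  rewrite ler_wpM2l ?(ltW K0)// ler_nat -(size_map (fun t => (c * t)%g) T).
  by apply: uniq_leq_size; rewrite ?filter_uniq// => q; rewrite mem_filter => /andP[].
rewrite big_const_seq iter_addr_0 -(mulr_natr (K * n)).
have cb : (count (fun c => ~~ inside c) C)%:R <= n * (m * (k * (size Q)%:R)).
  apply: (@le_trans _ _ ((size T)%:R * (count (fun q => has (fun t => (q * t)%g \notin Q) A) Q)%:R)).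
    rewrite -natrM ler_nat -!size_filter mulnC -(size_allpairs (fun q t => (q * t^-1)%g)).
    apply: uniq_leq_size; first by rewrite filter_uniq.
    move=> c; rewrite mem_filter mem_undup => /andP[/allPn[d /mapP[t' t'T ->] dQ] /allpairsP[[q t] [/= qQ tT E]]].
    apply/allpairsP; exists (q, t); split=> //=; rewrite mem_filter qQ andbT.
    apply/hasP; exists (t^-1 * t')%g; first by apply/allpairsP; exists (t, t').
    by rewrite mulgA -E.
  rewrite ler_wpM2l//.
  have := count_neighbourhood pred0 (ltW k0) Qi.
  rewrite count_pred0 addr0; apply: le_trans; rewrite ler_nat.
  by apply: sub_count => q; apply: sub_has => t /=; rewrite orbF.
apply: (@le_trans _ _ (K * n * (n * (m * (k * (size Q)%:R))))).
  by rewrite ler_wpM2l// mulr_ge0// ltW.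
have -> : K * n * (n * (m * (k * (size Q)%:R))) = n * K * n * m * k * (size Q)%:R by ring.
rewrite ler_wpM2r// /k mulrA ler_pdivrMr ?ltr_wpDl// mulrC ler_wpM2l ?(ltW e0)//.
by rewrite lerDl.
Qed.

(** The limit is the infimum of [lminor T / size T] over all nonempty finite sets. It bounds every
    window from below, and [lminor_window] for a nearly optimal [T] bounds large windows from
    above. *)
Lemma lminor_cvg : exists2 l : R, 0 <= l & forall e, 0 < e ->
  windows R (fun Q => `|lminor Q - l * (size Q)%:R| <= e * (size Q)%:R).
Proof.
pose S := [set x : R | exists T, [/\ uniq T, T != [::] & x = lminor T / (size T)%:R]].
have S0 : S !=set0 by exists (lminor [:: 1%g] / 1), [:: 1%g].
have Sge (t : R) : S t -> 0 <= t by move=> [T [uT _ ->]]; rewrite divr_ge0// lminor_ge0.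
have infS : has_inf S by split=> //; exists 0 => t /Sge.
exists (inf S); first by apply: lb_le_inf => // t /Sge.
move=> e e0; have e2 : 0 < e / 2 by rewrite divr_gt0.
have [_ [T [uT T0 ->]] HT] := inf_adherent e2 infS.
have n0 : 0 < (size T)%:R :> R by rewrite ltr0n lt0n size_eq0.
have ne : 0 < e / 2 * (size T)%:R by rewrite mulr_gt0.
apply: filterS2 (lminor_window uT T0 ne) (near_invariant [::] (@ltr01 R)) => Q HQ [uQ Q0 _].
have m0 : 0 < (size Q)%:R :> R by rewrite ltr0n lt0n size_eq0.
have h1 : inf S <= lminor Q / (size Q)%:R by apply: inf_lbound; [exact: infS.2|exists Q].
rewrite ler_pdivlMr// in h1.
rewrite ger0_norm ?subr_ge0// lerBlDr -mulrDl -(ler_pM2l n0).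
apply: le_trans HQ _; rewrite mulrA ler_wpM2r//.
rewrite ltr_pdivrMr// in HT.
by rewrite mulrC; lra.
Qed.

End PrincipalMinors.

(** * Exponential growth rates *)

Section Growth.
Variables (R : realType) (G : groupType).
Implicit Types (a b f g : seq (R * G)) (x : G -> R) (Q T s : seq G) (c : G).

(** One term of the expansion of [(1 + t)^(m + n)], with [t] fixed small. It makes the loss in
    [exists_large_minor] subexponential. *)
Lemma binomial_small (d : R) : 0 < d -> exists2 k : R, 0 < k &
  forall m n : nat, n%:R <= k * m%:R -> 'C(m + n, m)%:R <= expR (d * m%:R).
Proof.
move=> d0; pose t := Num.min 1 (d / 4).
have t0 : 0 < t by rewrite lt_min ltr01 divr_gt0.
have t1 : t <= 1 by rewrite ge_min lexx.
have td : t <= d / 4 by rewrite ge_min lexx orbT.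
have lt0 : ln t <= 0 by rewrite ln_le0.
have u0 : 0 < 1 - ln t by lra.
pose k := Num.min 1 (d / 2 / (1 - ln t)).
have k0 : 0 < k by rewrite lt_min ltr01 !divr_gt0.
exists k => // m n nk.
have n1 : n%:R <= m%:R :> R.
  by apply: le_trans nk _; rewrite ler_piMl// ge_min lexx.
have n2 : n%:R * (1 - ln t) <= d / 2 * m%:R.
  rewrite -ler_pdivlMr// mulrAC; apply: le_trans nk _; rewrite ler_wpM2r//.
  by rewrite ge_min lexx orbT.
have h1 : 'C(m + n, m)%:R * t ^+ n <= (1 + t) ^+ (m + n).
  have nm : (n < (m + n).+1)%N by rewrite ltnS leq_addl.
  rewrite exprDn (bigD1 (Ordinal nm))//= expr1n mul1r.
  have -> : 'C(m + n, n) = 'C(m + n, m) by rewrite -(bin_sub (leq_addl m n)) addnK.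
  rewrite -(mulr_natl (t ^+ n)) lerDl.
  by apply: sumr_ge0 => i _; rewrite mulrn_wge0// mulr_ge0 ?exprn_ge0 ?ler01// ltW.
have h2 : (1 + t) ^+ (m + n) <= expR (d / 2 * m%:R).
  apply: (@le_trans _ _ (expR (t * (m + n)%:R))).
    rewrite expRM_natr; apply: lerXn2r; rewrite ?nnegrE ?expR_ge0 ?expR_ge1Dx//.
    by rewrite addr_ge0 ?ler01// ltW.
  rewrite ler_expR natrD; apply: (@le_trans _ _ (d / 4 * (m%:R + n%:R))).
    by rewrite ler_wpM2r// addr_ge0.
  have := ler_wpM2l (ltW (divr_gt0 d0 (ltr0n R 4))) n1; lra.
have h3 : (t ^+ n)^-1 <= expR (d / 2 * m%:R).
  rewrite -(lnK t0) -expRM_natr -expRN ler_expR.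
  have : 0 <= n%:R :> R by []; nra.
have tn : 0 < t ^+ n by rewrite exprn_gt0.
rewrite -[leLHS](mulfK (lt0r_neq0 tn)).
have -> : d * m%:R = d / 2 * m%:R + d / 2 * m%:R by field.
rewrite expRD; apply: ler_pM => //.
- by rewrite mulr_ge0// ltW.
- by rewrite invr_ge0 ltW.
- exact: le_trans h1 h2.
Qed.

(** The upper bound is asked at every scale, the lower one at a single scale. As [Nsep] increases
    when [e] decreases, the rate is then [l] at all scales below [e0]. *)
Definition growth a (l : R) :=
  (forall e d, 0 < e -> 0 < d ->
     windows R (fun Q => (Nsep (solution a) Q e)%:R <= expR ((l + d) * (size Q)%:R))) /\
  exists2 e0 : R, 0 < e0 & forall d, 0 < d ->
     windows R (fun Q => expR ((l - d) * (size Q)%:R) <= (Nsep (solution a) Q e0)%:R).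

Lemma eq_growth a b l : (forall x c, lop a x c = lop b x c) -> growth a l -> growth b l.
Proof.
move=> ab; rewrite /growth; suff -> : solution a = solution b by [].
by apply/funext => x; apply/propext; split=> H c; [rewrite -ab|rewrite ab].
Qed.

Lemma growth_mul f g l l' : intlist f -> intlist g -> left_inv g -> left_inv (lstar g) ->
  growth f l -> growth g l' -> growth (lmul f g) (l + l').
Proof.
move=> fZ gZ gi gi' [fu [ef ef0 fl]] [gu [eg eg0 gl]]; split=> [e d e0 d0|].
  have d3 : 0 < d / 3 by rewrite divr_gt0.
  have e8 : 0 < e / 8 by rewrite divr_gt0.
  have [e1 e10 H] := Nsep_mul_le fZ gZ gi gi' e0 d3.
  apply: filterS3 H (fu _ _ e10 d3) (gu _ _ e8 d3) => Q h1 h2 h3.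
  apply: le_trans h1 _; apply: le_trans (ler_wpM2r (expR_ge0 _) (ler_pM _ _ h2 h3)) _ => //.
  by rewrite -!expRD ler_expR -!mulrDl ler_wpM2r//; lra.
pose e := Num.min ef eg; have e0 : 0 < e by rewrite lt_min ef0.
have [e1 e10 H1] := Nsep_mul_ge fZ gZ gi' e0.
exists e1 => // d d0; have d3 : 0 < d / 3 by rewrite divr_gt0.
apply: filterS3 (H1 _ d3) (fl _ d3) (gl _ d3) => Q h1 h2 h3.
have h4 : expR ((l - d / 3) * (size Q)%:R) <= (Nsep (solution f) Q e)%:R.
  by apply: le_trans h2 _; rewrite ler_nat Nsep_le// ge_min lexx.
have h5 : expR ((l' - d / 3) * (size Q)%:R) <= (Nsep (solution g) Q e)%:R.
  by apply: le_trans h3 _; rewrite ler_nat Nsep_le// ge_min lexx orbT.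
rewrite -(ler_pM2r (expR_gt0 (d / 3 * (size Q)%:R))); apply: le_trans h1.
apply: le_trans (ler_pM (expR_ge0 _) (expR_ge0 _) h4 h5).
by rewrite -!expRD ler_expR -!mulrDl ler_wpM2r//; lra.
Qed.

(* The determinant of the compression of f f^* to a window is a Gram determinant.
   Up to a subexponential factor it is the square of a square minor of f^*, whose
   transpose is a minor of f; this bounds the counts for f and f^* from below,
   while their product is bounded above by the count for f f^*. *)
Lemma growth_star f : intlist f -> left_inv f -> left_inv (lstar f) ->
  exists l, [/\ 0 <= l, growth f l & growth (lstar f) l].
Proof.
move=> fZ fi fi'; pose fs := lstar f; pose a := lmul f fs.
have fsZ : intlist fs by rewrite intlist_star.
have aZ : intlist a by exact: intlist_mul.
have a_sym x c : lop (lstar a) x c = lop a x c by rewrite /a lop_star_mul /fs lstarK.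
pose w s := s ++ [seq c <- wmul s (sinv fs) | c \notin s].
have uw s : uniq s -> uniq (w s).
  move=> us; rewrite cat_uniq us filter_uniq ?undup_uniq// andbT /=.
  by apply/hasPn => c; rewrite mem_filter => /andP[].
have sw s : {subset wmul s (sinv fs) <= w s}.
  by move=> c cs; rewrite mem_cat mem_filter cs andbT; case: (_ \in _).
have aE s : uniq s -> mxop a s s = (mxop fs (w s) s)^T *m mxop fs (w s) s.
  by move=> us; rewrite (mxop_mul _ _ (uw s us) (@sw s)) trmx_mxop /fs lstarK.
have [C C0 HC] := mxop_lower fi'.
have formE s (y : 'cV[R]_(size s)) : uniq s ->
    (y^T *m mxop a s s *m y) 0 0 = \sum_i (mxop fs (w s) s *m y) i 0 ^+ 2.
  by move=> us; rewrite aE// sum_sqr_mx trmx_mul !mulmxA.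
have HC' s (y : 'cV[R]_(size s)) : uniq s ->
    \sum_j y j 0 ^+ 2 <= C * (y^T *m mxop a s s *m y) 0 0.
  by move=> us; rewrite formE//; exact: HC (uw s us) (@sw s).
have y2 n (y : 'cV[R]_n) : y != 0 -> 0 < \sum_j y j 0 ^+ 2.
  move=> y0; rewrite lt_def sumr_ge0 ?andbT => [|j _]; last exact: sqr_ge0.
  apply: contraNneq y0 => /eqP; rewrite psumr_eq0 => [/allP H|j _]; last exact: sqr_ge0.
  apply/eqP/matrixP => j o; rewrite (ord1 o) mxE; apply/eqP.
  by have := H j; rewrite mem_index_enum sqrf_eq0 => /(_ isT).
have a_pos s (y : 'cV[R]_(size s)) : uniq s -> y != 0 -> 0 < (y^T *m mxop a s s *m y) 0 0.
  move=> us y0; rewrite -(ltr_pM2l C0) mulr0.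
  exact: lt_le_trans (y2 _ _ y0) (HC' _ _ us).
have C20 : 0 < C ^+ 2 by rewrite exprn_gt0.
(* Coercivity of the form gives a lower bound for the matrix by
   [2 C y (A y) <= y^2 + C^2 (A y)^2]. *)
have HC2 Q : uniq Q -> forall y : 'cV[R]_(size Q),
    \sum_j y j 0 ^+ 2 <= C ^+ 2 * \sum_j (mxop a Q Q *m y) j 0 ^+ 2.
  move=> uQ y; have := HC' _ y uQ; rewrite -mulmxA [(_ *m _) 0 0]mxE.
  set A := mxop a Q Q; set Y := \sum_j y j 0 ^+ 2 => h.
  have : C * \sum_j y^T 0 j * (A *m y) j 0 <= 2^-1 * Y + 2^-1 * (C ^+ 2 * \sum_j (A *m y) j 0 ^+ 2).
    rewrite /Y !mulr_sumr -big_split; apply: ler_sum => j _ /=; rewrite [y^T _ _]mxE.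
    by have := sqr_ge0 (y j 0 - C * (A *m y) j 0); nra.
  lra.
have [l0 l00 Hl] := lminor_cvg a_sym a_pos aZ.
have minorE Q : uniq Q -> minor a Q = expR (lminor a Q).
  by move=> uQ; rewrite /lminor lnK// posrE minor_gt0.
have upper e d : 0 < e -> 0 < d ->
    windows R (fun Q => (Nsep (solution a) Q e)%:R <= expR ((l0 + d) * (size Q)%:R)).
  move=> e0 d0; have d2 : 0 < d / 2 by rewrite divr_gt0.
  apply: filterS3 (Nsep_le_det aZ C20 HC2 e0 d2) (Hl _ d2) (near_invariant [::] (@ltr01 R)).
  move=> Q h1 h2 [uQ _ _]; apply: le_trans h1 _.
  rewrite -/(minor a Q) gtr0_norm ?minor_gt0// minorE// -expRD ler_expR.
  by move: h2; rewrite ler_norml => /andP[_]; lra.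
have [ef ef0 Hf] := det_le_Nsep fZ fi fi'.
have [eg eg0 Hg] : exists2 e0 : R, 0 < e0 & forall d, 0 < d -> exists2 k : R, 0 < k &
  windows R (fun Q => forall w1 w2 : 'I_(size Q) -> G, injective w1 -> injective w2 ->
    #|[pred i | w1 i \notin Q]|%:R <= k * (size Q)%:R ->
    #|[pred i | w2 i \notin Q]|%:R <= k * (size Q)%:R ->
    `|\det (mxw fs w1 w2)| <= (Nsep (solution fs) Q e0)%:R * expR (d * (size Q)%:R)).
  by apply: det_le_Nsep => //; rewrite /fs lstarK.
have lower d : 0 < d -> windows R (fun Q =>
    expR ((l0 / 2 - d) * (size Q)%:R) <= (Nsep (solution f) Q ef)%:R /\
    expR ((l0 / 2 - d) * (size Q)%:R) <= (Nsep (solution fs) Q eg)%:R).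
  move=> d0; have d2 : 0 < d / 2 by rewrite divr_gt0.
  have [kf kf0 Hf'] := Hf _ d2; have [kg kg0 Hg'] := Hg _ d2.
  have [kb kb0 Hb] := binomial_small d2.
  pose n : R := (size (sinv fs)).+1%:R.
  pose k := Num.min kf (Num.min kg kb) / n.
  have m0 : 0 < Num.min kf (Num.min kg kb) by rewrite !lt_min kf0 kg0.
  have k0 : 0 < k by rewrite divr_gt0.
  apply: filterS (filterI (filterI Hf' Hg') (filterI (Hl _ d2) (near_invariant (sinv fs) k0))).
  move=> Q [[hf hg] [hl Qi]]; have [uQ Q0 _] := Qi.
  pose M := mxop fs (w Q) Q.
  have szw : (size (w Q) = size Q + size [seq c <- wmul Q (sinv fs) | c \notin Q])%N.
    exact: size_cat.
  have szQ : (size Q <= size (w Q))%N by rewrite szw leq_addr.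
  have new : (size [seq c <- wmul Q (sinv fs) | c \notin Q])%:R <=
      Num.min kf (Num.min kg kb) * (size Q)%:R.
    apply: le_trans (size_filter_wmul (ltW k0) Qi) _; rewrite ler_wpM2r//.
    rewrite /k mulrCA ler_piMr ?(ltW m0)// ler_pdivrMr// mul1r ler_nat.
    exact: leqnSn.
  have [h hI Hh] := exists_large_minor M szQ.
  pose w1 i := nth 1%g (w Q) (h i); pose w2 (i : 'I_(size Q)) := nth 1%g Q i.
  have w1I : injective w1.
    move=> i j /eqP; rewrite /w1 nth_uniq ?uw// => /eqP /val_inj; exact: hI.
  have w2I : injective w2.
    by move=> i j /eqP; rewrite /w2 nth_uniq// => /eqP /val_inj.
  have c1 : (#|[pred i | w1 i \notin Q]| <= size [seq c <- wmul Q (sinv fs) | c \notin Q])%N.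
    apply: (count_pred_image w1I) => i iQ; have : w1 i \in w Q by rewrite mem_nth.
    by move: iQ; rewrite inE mem_cat => /negbTE->.
  have c2 : #|[pred i | w2 i \notin Q]| = 0%N.
    by apply: eq_card0 => i; rewrite inE mem_nth.
  have E : rowsub h M = mxw fs w1 w2 by apply/matrixP => i j; rewrite !mxE.
  (* The same minor serves both sides: transposing it exchanges rows with columns and [fs] with
     [f]. *)
  have E' : `|\det (mxw f w2 w1)| = `|\det (mxw fs w1 w2)|.
    rewrite -det_tr; congr (`|\det _|); apply/matrixP => i j; rewrite !mxE.
    by rewrite lop_dltC.
  have b1 k' : Num.min kf (Num.min kg kb) <= k' ->
      #|[pred i | w1 i \notin Q]|%:R <= k' * (size Q)%:R.
    move=> kk; apply: (@le_trans _ _ (Num.min kf (Num.min kg kb) * (size Q)%:R)).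
      by apply: le_trans new; rewrite ler_nat.
    by rewrite ler_wpM2r.
  have bf := hf w2 w1 w2I w1I _ (b1 _ _); have bg := hg w1 w2 w1I w2I (b1 _ _) _.
  have big : expR ((l0 / 2 - d / 2) * (size Q)%:R) <= `|\det (mxw fs w1 w2)|.
    rewrite -(@ler_pXn2r _ 2)// ?nnegrE ?expR_ge0// -expRM_natr real_normK ?num_real//.
    have := Hh; rewrite E -aE// -/(minor a Q) gtr0_norm ?minor_gt0// minorE// szw => Hh'.
    have Hb' : 'C(size Q + size [seq c <- wmul Q (sinv fs) | c \notin Q], size Q)%:R <=
        expR (d / 2 * (size Q)%:R).
      apply: Hb; apply: le_trans new _; rewrite ler_wpM2r//.
      by rewrite !ge_min lexx !orbT.
    have := le_trans Hh' (ler_wpM2r (sqr_ge0 _) Hb'); rewrite -ler_pdivrMl ?expR_gt0// -expRN -expRD.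
    apply: le_trans; rewrite ler_expR; move: hl; rewrite ler_norml => /andP[hl _]; lra.
  have sE : expR ((l0 / 2 - d / 2) * (size Q)%:R) =
      expR ((l0 / 2 - d) * (size Q)%:R) * expR (d / 2 * (size Q)%:R).
    by rewrite -expRD; congr expR; field.
  split; rewrite -(ler_pM2r (expR_gt0 (d / 2 * (size Q)%:R))) -sE; apply: le_trans big _.
    rewrite -E'; apply: bf; rewrite ?c2 ?mulr_ge0 ?(ltW kf0)//.
    by rewrite ge_min lexx.
  apply: bg; rewrite ?c2 ?mulr_ge0 ?(ltW kg0)//.
  by rewrite !ge_min lexx orbT.
(* The upper bound for one factor is that of the product divided by the lower bound for the
   other. *)
have half (P P' : set (G -> R)) (e0 : R) : 0 < e0 ->
    (forall e : R, 0 < e -> exists2 e' : R, 0 < e' & forall d : R, 0 < d ->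
      windows R (fun Q => (Nsep P Q e)%:R * (Nsep P' Q e)%:R <=
        (Nsep (solution a) Q e')%:R * expR (d * (size Q)%:R))) ->
    (forall d, 0 < d -> windows R (fun Q => expR ((l0 / 2 - d) * (size Q)%:R) <= (Nsep P' Q e0)%:R)) ->
    forall e d, 0 < e -> 0 < d ->
      windows R (fun Q => (Nsep P Q e)%:R <= expR ((l0 / 2 + d) * (size Q)%:R)).
  move=> e00 Hm Hl' e d e_0 d0; pose e1 := Num.min e e0.
  have e10 : 0 < e1 by rewrite lt_min e_0.
  have d3 : 0 < d / 3 by rewrite divr_gt0.
  have [e2 e20 He2] := Hm _ e10.
  apply: filterS3 (He2 _ d3) (upper _ _ e20 d3) (Hl' _ d3) => Q h1 h2 h3.
  have h4 : expR ((l0 / 2 - d / 3) * (size Q)%:R) <= (Nsep P' Q e1)%:R.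
    by apply: le_trans h3 _; rewrite ler_nat Nsep_le// ge_min lexx orbT.
  apply: (@le_trans _ _ (Nsep P Q e1)%:R); first by rewrite ler_nat Nsep_le// ge_min lexx.
  rewrite -(ler_pM2r (expR_gt0 ((l0 / 2 - d / 3) * (size Q)%:R))).
  apply: le_trans (ler_wpM2l (ler0n R _) h4) _; apply: le_trans h1 _.
  apply: le_trans (ler_wpM2r (expR_ge0 _) h2) _.
  by rewrite -!expRD ler_expR -!mulrDl ler_wpM2r//; lra.
have fss : left_inv (lstar fs) by rewrite /fs lstarK.
have mul_ge := Nsep_mul_ge fZ fsZ fss.
have lowf (d : R) : 0 < d ->
    windows R (fun Q => expR ((l0 / 2 - d) * (size Q)%:R) <= (Nsep (solution f) Q ef)%:R).
  by move=> /lower; apply: filterS => Q [].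
have lowfs (d : R) : 0 < d ->
    windows R (fun Q => expR ((l0 / 2 - d) * (size Q)%:R) <= (Nsep (solution fs) Q eg)%:R).
  by move=> /lower; apply: filterS => Q [].
exists (l0 / 2); split; first by rewrite divr_ge0.
  by split; [exact: half _ (solution fs) _ eg0 mul_ge lowfs | exists ef].
split; last by exists eg.
apply: half _ (solution f) _ ef0 _ lowf => e /mul_ge[e' e'0 H]; exists e' => // d /H.
by apply: filterS => Q; rewrite mulrC.
Qed.

End Growth.

(** * Entropy as a growth rate *)

Section Entropy.
Variables (R : realType) (G : groupType).
Implicit Types (f : group_ring G) (x y : G -> R) (c : G) (S T Q : seq G).

Lemma nearZ_closed (t : R) : (forall e, 0 < e -> nearZ e t) -> t \is a Num.int.
Proof.
move=> H; have e4 : 0 < 4^-1 :> R by rewrite invr_gt0.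
have [m tm] := H _ e4; suff -> : t = m%:~R by exact: intr_int.
apply/eqP; rewrite -subr_eq0 -normr_eq0 eq_le normr_ge0 andbT leNgt; apply/negP => r0.
have [n tn] := H _ (divr_gt0 r0 (ltr0n R 2)).
have E : (m%:~R - n%:~R : R) = 0.
  apply: int_small; first by rewrite rpredB ?intr_int.
  have -> : m%:~R - n%:~R = (t - n%:~R) - (t - m%:~R) by ring.
  by apply: le_lt_trans (ler_normB _ _) _; lra.
by move: tn; rewrite -(subr0_eq E); lra.
Qed.

Lemma lifts_round f x y (q : Xspace R f) :
  lifts y q -> lifts (fun c => y c + (round (x c - y c))%:~R) q.
Proof. by move=> yq c; rewrite -yq; apply/cpi_eq; rewrite addrAC subrr add0r intr_int. Qed.

(** Lebesgue's number lemma, by contradiction: solutions for which no member of [V] works would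
    accumulate at a solution, and the member of [V] around it works for nearby ones. *)
Lemma lebesgue_number f (V : set (set (Xspace R f))) : open_cover V ->
  exists S (e : R), 0 < e /\ forall x, solution (grlist R f) x -> exists2 U, V U &
    forall (q : Xspace R f) y, lifts y q -> (forall c, c \in S -> nearZ e (x c - y c)) -> U q.
Proof.
move=> [Vo Vc]; apply: contrapT => H.
pose P S e := [set x : {ptws G -> R^o} | [/\ forall c, `|x c| <= 1, solution (grlist R f) x &
  forall U, V U -> exists (q : Xspace R f) y,
    [/\ lifts y q, forall c, c \in S -> nearZ e (x c - y c) & ~ U q]]].
have [|||x [x1 Hx]] := @cube_cluster R G 1 P.
- move=> S e e0; apply: contrapT => H'; apply: H; exists S, e; split=> // x xs.
  apply: contrapT => HU; apply: H'; exists (fun c => frac (x c)); split=> [c||U VU].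
  + by have /andP[h1 h2] := frac_itv (x c); rewrite ger0_norm// ltW.
  + exact: solution_frac (intlist_gr _ _) xs.
  apply: contrapT => Hq; apply: HU; exists U => // q y yq xy; apply: contrapT => nU.
  apply: Hq; exists q, y; split=> // c cS.
  have := xy c cS; rewrite -(nearZ_add_int _ _ (frac_int (x c))).
  by rewrite addrC addrA subrK.
- move=> T T' h h' TT hh x [x1 xs HV]; split=> // U /HV[q [y [yq xy nU]]].
  by exists q, y; split=> // c /TT /xy; exact: nearZ_le.
- by move=> T h x [].
have xs : solution (grlist R f) x.
  move=> c; apply: nearZ_closed => e e0; pose n := l1norm (grlist R f) + 1.
  have n0 : 0 < n by rewrite ltr_wpDl.
  have [y [_ ys _] xy] := Hx [::] 1 [seq (c * p.2)%g | p <- grlist R f] _ ltr01 (divr_gt0 e0 n0).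
  have /intrP[m ym] := ys c; exists m; rewrite -ym.
  apply: le_trans (lop_close (fun d dS => ltW (xy d dS))) _.
  by rewrite mulrCA ler_piMr ?(ltW e0)// ler_pdivrMr// mul1r lerDl.
have [U VU Uq] : (\bigcup_(U in V) U) (of_solution xs) by rewrite Vc.
have [S [e [e0 He]]] := open_Xspace_box (Vo _ VU) Uq (lifts_of_solution xs).
(* Two errors [h] add up to less than [e], and to less than 1/2 so that [round] yields a lift near
   [x]. *)
pose h := Num.min (e / 4) 8^-1.
have h0 : 0 < h by rewrite lt_min divr_gt0//= invr_gt0.
have he : h <= e / 4 by rewrite ge_min lexx.
have h8 : h <= 8^-1 by rewrite ge_min lexx orbT.
have [y [_ _ HV] xy] := Hx S h S h h0 h0.
have [q [z [zq yz nU]]] := HV U VU; apply: nU; apply: He (lifts_round x zq) _ => c cS.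
have : nearZ (h + h) (x c - z c).
  apply: nearZ_triangle (yz c cS); exists 0; rewrite subr0; exact: ltW (xy c cS).
move=> /round_near; rewrite opprD addrA => near.
by apply: le_lt_trans (near _) _; lra.
Qed.

Section UpperBound.
Variables (f : group_ring G) (l : R) (F : nat -> {fset G}).
Hypotheses (l0 : 0 <= l) (FF : folner R F).

Let up (e d : R) := windows R
  (fun Q => (Nsep (solution (grlist R f)) Q e)%:R <= expR ((l + d) * (size Q)%:R)).

Lemma size_wmul_le T d : 0 < d ->
  windows R (fun Q => (l + d / 2) * (size (wmul Q T))%:R <= (l + d) * (size Q)%:R).
Proof.
move=> d0; have d2 : 0 < d / 2 by rewrite divr_gt0.
have ld0 : 0 < l + d / 2 by rewrite ltr_wpDl.
pose n : R := (size T).+1%:R; have n0 : 0 < n by rewrite ltr0n.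
pose k := d / 2 / (l + d / 2) / n; have k0 : 0 < k by rewrite !divr_gt0.
apply: filterS (near_invariant T k0) => Q Qi; have [uQ _ _] := Qi.
have h1 := size_filter_wmul (ltW k0) Qi.
have h2 : (size [seq c <- wmul Q T | c \in Q] <= size Q)%N.
  apply: uniq_leq_size; first by rewrite filter_uniq ?undup_uniq.
  by move=> c; rewrite mem_filter => /andP[].
have h3 : (size T)%:R * k * (l + d / 2) <= d / 2.
  have -> : (size T)%:R * k * (l + d / 2) = d / 2 * ((size T)%:R / n).
    move: (lt0r_neq0 ld0) (lt0r_neq0 n0); rewrite /k.
    move: (l + d / 2) (n) => u v u0 v0.
    by field; rewrite u0 v0.
  by rewrite ler_piMr ?(ltW d2)// ler_pdivrMr// mul1r ler_nat.
have h4 : (size (wmul Q T))%:R <= (size Q)%:R + (size T)%:R * k * (size Q)%:R.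
  rewrite -[X in X%:R <= _](count_predC (mem Q)) natrD -!size_filter; apply: lerD => //.
  by rewrite ler_nat.
apply: le_trans (ler_wpM2l (ltW ld0) h4) _.
have := ler_wpM2r (ler0n R (size Q)) h3.
by rewrite !mulrDr !mulrDl; lra.
Qed.

(** Each member of a spanning family gives one member of the join: at [c], take the set that
    [lebesgue_number] attaches to the translated solution. Spanning on the thickened window makes
    these sets a cover. *)
Lemma min_subcover_le V (d : R) : open_cover V -> 0 < d ->
  (forall e d, 0 < e -> 0 < d -> up e d) ->
  \forall n \near \oo, (min_subcover R (cover_join (alpha R f) (F n) V) <=
    (expR ((l + d) * #|` F n|%:R))%:E)%E.
Proof.
move=> oV d0 Hup; have [S [e [e0 He]]] := lebesgue_number oV.
have d2 : 0 < d / 2 by rewrite divr_gt0.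
(* Adding the identity makes [K] nonempty, as [wmul_windows] requires. *)
pose K := 1%g :: S.
have H : windows R (fun Q => (Nsep (solution (grlist R f)) (wmul Q K) e)%:R <=
    expR ((l + d) * (size Q)%:R)).
  have h1 := @wmul_windows R G K isT _ (Hup _ _ e0 d2).
  apply: filterS2 h1 (size_wmul_le K d0) => Q h1 h2.
  by apply: le_trans h1 _; rewrite ler_expR.
apply: filterS (folner_windows FF H) => n; rewrite size_map => Hn.
set W := wmul _ _ in Hn; have [s [sP _ span]] := spanning_family (solution (grlist R f)) W e0.
have trans i c : solution (grlist R f) (fun d => s i (c^-1 * d)%g).
  by move=> d'; rewrite lop_translate; exact: sP.
pose U i c := projT1 (cid2 (He _ (trans i c))).
have UV i c : V (U i c) by rewrite /U; case: cid2.
have HU i c : forall (q : Xspace R f) y, lifts y q ->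
    (forall k, k \in S -> nearZ e (s i (c^-1 * k)%g - y k)) -> U i c q.
  by rewrite /U; case: cid2.
pose O i := \bigcap_(c in [set` F n]) (alpha R f c @^-1` U i c).
apply: (@le_trans _ _ (#|` [fset O i | i in 'I_(Nsep (solution (grlist R f)) W e)]%fset|%:R)%:E).
  apply: ereal_inf_lbound; exists [fset O i | i in 'I_(Nsep (solution (grlist R f)) W e)]%fset => //.
  split=> [A /= /imfsetP[i _ ->]|].
    by exists (U i) => // c _.
  apply/seteqP; split=> // q _; have [x xq _] := exists_lift q.
  have [i Hi] := span x (lifts_solution xq).
  exists (O i); first by apply/imfsetP; exists i.
  move=> c cF; apply: HU (lifts_alpha c xq) _ => k kS; apply: nearZ_sym; apply: Hi.
  by apply: mem_wmul; [exact: map_f|rewrite inE kS orbT].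
rewrite lee_fin; apply: le_trans Hn; rewrite ler_nat.
by apply: leq_trans (leq_imfset_card _ _ _) _; rewrite -cardE card_ord.
Qed.

End UpperBound.

Definition arcs f (e : R) : set (set (Xspace R f)) :=
  [set [set q : Xspace R f | exists2 t, cpi t = \val q 1%g & `|t - u| < e] | u in [set: R]].

Arguments arcs : clear implicits.

Lemma open_cover_arcs f (e : R) : 0 < e -> open_cover (arcs f e).
Proof.
move=> e0; split=> [U [u _ <-]|]; first exact: open_Xspace_arc.
apply/seteqP; split=> // q _; have [x xq _] := exists_lift q.
exists [set q : Xspace R f | exists2 t, cpi t = \val q 1%g & `|t - x 1%g| < e].
  by exists (x 1%g).
by exists (x 1%g) => //; rewrite subrr normr0.
Qed.

(** Two points in one member of the join lie, for each [c] in [B], in a common arc of radius [e / 2]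
    at the coordinate [c^-1]. So [e]-separated solutions need different members. *)
Lemma Nsep_le_min_subcover f (e : R) (B : {fset G}) : 0 < e ->
  ((Nsep (solution (grlist R f)) (winv B) e)%:R%:E <=
    min_subcover R (cover_join (alpha R f) B (arcs f (e / 2))))%E.
Proof.
move=> e0; apply: le_ereal_inf_tmp => _ [W [WV Wc] <-]; rewrite lee_fin ler_nat.
have [s [sP ssep]] := Nsep_has (solution (grlist R f)) (winv B) e.
have HO i : exists2 A, A \in W & A (of_solution (sP i)).
  by have [A AW AO] : (\bigcup_(A in [set` W]) A) (of_solution (sP i)) by [rewrite Wc|]; exists A.
pose A i := projT1 (cid2 (HO i)).
have AW i : A i \in W by rewrite /A; case: cid2.
have AO i : A i (of_solution (sP i)) by rewrite /A; case: cid2.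
have AI : injective A.
  move=> i j Aij; apply/eqP; apply: contrapT => /negP ij.
  have [c /mapP[d dB ->] ncd] := ssep i j ij; apply: ncd.
  have [u uV AE] := WV _ (AW i).
  have [v _ vE] := uV d dB.
  have := AO i; have := AO j; rewrite -Aij AE => /(_ d dB) + /(_ d dB).
  rewrite /= -vE /= mulg1 => -[t /cpi_eq tj tv] [t' /cpi_eq ti t'v].
  have near (t0 a : R) : t0 - a \is a Num.int -> `|t0 - v| < e / 2 -> nearZ (e / 2) (v - a).
    move=> t0a /ltW t0v; rewrite -[v](subrK t0) -addrA nearZ_add_int//.
    by exists 0; rewrite subr0 distrC.
  rewrite [e]splitr; apply: (nearZ_triangle _ (near _ _ tj tv)).
  by apply: nearZ_sym; exact: near ti t'v.
have -> : Nsep (solution (grlist R f)) (winv B) e = #|` [fset A i | i in 'I_(Nsep (solution (grlist R f)) (winv B) e)]%fset|.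
  by rewrite card_imfset//= -cardE card_ord.
by apply: fsubset_leq_card; apply/fsubsetP => _ /imfsetP[i _ ->].
Qed.

Lemma min_subcover_ge0 (T : Type) (V : set (set T)) : (0 <= min_subcover R V)%E.
Proof. by apply: le_ereal_inf_tmp => _ [W _ <-]; rewrite lee_fin. Qed.

Lemma normalized_lne_le (k c : R) (m : \bar R) : 0 < k -> (0 <= m)%E ->
  (m <= (expR (c * k))%:E)%E -> ((k^-1)%:E * lne m <= c%:E)%E.
Proof.
move=> k0 m0 mk; have : (lne m <= (c * k)%:E)%E.
  by rewrite -[leRHS]expeRK; rewrite lee_lne/= ?in_itv/= ?leey ?m0 ?lee_fin ?expR_ge0.
move=> /(lee_wpmul2l (_ : 0 <= (k^-1)%:E)%E) H; apply: le_trans (H _) _.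
  by rewrite lee_fin invr_ge0 ltW.
by rewrite -EFinM lee_fin mulrC mulfK ?gt_eqF.
Qed.

Lemma normalized_lne_ge (k c : R) (m : \bar R) : 0 < k ->
  ((expR (c * k))%:E <= m)%E -> (c%:E <= (k^-1)%:E * lne m)%E.
Proof.
move=> k0 mk; have : ((c * k)%:E <= lne m)%E.
  rewrite -[leLHS]expeRK; rewrite lee_lne/= ?in_itv/= ?leey ?lee_fin ?expR_ge0//.
  by rewrite andbT; apply: le_trans mk; rewrite lee_fin expR_ge0.
move=> /(lee_wpmul2l (_ : 0 <= (k^-1)%:E)%E) H; apply: le_trans (H _).
  by rewrite -EFinM lee_fin mulrC mulfK ?gt_eqF.
by rewrite lee_fin invr_ge0 ltW.
Qed.

(* A divergent sequence of extended reals has the junk limit 0, which is below l. *)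
Lemma entropy_growth f l F : folner R F -> 0 <= l -> growth (grlist R f) l ->
  entropy R F (alpha R f) = l%:E.
Proof.
move=> FF l0 [up [e e0 low]].
have card_gt0 n : 0 < #|` F n|%:R :> R by rewrite ltr0n cardfs_gt0 (FF.1 n).
pose u V n := ((#|` F n|%:R^-1)%:E * lne (min_subcover R (cover_join (alpha R f) (F n) V)))%E.
have u_le V (d : R) : open_cover V -> 0 < d -> \forall n \near \oo, (u V n <= (l + d)%:E)%E.
  move=> oV d0; apply: filterS (min_subcover_le l0 FF oV d0 up) => n.
  by apply: normalized_lne_le => //; exact: min_subcover_ge0.
have u_ge (d : R) : 0 < d -> \forall n \near \oo, ((l - d)%:E <= u (arcs f (e / 2)) n)%E.
  move=> d0; apply: filterS (folner_windows FF (low _ d0)) => n.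
  rewrite size_map => H; apply: normalized_lne_ge => //.
  by apply: le_trans (Nsep_le_min_subcover _ _ e0); rewrite lee_fin.
apply/eqP; rewrite eq_le; apply/andP; split.
  apply: ge_ereal_sup => _ [V oV <-]; rewrite -/(u V).
  have [cu|ncu] := pselect (cvgn (u V)); last by rewrite dvgP.
  apply/lee_addgt0Pr => d d0; rewrite -EFinD.
  by apply: lime_le => //; exact: u_le.
apply: ereal_sup_ubound; exists (arcs f (e / 2)).
  by apply: open_cover_arcs; rewrite divr_gt0.
have e2 : 0 < e / 2 by rewrite divr_gt0.
apply: cvg_lim => //; rewrite -/(u _).
have bounds (d : R) : 0 < d -> \forall n \near \oo, [/\ u (arcs f (e / 2)) n \is a fin_num,
    l - d <= fine (u (arcs f (e / 2)) n) & fine (u (arcs f (e / 2)) n) <= l + d].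
  move=> d0; have h := u_le _ _ (open_cover_arcs f e2) d0.
  apply: filterS2 (u_ge _ d0) h => n.
  by case: (u _ n).
apply/fine_cvgP; split; first by apply: filterS (bounds _ ltr01) => n [].
apply/cvgrPdist_le => d /bounds; apply: filterS => n [_ h1 h2] /=.
by rewrite distrC ler_distl h1.
Qed.

End Entropy.

Lemma eq_left_inv (R : realType) (G : groupType) (a b : seq (R * G)) :
  (forall x c, lop a x c = lop b x c) -> left_inv a -> left_inv b.
Proof.
move=> ab [u [r [r1 H]]]; exists u, r; split=> // x c.
by rewrite -H; apply: eq_lop => d; rewrite ab.
Qed.

Lemma expansive_growth (R : realType) (G : groupType) (f : group_ring G) :
  amenable R G -> expansive (Xspace_zero R f) (alpha R f) ->
  [/\ left_inv (grlist R f), left_inv (lstar (grlist R f)) & exists l, [/\ 0 <= l,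
    growth (grlist R f) l & growth (lstar (grlist R f)) l]].
Proof.
move=> GA fe.
have fi := left_inv_of_injective (expansive_injective fe).
have fi' := left_inv_star (amenable_windows_proper GA) fi.
by split=> //; exact: growth_star (intlist_gr _ _) fi fi'.
Qed.

Theorem corollary5p8 (R : realType) (G : groupType) (f g : group_ring G) :
  countable [set: G] -> residually_finite G -> amenable R G ->
  expansive (Xspace_zero R f) (alpha R f) ->
  expansive (Xspace_zero R g) (alpha R g) ->
  [/\ expansive (Xspace_zero R (gr_star f)) (alpha R (gr_star f)),
      expansive (Xspace_zero R (gr_mul f g)) (alpha R (gr_mul f g)) &
      forall F : nat -> {fset G}, folner R F ->
        entropy R F (alpha R (gr_star f)) = entropy R F (alpha R f) /\
        entropy R F (alpha R (gr_mul f g)) =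
          (entropy R F (alpha R f) + entropy R F (alpha R g))%E].
Proof.
move=> _ _ GA /(expansive_growth GA)[fi fi' [l [l0 fl fl']]].
move=> /(expansive_growth GA)[gi gi' [l' [l'0 gl _]]].
have star x c : lop (lstar (grlist R f)) x c = lop (grlist R (gr_star f)) x c.
  by rewrite lop_gr_star.
have mul x c : lop (lmul (grlist R f) (grlist R g)) x c = lop (grlist R (gr_mul f g)) x c.
  by rewrite lop_gr_mul lop_mul.
split; first exact: left_inv_expansive (eq_left_inv star fi').
  exact: left_inv_expansive (eq_left_inv mul (left_inv_mul fi gi)).
move=> F FF.
rewrite (entropy_growth FF l0 fl) (entropy_growth FF l'0 gl); split.
  exact: entropy_growth FF l0 (eq_growth star fl').
rewrite -EFinD; apply: entropy_growth FF (addr_ge0 l0 l'0) _.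
apply: eq_growth mul _; apply: growth_mul fl gl => //; exact: intlist_gr.
Qed.
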